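(* Let $(\mathcal{T}_{\rm Br},\mu_{\rm Br})$ be the Brownian Continuum Random Tree with its mass measure. The measured tree $(\mathcal{T}_{\rm Br},\mu_{\rm Br})$ is a measurable function of the unmeasured tree $\mathcal{T}_{\rm Br}$; that is, there is a measurable map $\Phi$ from the space of isometry classes of compact rooted real trees (with the Gromov-Hausdorff Borel $\sigma$-algebra) to the space of measure-preserving isometry classes of compact rooted real trees equipped with a Borel probability measure (with the Gromov-Hausdorff-Prokhorov Borel $\sigma$-algebra) such that $\Phi(\mathcal{T}_{\rm Br})=(\mathcal{T}_{\rm Br},\mu_{\rm Br})$ almost surely.
   Context: For continuous $h\colon[0,1]\to[0,\infty)$ with $h(0)=h(1)=0$, let $d_h(s,t)=h(s)+h(t)-2\min_{[s\wedge t,s\vee t]}h$. The tree $T_h$ is the quotient of $[0,1]$ by the relation $d_h(s,t)=0$, equipped with the metric $d_h$, rooted at the class of $0$, and $\mu_h$ is the push-forward of Lebesgue measure on $[0,1]$ under the quotient map. The Brownian CRT $(\mathcal{T}_{\rm Br},\mu_{\rm Br})$ is $(T_h,d_h,\rho_h,\mu_h)$ for $h=2B^{\rm ex}$, where $B^{\rm ex}$ is the normalised excursion (of duration 1) of linear Brownian motion. The unmeasured $\mathcal{T}_{\rm Br}$ is the rooted compact metric space $(T_h,d_h,\rho_h)$. For compact pointed metric spaces, $d_{\rm GH}((T,d,\rho),(T',d',\rho'))=\inf\{d_{\rm H}^Z(\Phi(T),\Phi'(T'))+d^Z(\Phi(\rho),\Phi'(\rho'))\}$ and, with Borel probability measures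 $\mu,\mu'$, $d_{\rm GHP}$ is the infimum of $d_{\rm H}^Z(\Phi(T),\Phi'(T'))+d^Z(\Phi(\rho),\Phi'(\rho'))+d_{\rm P}^Z(\Phi_*\mu,\Phi'_*\mu')$; the infima are over isometric embeddings $\Phi,\Phi'$ into a common Polish metric space $(Z,d^Z)$, with $d_{\rm H}^Z$, $d_{\rm P}^Z$ the Hausdorff and Prokhorov distances. *)

(* Defs.v *)
From HB Require Import structures.
From mathcomp Require Import all_boot all_order all_algebra.
From mathcomp Require Import all_classical all_reals all_analysis.
From mathcomp Require Import lra.

Set Implicit Arguments.
Unset Strict Implicit.
Unset Printing Implicit Defensive.

Import Order.TTheory GRing.Theory Num.Theory.
Import numFieldNormedType.Exports.

Local Open Scope classical_set_scope.
Local Open Scope ring_scope.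

(* [point] is the root. *)
#[short(type="pointedMetricType")]
HB.structure Definition PointedMetric (K : numDomainType) :=
  {T of Pointed T & Metric K T}.

Definition borel {R : realType} (T : pointedMetricType R) :=
  g_sigma_algebraType (@open T).

Section RealTrees.
Context {R : realType}.

Definition geodesic (T : metricType R) (x y : T) (f : R -> T) : Prop :=
  [/\ f 0 = x, f (mdist x y) = y &
      {in `[0, mdist x y] &, forall s t, mdist (f s) (f t) = `|s - t|}].

Definition real_tree (T : metricType R) : Prop :=
  forall x y : T,
    [/\ exists f, geodesic x y f,
        forall f g, geodesic x y f -> geodesic x y g ->
          {in `[0, mdist x y], f =1 g} &
        forall f (q : R -> T), geodesic x y f ->
          {within `[0, 1], continuous q} -> {in `[0, 1] &, injective q} ->
          q 0 = x -> q 1 = y -> q @` `[0, 1] = f @` `[0, mdist x y]].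

End RealTrees.

Record rtree (R : realType) := RTree {
  rtree_car :> pointedMetricType R ;
  rtree_compact : compact [set: rtree_car] ;
  rtree_real_tree : real_tree rtree_car }.

Record mrtree (R : realType) := MRTree {
  mrtree_tree :> rtree R ;
  mass : probability (borel mrtree_tree) R }.

Section GromovHausdorff.
Context {R : realType}.

Definition rooted_isometry (T T' : pointedMetricType R) (f : T -> T') : Prop :=
  [/\ bijective f, forall x y, mdist (f x) (f y) = mdist x y &
      f point = point].

Definition isometric (T T' : rtree R) : Prop :=
  exists f : T -> T', rooted_isometry f.

Definition misometric (T T' : mrtree R) : Prop :=
  exists2 f : T -> T', rooted_isometry f &
    forall A : set (borel T'), measurable A ->
      mass T' A = mass T (f @^-1` A).

Definition rtree_class : Type :=
  {C : set (rtree R) | exists T, C = [set T' | isometric T T']}.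

Definition mrtree_class : Type :=
  {C : set (mrtree R) | exists T, C = [set T' | misometric T T']}.

Definition rtree_cls (T : rtree R) : rtree_class :=
  exist _ [set T' | isometric T T'] (ex_intro _ T erefl).

Definition mrtree_cls (T : mrtree R) : mrtree_class :=
  exist _ [set T' | misometric T T'] (ex_intro _ T erefl).

Definition polish (Z : metricType R) : Prop :=
  (forall F : set_system Z, ProperFilter F -> cauchy F -> exists z : Z, F --> z) /\
  (exists2 D : set Z, countable D & dense D).

Definition embedding (T Z : metricType R) (f : T -> Z) : Prop :=
  forall x y, mdist (f x) (f y) = mdist x y.

Definition fattening (Z : metricType R) (A : set Z) (e : R) : set Z :=
  [set z | exists2 a, A a & mdist a z < e].

Definition hausdorff_dist (Z : metricType R) (A B : set Z) : R :=
  inf [set e | [/\ 0 < e, A `<=` fattening B e & B `<=` fattening A e]].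

(* [mu] and [nu] are measures on the Borel sets of [Z], as set functions. *)
Definition prokhorov_dist (Z : metricType R) (mu nu : set Z -> \bar R) : R :=
  inf [set e | 0 < e /\ forall A : set Z, <<s @open Z >> A ->
    (mu A <= nu (fattening A e) + e%:E)%E /\
    (nu A <= mu (fattening A e) + e%:E)%E].

Definition GH_dist (T T' : pointedMetricType R) : R :=
  inf [set r | exists (Z : metricType R) (f : T -> Z) (f' : T' -> Z),
    [/\ polish Z, embedding f, embedding f' &
        r = hausdorff_dist (range f) (range f') + mdist (f point) (f' point)]].

Definition GHP_dist (T T' : mrtree R) : R :=
  inf [set r | exists (Z : metricType R) (f : T -> Z) (f' : T' -> Z),
    [/\ polish Z, embedding f, embedding f' &
        r = hausdorff_dist (range f) (range f') + mdist (f point) (f' point) +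
            prokhorov_dist (fun A => mass T (f @^-1` A))
                           (fun A => mass T' (f' @^-1` A))]].

(* Open sets for the distance that [GH_dist] induces on isometry classes; it  *)
(* is well defined there, as [GH_dist] is invariant under [isometric].        *)
Definition GH_open (U : set rtree_class) : Prop :=
  forall T : rtree R, U (rtree_cls T) ->
    exists2 e : R, 0 < e &
      forall T' : rtree R, GH_dist T T' < e -> U (rtree_cls T').

Definition GHP_open (U : set mrtree_class) : Prop :=
  forall T : mrtree R, U (mrtree_cls T) ->
    exists2 e : R, 0 < e &
      forall T' : mrtree R, GHP_dist T T' < e -> U (mrtree_cls T').

Definition GH_GHP_measurable (Phi : rtree_class -> mrtree_class) : Prop :=
  forall B, <<s GHP_open >> B -> <<s GH_open >> (Phi @^-1` B).

End GromovHausdorff.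

Arguments rtree_class R : clear implicits.
Arguments mrtree_class R : clear implicits.

(* Only the values on [0, 1] matter. *)
Record coding_fun (R : realType) := CodingFun {
  coding_val :> R -> R ;
  coding_continuous : {within `[0, 1], continuous coding_val} ;
  coding_ge0 : {in `[0, 1], forall t, 0 <= coding_val t} ;
  coding0 : coding_val 0 = 0 ;
  coding1 : coding_val 1 = 0 }.
Section FourPoint.
Context {R : realType} (T : metricType R).
Local Notation d := (@mdist R T).

Definition four_point : Prop := forall x y z w : T,
  d x y + d z w <= d x z + d y w \/ d x y + d z w <= d x w + d y z.

Lemma within_continuous_mdist (a b : R) (q : R -> T) :
  {within `[a, b], continuous q} ->
  forall s e, a <= s <= b -> 0 < e ->
    exists2 r, 0 < r & forall t, a <= t <= b -> `|s - t| < r ->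
      d (q s) (q t) < e.
Proof.
move=> /subspace_continuousP qc s e sab e0.
have sA : `[a, b]%classic s by rewrite /= in_itv.
have /metricType_numDomainType.cvgrPdist_lt /(_ e e0) := qc _ sA.
case=> r /= r0 H; exists r => // t tab st.
by apply: H => //=; rewrite in_itv.
Qed.

End FourPoint.

Section FourPointTree.
Context {R : realType} (T : metricType R).
Local Notation d := (@mdist R T).
Hypothesis fpc : four_point T.

Lemma between_unique (x y z w : T) : d x z + d z y = d x y ->
  d x w = d x z -> d w y = d z y -> z = w.
Proof.
move=> xzy xw wy; apply: (@mdist_positivity R).
have := fpc x y z w; have := @mdist_ge0 R T z w.
rewrite (metric_sym y w) (metric_sym y z); lra.
Qed.

Lemma path_between (a b : R) (q : R -> T) (z : T) : a <= b ->
  {within `[a, b], continuous q} ->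
  d (q a) z + d z (q b) = d (q a) (q b) ->
  exists2 s, a <= s <= b & q s = z.
Proof.
move=> ab qc azb.
have [//|nz] := pselect (exists2 s, a <= s <= b & q s = z).
have {}nz s : a <= s <= b -> 0 < d (q s) z.
  move=> sab; rewrite mdist_gt0; apply/eqP => sz; apply: nz.
  by exists s.
have cq := within_continuous_mdist qc.
set x := q a in azb *; set y := q b in azb *.
pose p s := d x (q s) - d y (q s).
pose S := [set s | a <= s <= b /\ p s <= d x z - d z y].
have Sa : S a.
  split; rewrite ?lexx// /p mdistxx (metric_sym y) -/x -azb.
  have := @mdist_ge0 R T x z; lra.
have Sub : has_ubound S by exists b => s [/andP[]].
have supS : has_sup S by split => //; exists a.
pose s0 := sup S.
have as0 : a <= s0 by apply: ub_le_sup.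
have s0b : s0 <= b by apply: ge_sup; [exists a|move=> s [/andP[]]].
have s0ab : a <= s0 <= b by rewrite as0.
have s0S : p s0 <= d x z - d z y.
  rewrite leNgt; apply/negP => s0p.
  pose e := (p s0 - (d x z - d z y)) / 2.
  have e0 : 0 < e by rewrite /e divr_gt0// subr_gt0.
  have [r r0 Hr] := cq s0 e s0ab e0.
  have [s Ss s0s] := sup_adherent r0 supS.
  have ss0 : s <= s0 by apply: ub_le_sup.
  have [sab ps] := Ss.
  have sr : `|s0 - s| < r by rewrite ger0_norm ?subr_ge0// -/s0 in s0s *; lra.
  have := Hr s sab sr.
  have := @metric_triangle R T x (q s) (q s0).
  have := @metric_triangle R T y (q s0) (q s).
  rewrite (metric_sym (q s) (q s0)) /e.
  move: ps; rewrite /p; lra.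
have zs0 := nz _ s0ab.
have s0lb : s0 < b.
  rewrite lt_neqAle s0b andbT; apply/eqP => s0E.
  move: s0S; rewrite /p s0E -/y mdistxx -azb => H.
  have := nz b; rewrite ab lexx -/y (metric_sym y) => /(_ isT); lra.
have aft s : s0 < s -> s <= b -> d x z - d z y < p s.
  move=> s0s sb; rewrite ltNge; apply/negP => ps.
  have : s <= s0 by apply: ub_le_sup => //; split => //; rewrite sb andbT; lra.
  lra.
have near e : 0 < e -> exists s, [/\ s0 < s, s <= b & d (q s0) (q s) < e].
  move=> e0; have [r r0 Hr] := cq s0 e s0ab e0.
  pose s := Num.min b (s0 + r / 2).
  have s0s : s0 < s by rewrite lt_min s0lb /=; lra.
  have sb : s <= b by rewrite ge_min lexx.
  have ss : s <= s0 + r / 2 by rewrite ge_min lexx orbT.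
  exists s; split => //; apply: Hr; first by rewrite sb andbT; lra.
  by rewrite ltr0_norm ?subr_lt0//; lra.
have s0E : p s0 = d x z - d z y.
  apply/eqP; rewrite eq_le s0S /= leNgt; apply/negP => ps0.
  pose e := ((d x z - d z y) - p s0) / 2.
  have e0 : 0 < e by rewrite /e divr_gt0// subr_gt0.
  have [s [s0s sb qs]] := near e e0.
  have := aft s s0s sb.
  have := @metric_triangle R T x (q s0) (q s).
  have := @metric_triangle R T y (q s) (q s0).
  rewrite (metric_sym (q s) (q s0)) /p.
  move: qs; rewrite /e /p; lra.
have [s [s0s sb qs]] := near _ zs0.
have := aft s s0s sb.
move: s0E; rewrite /p.
have := fpc x y z (q s0).
have := fpc x (q s) y (q s0).
have := fpc x (q s0) y (q s).
have := fpc x y (q s0) (q s).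
have := @metric_triangle R T x z (q s0).
have := @metric_triangle R T y z (q s0).
have := @metric_triangle R T x (q s) (q s0).
have := @metric_triangle R T y (q s) (q s0).
move: qs zs0 azb.
rewrite ?(metric_sym (q s) (q s0)) ?(metric_sym (q s) y)
  ?(metric_sym (q s) x) ?(metric_sym (q s0) y) ?(metric_sym (q s0) x)
  ?(metric_sym z y) ?(metric_sym z (q s0)) ?(metric_sym z x).
lra.
Qed.

Lemma four_point_real_tree :
  (forall x y : T, exists f, geodesic x y f) -> real_tree T.
Proof.
move=> geo x y; split; first exact: geo.
- move=> f g [f0 fD fi] [g0 gD gi] t tD.
  have D0 : 0 \in `[0, d x y] by rewrite in_itv/= lexx mdist_ge0.
  have DD : d x y \in `[0, d x y] by rewrite in_itv/= lexx mdist_ge0.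
  have /andP[t0 tD'] : 0 <= t <= d x y by move: tD; rewrite in_itv.
  have xf : d x (f t) = t by rewrite -f0 fi// sub0r normrN ger0_norm.
  have xg : d x (g t) = t by rewrite -g0 gi// sub0r normrN ger0_norm.
  have yf : d (f t) y = d x y - t.
    by rewrite -{1}fD fi// distrC ger0_norm ?subr_ge0.
  have yg : d (g t) y = d x y - t.
    by rewrite -{1}gD gi// distrC ger0_norm ?subr_ge0.
  apply: (@between_unique x y) => //; rewrite ?xf ?xg ?yf ?yg//; lra.
- move=> f q [f0 fD fi] qc qi q0 q1.
  have D0 : 0 \in `[0, d x y] by rewrite in_itv/= lexx mdist_ge0.
  have DD : d x y \in `[0, d x y] by rewrite in_itv/= lexx mdist_ge0.
  have fxy t : t \in `[0, d x y] -> d x (f t) = t /\ d (f t) y = d x y - t.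
    move=> tD; have /andP[t0 tD'] : 0 <= t <= d x y by move: tD; rewrite in_itv.
    split; first by rewrite -f0 fi// sub0r normrN ger0_norm.
    by rewrite -{1}fD fi// distrC ger0_norm ?subr_ge0.
  apply/seteqP; split => [_ [s /= s01 <-]|_ [t /= tD <-]]; last first.
    have [ft1 ft2] := fxy t tD.
    have [|s s01 <-] := @path_between 0 1 q (f t) ler01 qc.
      by rewrite q0 q1 ft1 ft2 addrC subrK.
    by exists s => //=; rewrite in_itv.
  have /andP[s0 s1] : 0 <= s <= 1 by move: s01; rewrite in_itv.
  pose w := q s; pose t := (d x w + d x y - d w y) / 2.
  have tD : t \in `[0, d x y].
    have := @metric_triangle R T x y w; have := @metric_triangle R T x w y.
    have := @metric_triangle R T w x y; rewrite (metric_sym y w) (metric_sym w x).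
    by rewrite in_itv/= /t => *; apply/andP; split; lra.
  have [ft1 ft2] := fxy t tD.
  pose z := f t.
  have Hz := fpc x y z w.
  have T1 := @metric_triangle R T x z w; have T2 := @metric_triangle R T w z y.
  have xzw : d x z + d z w = d x w.
    move: Hz T1 T2; rewrite (metric_sym y w) (metric_sym y z) ?(metric_sym w z) /z ft1 ft2 /t.
    lra.
  have wzy : d w z + d z y = d w y.
    move: Hz T1 T2; rewrite (metric_sym y w) (metric_sym y z) ?(metric_sym w z).
    rewrite /z ft1 ft2 /t; lra.
  have qc1 : {within `[0, s], continuous q}.
    apply: continuous_subspaceW qc => u /=; rewrite !in_itv/= => /andP[-> us].
    exact: le_trans us s1.
  have qc2 : {within `[s, 1], continuous q}.
    apply: continuous_subspaceW qc => u /=; rewrite !in_itv/= => /andP[us ->].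
    by rewrite (le_trans s0 us).
  have q0z : d (q 0) z + d z (q s) = d (q 0) (q s) by rewrite q0.
  have q1z : d (q s) z + d z (q 1) = d (q s) (q 1) by rewrite q1.
  have [s1' /andP[? ?] qs1] := path_between s0 qc1 q0z.
  have [s2' /andP[? ?] qs2] := path_between s1 qc2 q1z.
  have : s1' = s2'.
    by apply: qi; rewrite ?qs1 ?qs2// in_itv/=; apply/andP; split; lra.
  move=> s12; have ss : s = s1' by lra.
  by exists t => //; rewrite -/z -qs1 ss.
Qed.

End FourPointTree.
Lemma itv_minmaxE (R : realType) (s t v : R) :
  (Num.min s t <= v <= Num.max s t) = (s <= v <= t) || (t <= v <= s).
Proof.
have [st|st] := leP s t; apply/idP/orP => [?|[|] /andP[? ?]].
- by left.
- by apply/andP; split; lra.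
- by apply/andP; split; lra.
- by right.
- by apply/andP; split; lra.
- by apply/andP; split; lra.
Qed.

Section CodeDist.
Context {R : realType} (h : coding_fun R).

(* The infimum is a minimum, by continuity of [h]. *)
Definition code_min (s t : R) : R :=
  inf (h @` `[Num.min s t, Num.max s t]).

Definition code_dist (s t : R) : R := h s + h t - 2 * code_min s t.

Local Notation m := code_min.
Local Notation I x := (0 <= x <= 1).

Lemma code_minC s t : m s t = m t s.
Proof. by rewrite /code_min minC maxC. Qed.

Lemma code_ge0 s : I s -> 0 <= h s.
Proof. by move=> Is; apply: coding_ge0; rewrite in_itv. Qed.

Lemma code_min_le s t u : I s -> I t ->
  Num.min s t <= u <= Num.max s t -> m s t <= h u.
Proof.
move=> /andP[s0 s1] /andP[t0 t1] ust; apply: ge_inf; last first.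
  by exists u => //=; rewrite in_itv.
exists 0 => _ [v /= + <-]; rewrite in_itv/= => /andP[v1 v2].
apply: code_ge0; apply/andP; split.
  by apply: le_trans v1; rewrite le_min s0.
by apply: (le_trans v2); rewrite ge_max s1.
Qed.

Lemma code_min_ge s t c :
  (forall u, Num.min s t <= u <= Num.max s t -> c <= h u) -> c <= m s t.
Proof.
move=> H; apply: lb_le_inf.
  exists (h s), s => //=; rewrite in_itv/=.
  by rewrite ge_min le_max lexx.
by move=> _ [u /= + <-]; rewrite in_itv/= => /H.
Qed.

Lemma code_min_lel s t : I s -> I t -> m s t <= h s.
Proof. by move=> Is It; apply: code_min_le; rewrite // ge_min le_max lexx. Qed.

Lemma code_min_ler s t : I s -> I t -> m s t <= h t.
Proof. by move=> Is It; rewrite code_minC; exact: code_min_lel. Qed.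

Lemma code_minxx s : I s -> m s s = h s.
Proof.
move=> Is; apply/eqP; rewrite eq_le code_min_lel//=.
by apply: code_min_ge => u; rewrite minxx maxxx => /le_anti ->.
Qed.

Lemma code_min_ge0 s t : I s -> I t -> 0 <= m s t.
Proof.
move=> /andP[s0 s1] /andP[t0 t1]; apply: code_min_ge => v /andP[v1 v2].
apply: code_ge0; apply/andP; split.
  by apply: le_trans v1; rewrite le_min s0.
by apply: (le_trans v2); rewrite ge_max s1.
Qed.

Lemma code_min_ultra s t u : I s -> I t -> I u ->
  m s t <= m s u \/ m t u <= m s u.
Proof.
move=> Is It Iu; have [st|st] := leP (m s t) (m t u); [left|right].
all: apply: code_min_ge => v vsu.
all: have [vt|vt] : Num.min s t <= v <= Num.max s t \/
  Num.min t u <= v <= Num.max t u by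
  move: vsu; rewrite !itv_minmaxE => /orP[]/andP[? ?];
  (have [?|?] := leP t v); solve
    [left; apply/orP; (left + right); apply/andP; split; lra
    |right; apply/orP; (left + right); apply/andP; split; lra].
- exact: code_min_le vt.
- by apply: (le_trans st); exact: code_min_le vt.
- by apply: (le_trans (ltW st)); exact: code_min_le vt.
- exact: code_min_le vt.
Qed.

Lemma code_distxx s : I s -> code_dist s s = 0.
Proof. by move=> Is; rewrite /code_dist code_minxx//; lra. Qed.

Lemma code_distC s t : code_dist s t = code_dist t s.
Proof. by rewrite /code_dist code_minC; lra. Qed.

Lemma code_dist_ge0 s t : I s -> I t -> 0 <= code_dist s t.
Proof.
move=> Is It; have := code_min_lel Is It; have := code_min_ler Is It.
by rewrite /code_dist; lra.
Qed.

Lemma code_dist_triangle t s u : I s -> I t -> I u ->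
  code_dist s u <= code_dist s t + code_dist t u.
Proof.
move=> Is It Iu; have := code_min_ultra Is It Iu.
have := code_min_ler Is It; have := code_min_lel It Iu.
by rewrite /code_dist; lra.
Qed.

Lemma code_dist_four_point x y z w : I x -> I y -> I z -> I w ->
  code_dist x y + code_dist z w <= code_dist x z + code_dist y w \/
  code_dist x y + code_dist z w <= code_dist x w + code_dist y z.
Proof.
move=> Ix Iy Iz Iw.
have := code_min_ultra Ix Iz Iy; have := code_min_ultra Ix Iw Iy.
have := code_min_ultra Iz Ix Iw; have := code_min_ultra Iz Iy Iw.
rewrite /code_dist ?(code_minC y x) ?(code_minC z x) ?(code_minC w x).
rewrite ?(code_minC z y) ?(code_minC w y) ?(code_minC w z).
lra.
Qed.

End CodeDist.
Lemma sval_inj (T : Type) (P : T -> Prop) (x y : {z : T | P z}) :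
  sval x = sval y -> x = y.
Proof. by case: x y => [x Px] [y Py] /=; exact: eq_exist. Qed.

Section CodedTree.
Context {R : realType} (h : coding_fun R).

Local Notation m := (code_min h).
Local Notation I x := (0 <= x <= 1).
Local Notation I01 := {t : R | 0 <= t <= 1}.
Local Notation cd := (code_dist h).

Lemma coding_cont s e : I s -> 0 < e ->
  exists2 r, 0 < r & forall t, I t -> `|s - t| < r -> `|h s - h t| < e.
Proof.
move=> Is e0.
have [r r0 H] :=
  @within_continuous_mdist R R^o 0 1 h (@coding_continuous _ h) s e Is e0.
by exists r => // t It st; rewrite distrC; exact: H.
Qed.

Lemma ancestor_ex t r : I t -> 0 <= r <= h t ->
  exists a : R, [/\ I a, h a = r & m a t = r].
Proof.
move=> It /andP[r0 rt]; have /andP[t0 t1] := It.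
pose S := [set s | 0 <= s <= t /\ h s <= r].
have S0 : S 0 by split; rewrite ?lexx ?t0// coding0.
have Sub : has_ubound S by exists t => s [/andP[]].
have supS : has_sup S by split => //; exists 0.
pose a := sup S.
have a0 : 0 <= a by apply: ub_le_sup.
have at_ : a <= t by apply: ge_sup; [exists 0|move=> s [/andP[]]].
have Ia : I a by rewrite a0 (le_trans at_).
have har : h a <= r.
  rewrite leNgt; apply/negP => rha.
  have har0 : 0 < h a - r by rewrite subr_gt0.
  have [d d0 Hd] := coding_cont Ia har0.
  have [s Ss sa] := sup_adherent d0 supS.
  have sa' : s <= a by apply: ub_le_sup.
  have [/andP[s0 st] hs] := Ss.
  have /Hd : I s by rewrite s0 (le_trans st).
  have sad : `|a - s| < d by rewrite ger0_norm ?subr_ge0//; rewrite -/a in sa; lra.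
  move=> /(_ sad); have := ler_norm (h a - h s); lra.
have hE : h a = r.
  have [] := @IVT R h a t r at_.
  - apply: continuous_subspaceW (@coding_continuous _ h) => u /=.
    rewrite !in_itv/= => /andP[au ut]; apply/andP; split; lra.
  - by rewrite ge_min le_max har rt orbT.
  - move=> c; rewrite in_itv/= => /andP[ac ct] hc.
    have ca : c <= a.
      by apply: ub_le_sup => //; split; rewrite ?hc ?ct ?andbT//; lra.
    by have -> : a = c by lra.
exists a; split => //.
apply/eqP; rewrite eq_le; apply/andP; split.
  by have := code_min_lel h Ia It; rewrite hE.
apply: code_min_ge => u; rewrite min_l// max_r// => /andP[au ut].
rewrite leNgt; apply/negP => hu.
have Su : S u by split; [rewrite (le_trans a0 au) ut|exact: ltW].
have ua : u <= a by apply: ub_le_sup.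
have uE : u = a by lra.
by move: hu; rewrite uE hE ltxx.
Qed.

(* Classes are plain predicates because [set] and [{eq_quot _}] live in the   *)
(* universe of all [eqType]s, which is too large for a carrier of [rtree].     *)
Definition code_class (s : I01) : I01 -> Prop :=
  fun t => cd (val s) (val t) = 0.

Definition coded_tree : Type :=
  {C : I01 -> Prop | exists s, C = code_class s}.

HB.instance Definition _ := gen_eqMixin coded_tree.
HB.instance Definition _ := gen_choiceMixin coded_tree.

Definition clamp01 (t : R) : R := Num.max 0 (Num.min 1 t).

Lemma clamp01_itv t : I (clamp01 t).
Proof. by rewrite /clamp01 le_max lexx ge_max ler01 ge_min lexx. Qed.

Lemma clamp01_id t : I t -> clamp01 t = t.
Proof. by move=> /andP[t0 t1]; rewrite /clamp01 (min_r t1) (max_r t0). Qed.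

Lemma clamp01_lip s t : `|clamp01 s - clamp01 t| <= `|s - t|.
Proof.
wlog st : s t / s <= t.
  move=> H; have [/H//|/ltW/H] := leP s t.
  by rewrite distrC (distrC t).
rewrite distrC (distrC s) !ger0_norm ?subr_ge0//.
  rewrite /clamp01; have [?|?] := leP 1 s; have [?|?] := leP 1 t;
  try (have [?|?] := leP 0 s); try (have [?|?] := leP 0 t);
  try (have [?|?] := leP 0 (1 : R)); lra.
by rewrite /clamp01 ge_max !le_max lexx /= le_min !ge_min lexx st !orbT.
Qed.

(* The quotient map, extended to the real line by a constant on each side. *)
Definition code_proj (t : R) : coded_tree :=
  let s : I01 := exist _ (clamp01 t) (clamp01_itv t) in
  exist _ (code_class s) (ex_intro _ s erefl).

Definition tree_repr (x : coded_tree) : R := val (projT1 (cid (svalP x))).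

Lemma tree_repr_itv x : I (tree_repr x).
Proof. exact: valP (projT1 (cid (svalP x))). Qed.

Definition tree_dist (x y : coded_tree) : R := cd (tree_repr x) (tree_repr y).

Lemma code_dist_repr s t : I s -> I t -> cd s t = 0 ->
  forall u, I u -> cd s u = cd t u.
Proof.
move=> Is It st u Iu; have := code_dist_triangle h Is It Iu.
have := code_dist_triangle h It Is Iu; rewrite (code_distC h t s) st; lra.
Qed.

Lemma code_classP (s t : I01) :
  code_class s = code_class t <-> cd (val s) (val t) = 0.
Proof.
split=> [st|st]; last first.
  apply/funext => u; apply/propext; rewrite /code_class.
  by rewrite (code_dist_repr (valP s) (valP t) st (valP u)).
have : code_class t t by apply/code_distxx/(valP t).
by rewrite -st.
Qed.

Lemma tree_reprE (s : R) : I s -> cd (tree_repr (code_proj s)) s = 0.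
Proof.
move=> Is; rewrite /tree_repr; case: cid => s' /= /code_classP /=.
by rewrite clamp01_id// code_distC.
Qed.

Lemma tree_distE (s t : R) : I s -> I t ->
  tree_dist (code_proj s) (code_proj t) = cd s t.
Proof.
move=> Is It; rewrite /tree_dist.
rewrite (code_dist_repr (tree_repr_itv _) Is (tree_reprE Is) (tree_repr_itv _)).
rewrite code_distC.
rewrite (code_dist_repr (tree_repr_itv _) It (tree_reprE It) Is).
exact: code_distC.
Qed.

Lemma code_projK (x : coded_tree) : code_proj (tree_repr x) = x.
Proof.
apply: sval_inj; rewrite /= [RHS](projT2 (cid (svalP x))).
by apply/code_classP => /=; rewrite clamp01_id ?tree_repr_itv// code_distxx// tree_repr_itv.
Qed.

End CodedTree.
Section CodedMetricTree.
Context {R : realType} (h : coding_fun R).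

Local Notation m := (code_min h).
Local Notation I x := (0 <= x <= 1).
Local Notation cd := (code_dist h).
Local Notation p := (code_proj h).

Lemma code_proj_surj (x : coded_tree h) : exists2 t, I t & p t = x.
Proof. by exists (tree_repr x); [exact: tree_repr_itv|exact: code_projK]. Qed.

Lemma tree_distxx (x : coded_tree h) : tree_dist x x = 0.
Proof. exact/code_distxx/tree_repr_itv. Qed.

Lemma tree_dist_positivity (x y : coded_tree h) : tree_dist x y = 0 -> x = y.
Proof.
move=> xy; rewrite -[x]code_projK -[y]code_projK; apply: sval_inj => /=.
by apply/code_classP; rewrite /= !clamp01_id// tree_repr_itv.
Qed.

Lemma tree_dist_sym (x y : coded_tree h) : tree_dist x y = tree_dist y x.
Proof. exact: code_distC. Qed.

Lemma tree_dist_triangle (y x z : coded_tree h) :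
  tree_dist x z <= tree_dist x y + tree_dist y z.
Proof. exact: code_dist_triangle (tree_repr_itv x) (tree_repr_itv y) (tree_repr_itv z). Qed.

HB.instance Definition _ := isPointed.Build (coded_tree h) (p 0).
HB.instance Definition _ := isMetric.Build R (coded_tree h)
  tree_distxx tree_dist_positivity tree_dist_sym tree_dist_triangle.

Lemma mdist_projE (s t : R) : I s -> I t -> mdist (p s) (p t) = cd s t.
Proof. exact: tree_distE. Qed.

Lemma code_proj_clamp t : p t = p (clamp01 t).
Proof.
apply: sval_inj => /=; apply/code_classP => /=.
by rewrite (clamp01_id (clamp01_itv t)) code_distxx// clamp01_itv.
Qed.

Lemma code_proj_continuous : continuous p.
Proof.
move=> s; apply/metricType_numDomainType.cvgrPdist_lt => e e0.
have Is := clamp01_itv s.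
have e3 : 0 < e / 4 by rewrite divr_gt0.
have [r r0 Hr] := coding_cont h Is e3.
exists r => //= t; rewrite /ball/= => st.
rewrite (code_proj_clamp s) (code_proj_clamp t) mdist_projE ?clamp01_itv//.
have It := clamp01_itv t.
have ct : `|clamp01 s - clamp01 t| < r by exact: le_lt_trans (clamp01_lip _ _) st.
have hm : h (clamp01 s) - e / 4 <= m (clamp01 s) (clamp01 t).
  apply: code_min_ge => u; rewrite itv_minmaxE => u1.
  have Iu : I u by case/orP: u1 => /andP[? ?]; apply/andP; split; lra.
  have su : `|clamp01 s - u| < r.
    apply: le_lt_trans ct; case/orP: u1 => /andP[? ?].
      by rewrite distrC (distrC (clamp01 s)) !ger0_norm ?subr_ge0 ?lerB//; lra.
    by rewrite !ger0_norm ?subr_ge0 ?lerB//; lra.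
  have := Hr u Iu su; have := ler_norm (h (clamp01 s) - h u); lra.
have := Hr _ It ct; rewrite distrC.
have := ler_norm (h (clamp01 t) - h (clamp01 s)).
rewrite /code_dist; lra.
Qed.

Lemma coded_tree_compact : compact [set: coded_tree h].
Proof.
rewrite (_ : [set: _] = p @` `[0, 1]).
  apply: continuous_compact; last exact: segment_compact.
  by apply: continuous_subspaceT => x; exact: code_proj_continuous.
apply/seteqP; split => // x _; have [t It <-] := code_proj_surj x.
by exists t => //=; rewrite in_itv.
Qed.

Lemma coded_tree_four_point : four_point (coded_tree h).
Proof. move=> x y z w; exact: code_dist_four_point (tree_repr_itv x) (tree_repr_itv y)
  (tree_repr_itv z) (tree_repr_itv w). Qed.

Lemma coded_tree_geodesic (x y : coded_tree h) : exists f, geodesic x y f.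
Proof.
have [s Is <-] := code_proj_surj x; have [t It <-] := code_proj_surj y.
rewrite /geodesic mdist_projE// {x y}; pose M := m s t.
have Ms : M <= h s := code_min_lel h Is It.
have Mt : M <= h t := code_min_ler h Is It.
have M0 : 0 <= M := code_min_ge0 h Is It.
have [as_ Has] : {f : R -> R & forall r, 0 <= r <= h s ->
    [/\ I (f r), h (f r) = r & m (f r) s = r]}.
  apply: (@choice _ _ (fun r a => 0 <= r <= h s -> [/\ I a, h a = r & m a s = r])).
  move=> r; have [/(ancestor_ex Is)[a Ha]|] := pselect (0 <= r <= h s).
    by exists a.
  by exists 0.
have [at_ Hat] : {f : R -> R & forall r, 0 <= r <= h t ->
    [/\ I (f r), h (f r) = r & m (f r) t = r]}.
  apply: (@choice _ _ (fun r a => 0 <= r <= h t -> [/\ I a, h a = r & m a t = r])).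
  move=> r; have [/(ancestor_ex It)[a Ha]|] := pselect (0 <= r <= h t).
    by exists a.
  by exists 0.
have Dst : cd s t = (h s - M) + (h t - M) by rewrite /code_dist -/M; lra.
pose f u := if u <= h s - M then as_ (h s - u) else at_ (u + 2 * M - h s).
have f_at u : 0 <= u <= cd s t -> I (f u) /\
   ((u <= h s - M /\ h (f u) = h s - u /\ m (f u) s = h s - u) \/
    (h s - M < u /\ h (f u) = u + 2 * M - h s /\ m (f u) t = u + 2 * M - h s)).
  move=> /andP[u0 uD]; rewrite /f; have [us|us] := leP u (h s - M).
    have [|? ? ?] := Has (h s - u); first by apply/andP; split; lra.
    by split => //; left.
  have [|? ? ?] := Hat (u + 2 * M - h s); first by apply/andP; split; lra.
  by split => //; right.
have D0 : 0 <= cd s t by rewrite Dst; lra.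
have pE a b : I a -> I b -> cd a b <= 0 -> p a = p b.
  move=> Ia Ib ab; apply: (@mdist_positivity R); rewrite mdist_projE//.
  by apply/eqP; rewrite eq_le ab code_dist_ge0.
exists (p \o f); split => /=.
- have [|If [[? [? ?]]|[? ?]]] := f_at 0; first by rewrite lexx.
    by apply: pE => //; rewrite /code_dist; lra.
  by exfalso; lra.
- have [|If] := f_at (cd s t); first by rewrite lexx D0.
  have := code_min_ultra h If Is It.
  case=> ? [[? [? ?]]|[? [? ?]]]; apply: pE => //; rewrite /code_dist; lra.
- suff iso u v : 0 <= u -> u <= v -> v <= cd s t ->
      mdist (p (f u)) (p (f v)) = v - u.
    move=> u v; rewrite !in_itv/= => /andP[u0 uD] /andP[v0 vD].
    have [uv|/ltW vu] := leP u v.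
      by rewrite iso// distrC ger0_norm ?subr_ge0.
    by rewrite metric_sym iso// ger0_norm ?subr_ge0.
  move=> u0 uv vD.
  have [|Iu fu] := f_at u; first by rewrite u0 (le_trans uv).
  have [|Iv fv] := f_at v; first by rewrite (le_trans u0).
  rewrite mdist_projE// /code_dist.
  have := code_min_lel h Iu Iv; have := code_min_ler h Iu Iv.
  have := code_min_ultra h Iu Is Iv; have := code_min_ultra h Iu It Iv.
  have := code_min_ultra h Is It Iv; have := code_min_ultra h Is Iu Iv.
  have := code_min_ultra h Is Iu It; have := code_min_ultra h Iu Iv It.
  rewrite ?(code_minC h s (f _)) ?(code_minC h t (f _)) -/M.
  case: fu fv => [[? [? ?]]|[? [? ?]]] [[? [? ?]]|[? [? ?]]]; lra.
Qed.

Lemma coded_tree_real_tree : real_tree (coded_tree h).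
Proof.
exact: four_point_real_tree coded_tree_four_point coded_tree_geodesic.
Qed.

Definition coded_rtree : rtree R :=
  @RTree R (coded_tree h) coded_tree_compact coded_tree_real_tree.

Definition borel_proj : measurableTypeR R -> borel (coded_tree h) := p.

Lemma borel_proj_measurable : measurable_fun setT borel_proj.
Proof.
apply: (@measurability _ _ _ (borel (coded_tree h)) _ _ (@open (coded_tree h))) => //.
move=> _ [U oU <-]; rewrite setTI; apply: measurable_realfun.open_measurable.
by move/continuousP : code_proj_continuous; exact.
Qed.

HB.instance Definition _ :=
  isMeasurableFun.Build _ _ _ _ borel_proj borel_proj_measurable.

(* [uniform_prob ltr01] is Lebesgue measure on [0, 1]. *)
Definition mass_measure : probability (borel (coded_tree h)) R :=
  distribution (uniform_prob (@ltr01 R)) borel_proj.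

Definition coded_mrtree : mrtree R := @MRTree R coded_rtree mass_measure.

End CodedMetricTree.

Lemma scale2_coding_continuous (R : realType) (h : coding_fun R) :
  {within `[0, 1], continuous (fun t => 2 * h t)}.
Proof.
apply/subspace_continuousP => t t01; apply: cvgM; first exact: cvg_cst.
by have /subspace_continuousP/(_ t t01) := @coding_continuous _ h.
Qed.

Lemma scale2_coding_ge0 (R : realType) (h : coding_fun R) :
  {in `[0, 1], forall t, 0 <= 2 * h t}.
Proof. by move=> t t01; rewrite mulr_ge0// coding_ge0. Qed.

Lemma scale2_coding0 (R : realType) (h : coding_fun R) : 2 * h 0 = 0.
Proof. by rewrite coding0 mulr0. Qed.

Lemma scale2_coding1 (R : realType) (h : coding_fun R) : 2 * h 1 = 0.
Proof. by rewrite coding1 mulr0. Qed.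

Definition double_coding (R : realType) (h : coding_fun R) : coding_fun R :=
  CodingFun (@scale2_coding_continuous R h) (@scale2_coding_ge0 R h)
    (scale2_coding0 h) (scale2_coding1 h).

Section Brownian.
Context {R : realType}.

Definition brownian_motion (d : measure_display) (T : measurableType d)
    (P : probability T R) (B : R -> {RV P >-> R}) : Prop :=
  [/\ forall w, B 0 w = 0,
      forall w, {within `[0, +oo[, continuous (fun t => B t w)},
      forall s t, 0 <= s -> s < t -> forall A : set R, measurable A ->
        P [set w | A (B t w - B s w)] = normal_prob 0 (Num.sqrt (t - s)) A &
      forall (n : nat) (t : nat -> R), 0 <= t 0 -> (forall i, t i <= t i.+1) ->
        forall A : nat -> set R, (forall i, measurable (A i)) ->
        P [set w | forall i, (i < n)%N -> A i (B (t i.+1) w - B (t i) w)] =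
          (\prod_(i < n) P [set w | A i (B (t i.+1) w - B (t i) w)%R])%E].

(* The excursion of the path [b] away from 0 straddling time 1, rescaled to    *)
(* duration 1 and made nonnegative. When [b] has no zero after time 1 (a null  *)
(* event for Brownian motion) [inf] is 0 and the value is irrelevant.          *)
Definition normalised_excursion (b : R -> R) (t : R) : R :=
  let g := sup [set s | 0 <= s <= 1 /\ b s = 0] in
  let d := inf [set s | 1 <= s /\ b s = 0] in
  `|b (g + t * (d - g))| / Num.sqrt (d - g).

(* The random path [X] has the law of the normalised excursion of a linear     *)
(* Brownian motion, possibly living on another probability space; the law of a *)
(* random continuous path is given by its finite-dimensional marginals.        *)
Definition brownian_excursion (d : measure_display) (T : measurableType d)
    (P : probability T R) (X : T -> coding_fun R) : Prop :=
  (forall t, 0 <= t <= 1 -> measurable_fun [set: T] (fun w => X w t)) /\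
  exists (d' : measure_display) (T' : measurableType d')
      (P' : probability T' R) (B : R -> {RV P' >-> R}),
    brownian_motion B /\
    forall (n : nat) (t : 'I_n -> R) (A : 'I_n -> set R),
      (forall i, 0 <= t i <= 1) -> (forall i, measurable (A i)) ->
      P [set w | forall i, A i (X w (t i))] =
      P' [set w | forall i, A i (normalised_excursion (fun s => B s w) (t i))].

End Brownian.

(* Main.v *)
(* For a path [h] and [eps > 0], let L_eps(s, t) be the supremum over finite
   ordered lists of pairs [a <= b] in [s, t] of the sum of [h b - h a - eps].
   When [h >= h s] on [s, t], it is also the supremum over finite sets S of points
   of the subtree coded by [s, t] of (length of the tree spanned by S, minus
   [eps] times the cardinality of S), so the metric determines it. For Brownian
   motion, eps L_eps(s, t) tends almost surely to a constant times [t - s]: scaling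
   makes L_eps almost a sum of independent identically distributed block gains,
   and second moments with Borel-Cantelli suffice along [eps = 1/n]. The
   excursion inherits this by scaling, so the metric of its tree determines the
   mass [t - s] of every subtree, and subtrees form a pi-system generating the
   Borel sets.

   For measurability, the argument of Egorov's theorem puts the excursion almost
   surely in a countable union of families of paths with explicit moduli and
   explicit rates in the limit above. Each family is compact for uniform
   convergence, and both trees depend continuously on the path; hence for every
   GHP-closed set F, the isometry classes of the trees coded by the paths of one
   family whose measured tree is in F form a GH-closed set. *)

Require Import Defs.
From HB Require Import structures.
From mathcomp Require Import all_boot all_order all_algebra.
From mathcomp Require Import all_classical all_reals all_analysis.
From mathcomp Require Import measurable_realfun.
From mathcomp Require Import zify lra.

Set Implicit Arguments.
Unset Strict Implicit.
Unset Printing Implicit Defensive.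

Import Order.TTheory GRing.Theory Num.Theory.
Import numFieldNormedType.Exports.

Local Open Scope classical_set_scope.
Local Open Scope ring_scope.

(** * Upward variation above a threshold *)

Section UpwardVariation.
Context {disp : Order.disp_t} {T : orderType disp} {R : realType}.
Implicit Types (s t u : T) (l : seq (T * T)) (h : T -> R).

(** The charge [eps] per pair keeps the upward variation of a rough path finite and makes it nearly
    additive, since cutting an interval loses at most one charge. The limiting constant is never
    computed: it is a supremum of mean gains, and only its positivity matters. Independence is
    exploited on meshes, so the moment bounds must be uniform in the mesh. Two obstacles shape the
    rest. The subtrees whose mass is sought correspond to time intervals that depend on the path, so
    the limit must hold uniformly in [s], [t] and [eps]; monotonicity in the interval and in [eps]
    derives this from countably many rational end points. And the law of the excursion is known only
    through finite-dimensional marginals, so regularity is restated through values at countably many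
    times ([grid_cond]) before it is transferred from Brownian motion. There the excursion is an
    absolute value; a negative one is treated by exchanging ascents and descents, at a cost that
    vanishes with [eps]. Paths for which the construction degenerates to 0 form a family of their
    own. *)

Fixpoint adm s t l : bool :=
  if l is p :: l' then [&& (s <= p.1)%O, (p.1 <= p.2)%O & adm p.2 t l']
  else (s <= t)%O.

(** Lists range over any total order, so that the same sums serve real times and grid indices. The
    supremum of these sums is never formed: it is only bounded, or approached by lists. *)
Definition usum h (e : R) l : R := \sum_(p <- l) (h p.2 - h p.1 - e).

Lemma usum_nil h e : usum h e [::] = 0.
Proof. by rewrite /usum big_nil. Qed.

Lemma usum_cons h e p l : usum h e (p :: l) = h p.2 - h p.1 - e + usum h e l.
Proof. by rewrite /usum big_cons. Qed.

Lemma usum_cat h e l1 l2 : usum h e (l1 ++ l2) = usum h e l1 + usum h e l2.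
Proof. by rewrite /usum big_cat. Qed.

Lemma adm_le s t l : adm s t l -> (s <= t)%O.
Proof.
elim: l s => [//|p l IH] s /= /and3P[sp pp /IH].
by apply: le_trans; exact: le_trans pp.
Qed.

Lemma adm_widen s s' t t' l : (s' <= s)%O -> (t <= t')%O ->
  adm s t l -> adm s' t' l.
Proof.
move=> ss tt; elim: l s s' ss => [|p l IH] s s' ss /=.
  by move=> st; exact: le_trans ss (le_trans st tt).
by move=> /and3P[sp -> /(IH _ _ (lexx _)) ->]; rewrite (le_trans ss sp).
Qed.

Lemma adm_cat s t u l1 l2 : adm s t l1 -> adm t u l2 -> adm s u (l1 ++ l2).
Proof.
elim: l1 s => [|p l IH] s /=; first by move=> st; apply: adm_widen.
by move=> /and3P[-> -> pt] tu /=; exact: IH.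
Qed.

Lemma adm_mem s t l p : adm s t l -> p \in l ->
  [&& (s <= p.1)%O, (p.1 <= p.2)%O & (p.2 <= t)%O].
Proof.
elim: l s => [//|q l IH] s /= /and3P[sq qq qt]; rewrite inE => /orP[/eqP ->|pl].
  by rewrite sq qq (adm_le qt).
have /and3P[qp -> ->] := IH _ qt pl.
by rewrite (le_trans sq (le_trans qq qp)).
Qed.

Lemma usum_eps_le h e e' l : e <= e' -> usum h e' l <= usum h e l.
Proof. by move=> ee; apply: ler_sum => p _; rewrite lerB. Qed.

(** At most one pair straddles [t]; cutting it there makes two pairs out of one and so pays one
    extra [e]. *)
Lemma usum_split h e s t u l : 0 <= e -> (s <= t)%O -> (t <= u)%O -> adm s u l ->
  exists l1 l2, [/\ adm s t l1, adm t u l2 &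
    usum h e l <= usum h e l1 + usum h e l2 + e].
Proof.
move=> e0; elim: l s => [|[a b] l IH] s st tu /=.
  by exists [::], [::]; split => //=; rewrite !usum_nil !add0r.
move=> /and3P[sa ab bu]; have [ta|at_] := leP t a.
  exists [::], ((a, b) :: l); split => //=; first by rewrite ta ab.
  by rewrite usum_nil add0r lerDl.
have [bt|tb] := leP b t.
  have [l1 [l2 [b1 b2 b3]]] := IH _ bt tu bu.
  exists ((a, b) :: l1), l2; split => //=; first by rewrite sa ab.
  by rewrite !usum_cons /=; lra.
exists [:: (a, t)], ((t, b) :: l); split => //=.
- by rewrite sa (ltW at_) lexx.
- by rewrite lexx (ltW tb).
- by rewrite !usum_cons usum_nil /=; lra.
Qed.

(* The descents of [h] interleave with its ascents. *)
Lemma usum_opp_cons h e s t a b l : adm s t ((a, b) :: l) ->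
  exists l' z, [/\ adm s t l', (b <= z <= t)%O &
    usum (fun x => - h x) e ((a, b) :: l) = usum h e l' + h a - h z - e].
Proof.
move=> /= /and3P[sa ab].
suff H : adm b t l -> exists l' z, [/\ adm b t l', (b <= z <= t)%O &
    usum (fun x => - h x) e ((a, b) :: l) = usum h e l' + h a - h z - e].
  move=> /H[l' [z [b1 b2 ->]]]; exists l', z; split => //.
  by apply: adm_widen b1 => //; exact: le_trans ab.
elim: l a b {sa ab} => [|[a2 b2] l IH] a b /=.
  move=> bt; exists [::], b; split; rewrite ?lexx//.
  by rewrite usum_cons !usum_nil /=; lra.
move=> /and3P[ba ab /(IH a2 b2)[l' [z [c1 /andP[c2 c3] c4]]]].
exists ((b, a2) :: l'), z; split => /=.
- by rewrite lexx ba; apply: adm_widen c1.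
- by rewrite c3 (le_trans ba (le_trans ab c2)).
- by rewrite usum_cons c4 usum_cons /=; lra.
Qed.

(** By [usum_opp_cons] only two outer values of [h] are left over, hence an error [C *+ 2] whatever
    the number of pairs. *)
Lemma usum_opp h e C s t l : 0 <= e ->
  (forall a, (s <= a <= t)%O -> `|h a| <= C) -> adm s t l ->
  exists2 l', adm s t l' & usum (fun x => - h x) e l <= usum h e l' + C *+ 2.
Proof.
move=> e0 hC; case: l => [|[a b] l] sl.
  exists [::] => //; rewrite !usum_nil add0r mulrn_wge0//.
  by apply: le_trans (hC s _); rewrite ?normr_ge0// lexx (adm_le sl).
have [l' [z [b1 /andP[b2 b3] ->]]] := usum_opp_cons h e sl.
have /and3P[sa ab bt] := adm_mem sl (mem_head _ _).
exists l' => //.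
have := hC a; rewrite sa (le_trans ab bt) => /(_ isT); rewrite ler_norml => /andP[? ?].
have := hC z; rewrite b3 (le_trans sa (le_trans ab b2)) => /(_ isT).
by rewrite ler_norml => /andP[? ?]; rewrite mulr2n; lra.
Qed.

(** Each increment moves by at most [c *+ 2], which the larger threshold absorbs pair by pair; the
    bound is therefore independent of the number of pairs. *)
Lemma usum_perturb h h' e c s t l : adm s t l ->
  (forall a, (s <= a <= t)%O -> `|h a - h' a| <= c) ->
  usum h (e + c *+ 2) l <= usum h' e l.
Proof.
move=> sl hh; rewrite /usum big_seq [leRHS]big_seq; apply: ler_sum => -[a b] pl /=.
have /= /and3P[sa ab bt] := adm_mem sl pl.
have := hh a; rewrite sa (le_trans ab bt) => /(_ isT); rewrite ler_norml => /andP[? ?].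
have := hh b; rewrite bt (le_trans sa ab) => /(_ isT); rewrite ler_norml => /andP[? ?].
rewrite mulr2n; lra.
Qed.

Lemma eq_usum h h' e s t l : adm s t l ->
  (forall a, (s <= a <= t)%O -> h a = h' a) -> usum h e l = usum h' e l.
Proof.
move=> sl hh; apply/eqP; rewrite eq_le; apply/andP; split.
  have := @usum_perturb h h' e 0 _ _ _ sl; rewrite mul0rn addr0; apply => a ha.
  by rewrite hh// subrr normr0.
have := @usum_perturb h' h e 0 _ _ _ sl; rewrite mul0rn addr0; apply => a ha.
by rewrite hh// subrr normr0.
Qed.

Lemma usumZ (k : R) h e l : usum (fun x => k * h x) (k * e) l = k * usum h e l.
Proof.
by rewrite /usum mulr_sumr; apply: eq_bigr => p _; rewrite !mulrBr.
Qed.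

Lemma usumDc (k : R) h e l : usum (fun x => h x + k) e l = usum h e l.
Proof. by apply: eq_bigr => p _; lra. Qed.

End UpwardVariation.

(** States that eps L_eps(s, t) is within [eta] of [c * (t - s)] without a supremum: all lists obey
    the upper bound and one list reaches the lower bound. *)
Definition regular_at (R : realType) (h : R -> R) (c eps eta s t : R) : Prop :=
  (forall l, adm s t l -> eps * usum h eps l <= c * (t - s) + eta) /\
  (exists2 l, adm s t l & c * (t - s) - eta <= eps * usum h eps l).

Definition pair_map (A B : Type) (f : A -> B) (p : A * A) := (f p.1, f p.2).

Section UpwardVariationMap.
Context {disp disp' : Order.disp_t} {T : orderType disp} {T' : orderType disp'}.
Context {R : realType}.

Lemma adm_map (f : T -> T') s t l : {in [pred x | (s <= x <= t)%O] &, {homo f : x y / (x <= y)%O}} ->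
  adm s t l -> adm (f s) (f t) (map (pair_map f) l).
Proof.
move=> fm sl; suff H : forall u, (u >= s)%O -> adm u t l -> adm (f u) (f t) (map (pair_map f) l).
  exact: H (lexx s) sl.
elim: l {sl} => [|[a b] l IH] u su /=.
  by move=> ut; apply: fm; rewrite ?inE ?su ?lexx ?(le_trans su ut).
move=> /and3P[ua ab bt].
have at_ := le_trans ab (adm_le bt); have sa := le_trans su ua.
rewrite fm ?inE ?su ?sa ?at_ ?(le_trans ua)//=.
rewrite fm ?inE ?sa ?at_ ?(adm_le bt) ?(le_trans sa)//=.
by apply: IH => //; exact: le_trans ab.
Qed.

Lemma usum_map (f : T -> T') (h : T' -> R) e l :
  usum h e (map (pair_map f) l) = usum (h \o f) e l.
Proof. by rewrite /usum big_map. Qed.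

End UpwardVariationMap.

(** * Optimal trading on a grid *)

Section GridVariation.
Context {R : realType}.
Implicit Types (x : nat -> R) (l : seq (nat * nat)).

(* Optimal gain of buying and selling at the prices [x 0, ..., x i] with unit   *)
(* transaction cost, together with the best balance while holding a share.      *)
Fixpoint trade x i : R * R :=
  if i is j.+1 then
    let q := trade x j in
    let b := Num.max q.2 (q.1 - x i) in
    (Num.max q.1 (b + x i - 1), b)
  else (0, - x 0).

Definition gain x i : R := (trade x i).1.

Lemma gain_homo x i j : (i <= j)%N -> gain x i <= gain x j.
Proof.
move=> /subnKC <-; elim: (j - i)%N => [|k IH]; first by rewrite addn0.
by apply: le_trans IH _; rewrite addnS /gain /= le_max lexx.
Qed.

Lemma trade2_homo x i j : (i <= j)%N -> (trade x i).2 <= (trade x j).2.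
Proof.
move=> /subnKC <-; elim: (j - i)%N => [|k IH]; first by rewrite addn0.
by apply: le_trans IH _; rewrite addnS /= le_max lexx.
Qed.

Lemma trade_buy x i : gain x i - x i <= (trade x i).2.
Proof.
case: i => [|i]; rewrite /gain /= ?sub0r//.
set b := Num.max (trade x i).2 _; have : (trade x i).1 - x i.+1 <= b by rewrite le_max lexx orbT.
by move=> ?; case: (leP (trade x i).1 (b + x i.+1 - 1)) => _; lra.
Qed.

Lemma trade_sell x i : (trade x i).2 + x i - 1 <= gain x i.
Proof. by case: i => [|i]; rewrite /gain /= ?le_max ?lexx ?orbT//; lra. Qed.

(** Buying at [a] leaves a balance of at least [gain x a - x a], which the optimal balance dominates
    until the sale at [b]. *)
Lemma gain_ub x i j l : adm i j l -> gain x i + usum x 1 l <= gain x j.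
Proof.
elim: l i => [|[a b] l IH] i /=.
  by rewrite leEnat usum_nil addr0; exact: gain_homo.
move=> /and3P[]; rewrite !leEnat => ia ab /IH; rewrite usum_cons /=.
have := gain_homo x ia; have := trade_buy x a; have := trade_sell x b.
have := trade2_homo x ab; lra.
Qed.

Lemma gain_ge0 x i : 0 <= gain x i.
Proof. exact: (gain_homo x (leq0n i)). Qed.

Lemma gain_attained x i : exists2 l, adm 0%N i l & usum x 1 l = gain x i.
Proof.
(* The induction also carries a list realising the best balance while holding a share; selling at
   the new index extends it. *)
suff [] : (exists2 l, adm 0%N i l & usum x 1 l = gain x i) /\
  exists l a, [/\ adm 0%N a l, (a <= i)%N & usum x 1 l - x a = (trade x i).2] by [].
elim: i => [|i [[l li lE] [l' [a [la ai l'E]]]]].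
  split; first by exists [::]; rewrite ?usum_nil.
  by exists [::], 0%N; split => //; rewrite usum_nil sub0r.
have H2 : exists l a, [/\ adm 0%N a l, (a <= i.+1)%N & usum x 1 l - x a = (trade x i.+1).2].
  rewrite /=; case: leP => _.
    exists l, i.+1; split => //; last by rewrite lE.
    by apply: adm_widen li => //; rewrite leEnat.
  by exists l', a; split => //; exact: leqW.
split; last exact: H2.
have [l2 [a2 [b1 b2 b3]]] := H2.
have -> : gain x i.+1 = Num.max (gain x i) ((trade x i.+1).2 + x i.+1 - 1) by [].
case: leP => _.
  exists (l2 ++ [:: (a2, i.+1)]); last by rewrite usum_cat usum_cons usum_nil -b3 /=; lra.
  by apply: adm_cat b1 _; rewrite /= !leEnat leqnn b2 leqnn.
by exists l => //; apply: adm_widen li => //; rewrite leEnat.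
Qed.

End GridVariation.

(** * Chaining over dyadic increments *)

Section Chaining.
Context {R : realType}.

Variables (x : nat -> R) (J : nat) (A rho : R).
Hypotheses (A0 : 0 <= A) (rho0 : 0 <= rho) (rho4 : rho ^+ 4 = 2^-1).
Hypothesis step : forall n i, (n <= J)%N -> (i < 2 ^ n)%N ->
  `|x (i.+1 * 2 ^ (J - n))%N - x (i * 2 ^ (J - n))%N| <= A * rho ^+ n.

Let rho_le : rho <= 6 / 7.
Proof.
have h : rho ^+ 4 <= (6 / 7) ^+ 4 by rewrite rho4; lra.
by move: h; rewrite ler_pXn2r ?nnegrE// divr_ge0.
Qed.

(** Rounding [q] down one binary digit at a time gives a geometric series. The constant 6 is stable
    because [rho], a fourth root of 1/2, is at most 6/7: one more step makes 7 and
    [7 * rho <= 6]. *)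
Lemma chaining_floor k q : (k <= J)%N -> (q <= 2 ^ J)%N ->
  `|x q - x (q %/ 2 ^ k * 2 ^ k)%N| <= 6 * A * rho ^+ (J - k).
Proof.
move=> + qJ; elim: k => [_|k IH kJ].
  by rewrite expn0 divn1 muln1 subrr normr0 !mulr_ge0// exprn_ge0.
have Ark : 0 <= A * rho ^+ (J - k.+1) by rewrite mulr_ge0// exprn_ge0.
have JkE : (J - k = (J - k.+1).+1)%N by rewrite subnSK.
have key : 7 * (rho * (A * rho ^+ (J - k.+1))) <= 6 * (A * rho ^+ (J - k.+1)).
  by rewrite mulrA ler_wpM2r//; have := rho_le; lra.
have {}IH := IH (ltnW kJ); rewrite JkE exprS in IH.
set p := (q %/ 2 ^ k)%N in IH.
have pE : (q %/ 2 ^ k.+1 = p %/ 2)%N by rewrite expnS mulnC divnMA.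
have p2 : (p = p %/ 2 * 2 + p %% 2)%N := divn_eq p 2.
have [r0|r1] : (p %% 2 = 0 \/ p %% 2 = 1)%N.
- by move: (ltn_pmod p (isT : 0 < 2)%N); case: (p %% 2)%N => [|[|//]]; [left|right].
- have -> : (q %/ 2 ^ k.+1 * 2 ^ k.+1 = p * 2 ^ k)%N.
    by rewrite pE expnS mulnA [in RHS]p2 r0 addn0.
  by apply: le_trans IH _; have := key; lra.
rewrite pE expnS mulnA.
have sp : `|x (p * 2 ^ k)%N - x (p %/ 2 * 2 * 2 ^ k)%N| <= A * rho ^+ (J - k).
  have := @step (J - k)%N (p %/ 2 * 2)%N; rewrite subKn ?(ltnW kJ)// leq_subr => /(_ isT).
  have pS : p = (p %/ 2 * 2).+1 by rewrite {1}p2 r1 addn1.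
  rewrite -pS; apply.
  have : (p * 2 ^ k <= 2 ^ J)%N by rewrite (leq_trans (leq_divM _ _)).
  have -> : (2 ^ J = 2 ^ (J - k) * 2 ^ k)%N by rewrite -expnD subnK// ltnW.
  by rewrite leq_pmul2r ?expn_gt0// => H; rewrite -pS.
have := ler_distD (x (p * 2 ^ k)%N) (x q) (x (p %/ 2 * 2 * 2 ^ k)%N).
rewrite JkE exprS in sp; lra.
Qed.

(** At the scale [2 ^ k] just below [b - a] the rounded indices are at most two steps apart, so the
    increment is at most 6 + 2 + 6 = 14 times [A * rho ^+ (J - k)]. This is a Hölder bound of
    exponent 1/4, raised to the fourth power to become linear in [b - a]. *)
Lemma chaining a b : (a <= b <= 2 ^ J)%N ->
  `|x b - x a| ^+ 4 <= 14 ^+ 4 * A ^+ 4 * ((b - a)%:R / (2 ^ J)%:R).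
Proof.
move=> /andP[]; rewrite leq_eqVlt => /predU1P[-> bJ|ab bJ].
  by rewrite subrr normr0 expr0n /= mulr_ge0// ?mulr_ge0 ?exprn_ge0.
pose k := trunc_log 2 (b - a).
have ba0 : (0 < b - a)%N by rewrite subn_gt0.
have /andP[kl ku] := trunc_log_bounds (isT : 1 < 2)%N ba0; rewrite -/k in kl ku.
have kJ : (k <= J)%N.
  by rewrite -(leq_exp2l (m := 2))// (leq_trans kl)// (leq_trans (leq_subr _ _)).
have aJ : (a <= 2 ^ J)%N by rewrite (leq_trans (ltnW ab)).
have fa := chaining_floor kJ aJ; have fb := chaining_floor kJ bJ.
set p := (a %/ 2 ^ k)%N in fa; set q := (b %/ 2 ^ k)%N in fb.
have pq : (p <= q)%N by rewrite leq_div2r// ltnW.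
have qp : (q <= p + 2)%N.
  rewrite -ltnS ltn_divLR ?expn_gt0//.
  have ap := divn_eq a (2 ^ k); have am := ltn_pmod a (d := 2 ^ k).
  rewrite expn_gt0 /= in am; move: ap (am isT) ku; rewrite -/p expnS; nia.
have qJ : (q * 2 ^ k <= 2 ^ (J - k) * 2 ^ k)%N.
  by rewrite -expnD subnK// (leq_trans (leq_divM _ _)).
rewrite leq_pmul2r ?expn_gt0// in qJ.
have sq i : (p <= i < q)%N -> `|x (i.+1 * 2 ^ k)%N - x (i * 2 ^ k)%N| <= A * rho ^+ (J - k).
  move=> /andP[_ iq]; have := @step (J - k)%N i; rewrite subKn// leq_subr.
  by apply => //; exact: leq_trans qJ.
have Ark : 0 <= A * rho ^+ (J - k) by rewrite mulr_ge0// exprn_ge0.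
have pq2 : `|x (q * 2 ^ k)%N - x (p * 2 ^ k)%N| <= 2 * A * rho ^+ (J - k).
  have [->|[qE|qE]] : q = p \/ q = p.+1 \/ q = p.+2 by lia.
  - by rewrite subrr normr0; lra.
  - rewrite qE; have := sq p; rewrite qE !leqnn => /(_ isT); lra.
  - rewrite qE.
    have := sq p; rewrite qE leqnn leqnSn => /(_ isT) s1.
    have := sq p.+1; rewrite qE leqnn leqnSn => /(_ isT) s2.
    by apply: le_trans (ler_distD (x (p.+1 * 2 ^ k)%N) _ _) _; lra.
have D : `|x b - x a| <= 14 * (A * rho ^+ (J - k)).
  have := ler_distD (x (q * 2 ^ k)%N) (x b) (x a).
  have := ler_distD (x (p * 2 ^ k)%N) (x (q * 2 ^ k)%N) (x a).
  rewrite (distrC (x (p * 2 ^ k)%N) (x a)); lra.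
apply: le_trans (lerXn2r 4 _ _ D) _; rewrite ?nnegrE ?mulr_ge0 ?exprn_ge0//.
have -> : (14 * (A * rho ^+ (J - k))) ^+ 4 = 14 ^+ 4 * A ^+ 4 * (rho ^+ (J - k)) ^+ 4 by rewrite !exprMn mulrA.
rewrite ler_wpM2l ?mulr_ge0 ?exprn_ge0//.
rewrite -exprM mulnC exprM rho4 exprVn -natrX.
rewrite ler_pdivlMr ?ltr0n ?expn_gt0// mulrC -[in X in X / _](subnKC kJ) expnD natrM mulfK ?pnatr_eq0 -?lt0n ?expn_gt0//.
by rewrite ler_nat.
Qed.

(** Since [y - 1 <= y ^+ 4], the chaining bound makes each pair gain at most a multiple of its
    length, and the lengths of successive pairs add up to at most the whole. *)
Lemma gain_chaining : gain x (2 ^ J) <= 14 ^+ 4 * A ^+ 4.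
Proof.
have [l lJ <-] := gain_attained x (2 ^ J)%N.
have C0 : 0 <= 14 ^+ 4 * A ^+ 4 :> R by rewrite mulr_ge0 ?exprn_ge0.
have bnd (s : nat) : adm s (2 ^ J)%N l ->
    usum x 1 l <= 14 ^+ 4 * A ^+ 4 * ((2 ^ J - s)%:R / (2 ^ J)%:R).
  elim: l s {lJ} => [|[a b] l IH] s /=.
    by move=> _; rewrite usum_nil mulr_ge0.
  rewrite !leEnat => /and3P[sa ab bJ]; have := adm_le bJ; rewrite leEnat => bJ'.
  have {}IH := IH _ bJ; rewrite usum_cons /=.
  have abJ : (a <= b <= 2 ^ J)%N by rewrite ab.
  have y4 (y : R) : y - 1 <= `|y| ^+ 4.
    have -> : `|y| ^+ 4 = (y ^+ 2) ^+ 2 by rewrite -(exprM _ 2 2) -[RHS]ger0_norm ?exprn_even_ge0// normrX.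
    have := sqr_ge0 (y ^+ 2 - 1 / 2); have := sqr_ge0 (y - 1 / 2); lra.
  apply: (@le_trans _ _ (14 ^+ 4 * A ^+ 4 * ((b - a)%:R / (2 ^ J)%:R) +
    14 ^+ 4 * A ^+ 4 * ((2 ^ J - b)%:R / (2 ^ J)%:R))).
    by apply: lerD => //; apply: le_trans (y4 _) (chaining abJ).
  rewrite -mulrDr ler_wpM2l// -mulrDl ler_wpM2r ?invr_ge0// -natrD ler_nat.
  by rewrite addnC addnBA// subnK// leq_sub2l// (leq_trans sa).
apply: le_trans (bnd _ lJ) _; by rewrite subn0 divff ?mulr1// pnatr_eq0 -lt0n expn_gt0.
Qed.

End Chaining.

(** [A] is the eighth root of the double sum: as [rho ^+ 8] is 1/4, the weights [4 ^+ n] make every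
    dyadic increment satisfy the chaining hypothesis. Eighth powers appear because the gain is
    bounded by a multiple of [A ^+ 4] and is squared. *)
Lemma gain_moment (R : realType) (x : nat -> R) (J : nat) :
  gain x (2 ^ J) ^+ 2 <= 14 ^+ 8 *
    \sum_(n < J.+1) \sum_(i < 2 ^ n) 4 ^+ n *
      (x (i.+1 * 2 ^ (J - n))%N - x (i * 2 ^ (J - n))%N) ^+ 8.
Proof.
set M := (X in _ <= _ * X).
have t0 (n i : nat) : 0 <= 4 ^+ n *
      (x (i.+1 * 2 ^ (J - n))%N - x (i * 2 ^ (J - n))%N) ^+ 8.
  by apply: mulr_ge0; [exact: exprn_ge0|exact: exprn_even_ge0].
have M0 : 0 <= M by apply: sumr_ge0 => n _; apply: sumr_ge0 => i _; exact: t0.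
pose A := Num.sqrt (Num.sqrt (Num.sqrt M)).
have A4 : A ^+ 4 = Num.sqrt M by rewrite (exprM _ 2 2) sqr_sqrtr ?sqr_sqrtr.
have A8 : A ^+ 8 = M by rewrite (exprM _ 4 2) A4 sqr_sqrtr.
pose rho : R := Num.sqrt (Num.sqrt 2^-1).
have rho4 : rho ^+ 4 = 2^-1.
  by rewrite (exprM _ 2 2) sqr_sqrtr ?sqr_sqrtr// invr_ge0.
have rho0 : 0 <= rho by exact: sqrtr_ge0.
have A0 : 0 <= A by exact: sqrtr_ge0.
have st n i : (n <= J)%N -> (i < 2 ^ n)%N ->
    `|x (i.+1 * 2 ^ (J - n))%N - x (i * 2 ^ (J - n))%N| <= A * rho ^+ n.
  move=> nJ i2; rewrite -(@ler_pXn2r _ 8) ?nnegrE ?mulr_ge0 ?exprn_ge0//.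
  rewrite -normrX ger0_norm ?exprn_even_ge0//.
  rewrite exprMn A8.
  have -> : (rho ^+ n) ^+ 8 = (4 ^+ n)^-1.
    by rewrite -exprM mulnC exprM (exprM _ 4 2) rho4 exprVn -natrX exprVn.
  rewrite ler_pdivlMr ?exprn_gt0// mulrC /M.
  have nJ' : (n < J.+1)%N by [].
  rewrite (bigD1 (Ordinal nJ'))//= (bigD1 (Ordinal i2))//= -addrA lerDl addr_ge0//.
    by apply: sumr_ge0.
  by apply: sumr_ge0 => *; apply: sumr_ge0.
have := gain_chaining A0 rho0 rho4 st; rewrite A4 => /(lerXn2r 2) H.
apply: le_trans (H _ _) _; rewrite ?nnegrE ?gain_ge0 ?mulr_ge0 ?sqrtr_ge0//.
by rewrite exprMn sqr_sqrtr// -exprM.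
Qed.

(** * Probability preliminaries *)

Section RealSequences.
Context {R : realType}.

Definition cylinder : set (set (nat -> R)) :=
  [set C | exists n (A : nat -> set R), (forall i, measurable (A i)) /\
     C = [set f | forall i, (i < n)%N -> A i (f i)]].

(** One space for two uses: the increments of Brownian motion over a mesh, and the values of a path
    at countably many times. A law on it is determined by finitely many coordinates at a time. *)
Definition realseq := g_sigma_algebraType cylinder.

Lemma cylinder_setI : setI_closed cylinder.
Proof.
move=> _ _ [n [A [mA ->]]] [m [B [mB ->]]].
exists (maxn n m), (fun i => (if (i < n)%N then A i else setT) `&`
  (if (i < m)%N then B i else setT)); split.
  by move=> i; apply: measurableI; case: ifP.
apply/seteqP; split => [f [fA fB] i _|f H].
  by split; case: ifP => // ?; [exact: fA|exact: fB].
by split => i im; have := H i; rewrite leq_max im ?orbT => /(_ isT) [].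
Qed.

Lemma cylinder_setT : cylinder setT.
Proof.
by exists 0%N, (fun=> setT); split => //; apply/seteqP; split.
Qed.

Lemma seq_measure_unique (m1 m2 : {measure set realseq -> \bar R}) :
  (m1 setT < +oo)%E -> (forall C, cylinder C -> m1 C = m2 C) ->
  forall A, measurable A -> m1 A = m2 A.
Proof.
move=> m1oo m12 A mA.
have Hu := @measure_unique _ R realseq cylinder (fun=> setT) erefl cylinder_setI.
apply: Hu => //.
- by move=> _; exact: cylinder_setT.
- by apply/seteqP; split => // x _; exists 0%N.
Qed.

Lemma measurable_cylinder (C : set realseq) : cylinder C -> measurable C.
Proof. exact: sub_sigma_algebra. Qed.

Lemma measurable_coord i : measurable_fun [set: realseq] (fun f : realseq => f i : R).
Proof.
move=> _ A mA; rewrite setTI; apply: measurable_cylinder.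
exists i.+1, (fun j => if j == i then A else setT); split.
  by move=> j; case: ifP.
apply/seteqP; split => [f fA j _|f /(_ i)]; first by case: eqP => // ->.
by rewrite ltnS leqnn eqxx => /(_ isT).
Qed.

Lemma measurable_fun_realseq d (T : measurableType d) (g : T -> realseq) :
  (forall i, measurable_fun setT (fun w => g w i : R)) -> measurable_fun setT g.
Proof.
move=> mg; apply: (@measurability _ _ T realseq setT g cylinder) => //.
move=> _ [_ [n [A [mA ->]]] <-]; rewrite setTI.
rewrite (_ : _ @^-1` _ = \bigcap_(i in `I_n) ((fun w => g w i : R) @^-1` A i)).
  by apply: fin_bigcap_measurable => // i _; rewrite -[X in measurable X]setTI; exact: mg.
by apply/seteqP; split.
Qed.

End RealSequences.
Arguments realseq R : clear implicits.

Section Independence.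
Context d (T : measurableType d) (R : realType) (P : probability T R).
Variables U V : {mfun T >-> realseq R}.
Hypothesis UV : forall C C', cylinder C -> cylinder C' ->
  P (U @^-1` C `&` V @^-1` C') = (P (U @^-1` C) * P (V @^-1` C'))%E.

(** The pi-system argument is applied to one variable at a time: with the other event fixed, both
    sides are finite measures that agree on cylinders. *)
Lemma indep_measurable A B : measurable A -> measurable B ->
  P (U @^-1` A `&` V @^-1` B) = (P (U @^-1` A) * P (V @^-1` B))%E.
Proof.
have mU (X : set (realseq R)) : measurable X -> measurable (U @^-1` X).
  by move=> mX; rewrite -[X in measurable X]setTI; exact: (@measurable_funP _ _ _ _ setT U).
have mV (X : set (realseq R)) : measurable X -> measurable (V @^-1` X).
  by move=> mX; rewrite -[X in measurable X]setTI; exact: (@measurable_funP _ _ _ _ setT V).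
have Pfin X : measurable X -> P X \is a fin_num by move=> mX; exact: fin_num_measure.
have step1 C' : cylinder C' -> forall X, measurable X ->
    P (U @^-1` X `&` V @^-1` C') = (P (U @^-1` X) * P (V @^-1` C'))%E.
  move=> cC X mX; have mC := mV _ (measurable_cylinder cC).
  have r0 : (0 <= fine (P (V @^-1` C')))%R by exact: fine_ge0.
  have := @seq_measure_unique R (pushforward (mrestr P mC) U)
    (mscale (NngNum r0) (distribution P U)).
  rewrite /pushforward /mrestr /distribution /mscale /= => H.
  have {}H := H (measurable_funP _) _ _ X mX.
  rewrite /pushforward /mrestr /mscale /= fineK ?Pfin// in H; rewrite H.
  - by rewrite muleC.
  - by rewrite preimage_setT setTI -ge0_fin_numE// Pfin.
  - by move=> C cC'; rewrite muleC UV.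
move=> mA mB; have mA' := mU _ mA.
have r0 : (0 <= fine (P (U @^-1` A)))%R by exact: fine_ge0.
have := @seq_measure_unique R (pushforward (mrestr P mA') V)
  (mscale (NngNum r0) (distribution P V)).
rewrite /pushforward /mrestr /distribution /mscale /= => H.
have {}H := H (measurable_funP _) _ _ B mB.
rewrite /pushforward /mrestr /mscale /= fineK ?Pfin// in H; rewrite setIC H//.
- by rewrite preimage_setT setTI -ge0_fin_numE// Pfin.
- by move=> C cC; rewrite setIC step1.
Qed.

Lemma indep_integralM (F G : realseq R -> R) :
  measurable_fun setT F -> measurable_fun setT G ->
  (forall x, 0 <= F x) -> (forall x, 0 <= G x) ->
  (\int[P]_w (F (U w) * G (V w))%:E =
   \int[P]_w (F (U w))%:E * \int[P]_w (G (V w))%:E)%E.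
Proof.
move=> mF mG F0 G0.
have mUV : measurable_fun setT (fun w => (U w, V w)).
  by apply/measurable_fun_pairP; split; exact: measurable_funP.
pose UVm : {mfun T >-> (realseq R * realseq R)%type} := HB.pack (fun w => (U w, V w))
   (isMeasurableFun.Build _ _ _ _ _ mUV).
have E X : measurable X -> (distribution P U \x distribution P V)%E X = distribution P UVm X.
  apply: product_measure_unique => A B mA mB; exact: indep_measurable.
have mFG : measurable_fun [set: (realseq R * realseq R)%type]
    (fun z => (F z.1 * G z.2)%:E).
  by apply/measurable_EFinP; apply: measurable_funM; exact: measurableT_comp.
have := @ge0_integral_distribution _ _ _ _ _ P UVm (fun z => (F z.1 * G z.2)%:E) mFG.
move=> <-; last by move=> z; rewrite lee_fin mulr_ge0.
rewrite (@eq_measure_integral _ _ _ _ (distribution P U \x distribution P V)%E); last first.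
  by move=> A mA _; exact/esym/E.
rewrite fubini_tonelli1//; last by move=> z; rewrite lee_fin mulr_ge0.
rewrite /fubini_F.
transitivity (\int[distribution P U]_x ((F x)%:E * \int[P]_w (G (V w))%:E))%E.
  apply: eq_integral => x _ /=; under eq_integral => y _ do rewrite EFinM.
  rewrite ge0_integralZl//; last first.
  - by rewrite lee_fin.
  - by move=> y _; rewrite lee_fin.
  - exact/measurable_EFinP.
  congr (_ * _)%E; rewrite (@ge0_integral_distribution _ _ _ _ _ P V (EFin \o G))//.
  exact/measurable_EFinP.
rewrite ge0_integralZr//; last first.
- by apply: integral_ge0 => y _; rewrite lee_fin.
- by move=> y _; rewrite lee_fin.
- exact/measurable_EFinP.
congr (_ * _)%E; rewrite (@ge0_integral_distribution _ _ _ _ _ P U (EFin \o F))//.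
exact/measurable_EFinP.
Qed.

End Independence.

Section WeakLaw.
Context d (T : measurableType d) (R : realType) (P : probability T R).
Variables (Y : nat -> T -> R) (v W : R).
Hypothesis mY : forall j, measurable_fun setT (Y j).
Hypothesis Y0 : forall j w, 0 <= Y j w.
Hypothesis EY : forall j, (\int[P]_w (Y j w)%:E = v%:E)%E.
Hypothesis EY2 : forall j, (\int[P]_w (Y j w ^+ 2)%:E <= W%:E)%E.
Hypothesis EYY : forall i j, (i < j)%N ->
  (\int[P]_w (Y i w * Y j w)%:E = (v ^+ 2)%:E)%E.

Let S m w := \sum_(j < m) Y j w.

Let S0 m w : 0 <= S m w. Proof. exact: sumr_ge0. Qed.

Let mS m : measurable_fun setT (S m).
Proof. by apply: measurable_sum => j; exact: mY. Qed.

Let v0 : 0 <= v.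
Proof. by rewrite -lee_fin -(EY 0); apply: integral_ge0 => w _; rewrite lee_fin. Qed.

Let ES m : (\int[P]_w (S m w)%:E = (m%:R * v)%:E)%E.
Proof.
under eq_integral do rewrite -sumEFin.
rewrite ge0_integral_sum//=; last 2 first.
- by move=> j; exact/measurable_EFinP.
- by move=> j w _; rewrite lee_fin.
by under eq_bigr do rewrite EY; rewrite sumEFin sumr_const card_ord mulr_natl.
Qed.

Let ESY m : (\int[P]_w (S m w * Y m w)%:E = (m%:R * v ^+ 2)%:E)%E.
Proof.
under eq_integral do rewrite mulr_suml -sumEFin.
rewrite ge0_integral_sum//=; last 2 first.
- by move=> j; apply/measurable_EFinP; exact: measurable_funM.
- by move=> j w _; rewrite lee_fin mulr_ge0.
under eq_bigr => j _ do rewrite EYY//.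
by rewrite sumEFin sumr_const card_ord mulr_natl.
Qed.

Let ES2 m : (\int[P]_w (S m w ^+ 2)%:E <= (m%:R * W + (m%:R * v) ^+ 2)%:E)%E.
Proof.
elim: m => [|m IH].
  under eq_integral do rewrite /S big_ord0 expr0n /=.
  by rewrite integral0 !mul0r expr0n /= addr0.
under eq_integral => w _.
  have -> : S m.+1 w ^+ 2 = S m w ^+ 2 + (2 * (S m w * Y m w) + Y m w ^+ 2).
    by rewrite /S big_ord_recr /=; lra.
  rewrite EFinD; over.
have m2 : measurable_fun setT (fun w => 2 * (S m w * Y m w)).
  by apply: measurable_funM => //; exact: measurable_funM.
rewrite ge0_integralD//=; last 4 first.
- by move=> w _; rewrite lee_fin sqr_ge0.
- by apply/measurable_EFinP; exact: measurable_funX.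
- by move=> w _; rewrite lee_fin addr_ge0 ?sqr_ge0// !mulr_ge0.
- by apply/measurable_EFinP; apply: measurable_funD => //; exact: measurable_funX.
under [X in (_ + X)%E]eq_integral do rewrite EFinD.
rewrite ge0_integralD//=; last 4 first.
- by move=> w _; rewrite lee_fin !mulr_ge0.
- exact/measurable_EFinP.
- by move=> w _; rewrite lee_fin sqr_ge0.
- by apply/measurable_EFinP; exact: measurable_funX.
under [X in (_ + (X + _))%E]eq_integral do rewrite EFinM.
rewrite ge0_integralZl//=; last 2 first.
- by apply/measurable_EFinP; exact: measurable_funM.
- by move=> w _; rewrite lee_fin mulr_ge0.
rewrite ESY; apply: le_trans (leeD IH (leeD (lexx _) (EY2 m))) _.
rewrite -!EFinM -!EFinD lee_fin -natr1.
have := sqr_ge0 v; lra.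
Qed.

Lemma chebyshev_sum m (x : R) : 0 < x ->
  (P [set w | (x <= `|\sum_(j < m) Y j w - m%:R * v|)%R] <= (m%:R * W / x ^+ 2)%:E)%E.
Proof.
move=> x0; set a := m%:R * v.
have a0 : 0 <= a by rewrite mulr_ge0.
have mD : measurable_fun setT (fun w => (S m w - a) ^+ 2).
  by apply: measurable_funX; exact: measurable_funB.
have mA : measurable [set w | x <= `|S m w - a|].
  rewrite -[X in measurable X]setTI; apply: measurable_fun_le => //.
  by apply: measurableT_comp => //; exact: measurable_funB.
have V : (\int[P]_w ((S m w - a) ^+ 2)%:E <= (m%:R * W)%:E)%E.
  (* The square is expanded with the cross term on the other side of the equation, so that every
     integrand is nonnegative. *)
  have H : (\int[P]_w ((S m w - a) ^+ 2)%:E + (2 * a * a)%:E =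
      \int[P]_w (S m w ^+ 2)%:E + (a ^+ 2)%:E)%E.
    have -> : ((2 * a * a)%:E = \int[P]_w (2 * a * S m w)%:E)%E.
      under eq_integral do rewrite EFinM.
      rewrite ge0_integralZl//=; last 3 first.
      - exact/measurable_EFinP.
      - by move=> w _; rewrite lee_fin.
      - by rewrite lee_fin mulr_ge0.
      by rewrite ES -EFinM.
    have -> : ((a ^+ 2)%:E = \int[P]_w (a ^+ 2)%:E)%E.
      by rewrite integral_cst//= probability_setT mule1.
    rewrite -!ge0_integralD//=; last first.
    all: try by move=> w _; rewrite lee_fin ?sqr_ge0 ?mulr_ge0.
    all: try by apply/measurable_EFinP; exact: measurable_funX.
    all: try by apply/measurable_EFinP; exact: measurable_funM.
    all: try exact/measurable_EFinP.
    by apply: eq_integral => w _; rewrite -!EFinD; congr (_%:E); lra.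
  have := ES2 m; rewrite -(@leeD2rE _ (a ^+ 2)%:E)// -H -EFinD.
  have -> : ((m%:R * W + (m%:R * v) ^+ 2 + a ^+ 2)%:E = (m%:R * W)%:E + (2 * a * a)%:E)%E.
    by rewrite -EFinD; congr (_%:E); rewrite -/a; lra.
  by rewrite leeD2rE.
rewrite EFinM lee_pdivlMr ?exprn_gt0// muleC.
have -> : ((x ^+ 2)%:E * P [set w | (x <= `|S m w - a|)%R] =
   \int[P]_(w in [set w | (x <= `|S m w - a|)%R]) (x ^+ 2)%:E)%E.
  by rewrite integral_cst.
apply: le_trans V.
apply: (@le_trans _ _ (\int[P]_(w in [set w | (x <= `|S m w - a|)%R])
    ((S m w - a) ^+ 2)%:E)%E).
  apply: ge0_le_integral => //=.
  - by move=> w _; rewrite lee_fin sqr_ge0.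
  - by apply/measurable_EFinP; exact: measurable_funTS.
  - move=> w xw; rewrite lee_fin -[leRHS]ger0_norm ?sqr_ge0// normrX.
    by rewrite lerXn2r// nnegrE ltW.
apply: ge0_subset_integral => //.
- exact/measurable_EFinP.
- by move=> w _; rewrite lee_fin sqr_ge0.
Qed.

End WeakLaw.

Section Density.
Context d (T : measurableType d) (R : realType).
Variables (mu nu : {measure set T -> \bar R}) (g : T -> R).
Hypotheses (mg : measurable_fun setT g) (g0 : forall x, 0 <= g x).
Hypothesis nuE : forall A, measurable A -> (nu A = \int[mu]_(x in A) (g x)%:E)%E.

Import HBNNSimple.

(** Extended from indicators to simple functions by linearity, then by monotone convergence. *)
Lemma ge0_integral_density (f : T -> R) : measurable_fun setT f ->
  (forall x, 0 <= f x) ->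
  (\int[nu]_x (f x)%:E = \int[mu]_x (f x * g x)%:E)%E.
Proof.
move=> mf f0; have mf' : measurable_fun setT (EFin \o f) by exact/measurable_EFinP.
pose f_ := nnsfun_approx measurableT mf'.
have mh (h : {nnsfun T >-> R}) r : measurable (h @^-1` [set r]).
  by rewrite -[X in measurable X]setTI; exact: (@measurable_funP _ _ _ _ setT h).
have indicE_ E : measurable E ->
    (\int[nu]_x (\1_E x)%:E = \int[mu]_x (\1_E x * g x)%:E)%E.
  move=> mE; rewrite integral_indic// setIT nuE// integral_mkcond/=.
  by apply: eq_integral => x _; rewrite patchE indicE; case: ifPn => _; rewrite ?mul1r ?mul0r.
have nnE (h : {nnsfun T >-> R}) : (\int[nu]_x (h x)%:E = \int[mu]_x (h x * g x)%:E)%E.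
  have hE x : (h x)%:E = (\sum_(r \in range h) (r%:E * (\1_(h @^-1` [set r]) x)%:E))%E.
    by rewrite {1}fimfunE -fsumEFin//; apply: eq_fsbigr => r _; rewrite EFinM.
  have hgE x : (h x * g x)%:E = (\sum_(r \in range h) (r%:E * (\1_(h @^-1` [set r]) x * g x)%:E))%E.
    rewrite EFinM hE ge0_mule_fsuml; last by move=> r; rewrite -EFinM nnfun_muleindic_ge0.
    by apply: eq_fsbigr => r _; rewrite EFinM muleA.
  under [LHS]eq_integral do rewrite hE.
  under [RHS]eq_integral do rewrite hgE.
  have m1 r : measurable_fun setT (fun x => \1_(h @^-1` [set r]) x : R).
    exact: measurable_indic.
  rewrite [LHS]ge0_integral_fsum//; last 2 first.
  - by move=> r; apply/measurable_EFinP; apply: measurable_funM.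
  - by move=> r x _; rewrite -EFinM nnfun_muleindic_ge0.
  rewrite [RHS]ge0_integral_fsum//; last 2 first.
  - by move=> r; apply/measurable_EFinP; apply: measurable_funM => //; exact: measurable_funM.
  - by move=> r x _; rewrite -EFinM mulrA EFinM mule_ge0// ?nnfun_muleindic_ge0// lee_fin.
  apply: eq_fsbigr => r /[!inE] hr; have r0 : 0 <= r by case: hr => y _ <-.
  rewrite ge0_integralZl//; last exact/measurable_EFinP.
  rewrite ge0_integralZl//; first by rewrite indicE_.
  - by apply/measurable_EFinP; exact: measurable_funM.
  - by move=> x _; rewrite lee_fin mulr_ge0.
transitivity (lim (\int[nu]_x (f_ n x)%:E @[n --> \oo])%E).
  rewrite -monotone_convergence//=.
  - apply: eq_integral => x /[!inE] xD; apply/esym/cvg_lim => //=.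
    by apply: cvg_nnsfun_approx => // y _; rewrite lee_fin.
  - by move=> n; exact/measurable_EFinP/measurable_funTS.
  - by move=> n ? _; rewrite lee_fin.
  - by move=> ? _ ? ? mn; rewrite lee_fin; exact/lefP/nd_nnsfun_approx.
transitivity (lim (\int[mu]_x (f_ n x * g x)%:E @[n --> \oo])%E).
  by apply: congr_lim; apply/funext => n /=; exact: nnE.
rewrite -monotone_convergence//=.
- apply: eq_integral => x /[!inE] xD; apply/cvg_lim => //=.
  rewrite EFinM; under eq_fun do rewrite EFinM.
  by apply: cvgeZr => //; apply: cvg_nnsfun_approx => // y _; rewrite lee_fin.
- by move=> n; apply/measurable_EFinP; apply: measurable_funM => //; exact/measurable_funTS.
- by move=> n ? _; rewrite lee_fin mulr_ge0.
- by move=> ? _ ? ? mn; rewrite lee_fin ler_wpM2r//; exact/lefP/nd_nnsfun_approx.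
Qed.

End Density.

(** * Normal laws: eighth moment, scaling, positivity *)

Section NormalLaw.
Context {R : realType}.
Implicit Types s k x : R.

(** The integrand is compared pointwise with the density of doubled variance: for
    [y = x ^+ 2 / (4 * s ^+ 2)] the exponential is [expR (- y)] squared, and one factor absorbs
    [y ^+ 4]. The constant collects 2^8 from [x ^+ 8], 2^8 from [y ^+ 4] and 2 from the ratio of the
    peaks. *)
Lemma normal_prob_moment8 s : 0 < s ->
  (\int[normal_prob 0 s]_x (x ^+ 8)%:E <= (2 ^+ 17 * s ^+ 8)%:E)%E.
Proof.
move=> s0; have s'0 : s != 0 by rewrite gt_eqF.
pose t := Num.sqrt 2 * s.
have t0 : 0 < t by rewrite mulr_gt0// sqrtr_gt0.
have t2 : t ^+ 2 = 2 * s ^+ 2 by rewrite exprMn sqr_sqrtr.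
rewrite (@ge0_integral_density _ _ _ lebesgue_measure _ (normal_pdf 0 s))//; last first.
all: try by move=> x; rewrite ?normal_pdf_ge0// exprn_even_ge0.
all: try exact: measurable_normal_pdf.
apply: (@le_trans _ _ (\int[lebesgue_measure]_x ((2 ^+ 17 * s ^+ 8) * normal_pdf 0 t x)%:E)%E); last first.
  under eq_integral do rewrite EFinM.
  rewrite ge0_integralZl//=.
  - by rewrite integral_normal_pdf mule1.
  - by apply/measurable_EFinP; exact: measurable_normal_pdf.
  - by move=> x _; rewrite lee_fin normal_pdf_ge0.
  - by rewrite lee_fin mulr_ge0// exprn_ge0// ltW.
apply: ge0_le_integral => //=.
- by move=> x _; rewrite lee_fin mulr_ge0 ?normal_pdf_ge0// exprn_even_ge0.
- by apply/measurable_EFinP; apply: measurable_funM => //; exact: measurable_normal_pdf.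
- by apply/measurable_EFinP; apply: measurable_funM => //; exact: measurable_normal_pdf.
move=> x _; rewrite lee_fin !normal_pdfE// ?gt_eqF// /normal_fun !subr0 t2.
pose y := x ^+ 2 / (4 * s ^+ 2).
have s20 : 0 < s ^+ 2 by rewrite exprn_gt0.
have y0 : 0 <= y by rewrite divr_ge0 ?sqr_ge0// mulr_ge0// ltW.
have xE : x ^+ 2 = 4 * s ^+ 2 * y by rewrite /y mulrC divfK// gt_eqF// mulr_gt0.
have yE : y * (s ^+ 2 * (s ^+ 2)^-1) = y by rewrite divff ?mulr1// gt_eqF.
have -> : - x ^+ 2 / (s ^+ 2 *+ 2) = - y + - y by rewrite xE -(mulr_natr (s ^+ 2)) invfM; lra.
have -> : - x ^+ 2 / (2 * s ^+ 2 *+ 2) = - y by rewrite xE -(mulr_natr (2 * s ^+ 2)) !invfM; lra.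
have x8 : x ^+ 8 = 2 ^+ 8 * s ^+ 8 * y ^+ 4.
  have -> : x ^+ 8 = (x ^+ 2) ^+ 4 by rewrite -exprM.
  rewrite xE; lra.
(* From [1 + y / 4 <= expR (y / 4)] raised to the fourth power; 2^8 is 4^4. *)
have ey : y ^+ 4 * expR (- y) <= 2 ^+ 8.
  rewrite expRN ler_pdivrMr ?expR_gt0//.
  have -> : expR y = expR (y / 4) ^+ 4 by rewrite -expRM_natl mulrC divfK.
  have : (y / 4) ^+ 4 <= expR (y / 4) ^+ 4.
    have y4 : 0 <= y / 4 by lra.
    rewrite lerXn2r// ?nnegrE ?expR_ge0//.
    by have := expR_ge1Dx (y / 4); lra.
  by rewrite exprMn; lra.
have pk : normal_peak s <= 2 * normal_peak t.
  have r2 : 1 <= 2 / Num.sqrt 2 :> R.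
    rewrite ler_pdivlMr ?sqrtr_gt0// mul1r -[leRHS]ger0_norm// -sqrtr_sqr.
    by rewrite ler_sqrt ?sqr_ge0//; lra.
  rewrite /normal_peak t2 -(mulrA 2) -(mulrnAr 2) sqrtrM// invfM mulrA.
  by apply: ler_peMl => //; rewrite invr_ge0 sqrtr_ge0.
rewrite expRD x8.
have e0 := expR_gt0 (- y); have p0 := normal_peak_ge0 t; have ps0 := normal_peak_ge0 s.
have A1 : 0 <= 2 ^+ 8 * s ^+ 8 * expR (- y) :> R by rewrite !mulr_ge0 ?exprn_ge0// ltW.
have A2 : 0 <= y ^+ 4 * expR (- y) by rewrite mulr_ge0 ?exprn_ge0// ltW.
have : normal_peak s * (y ^+ 4 * expR (- y)) <= 2 * normal_peak t * 2 ^+ 8.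
  by apply: ler_pM.
move=> /(ler_wpM2l A1); lra.
Qed.

Lemma lebesgue_measure_scale k (A : set R) : 0 < k -> measurable A ->
  (lebesgue_measure [set x | A (k^-1 * x)%R] = k%:E * lebesgue_measure A)%E.
Proof.
move=> k0 mA.
pose f : measurableTypeR R -> measurableTypeR R := fun x => k^-1 * x.
have mf : measurable_fun [set: measurableTypeR R] f.
  by apply: measurable_funM.
have k0' : 0 <= k^-1 by rewrite invr_ge0 ltW.
pose fm : {mfun measurableTypeR R >-> measurableTypeR R} := HB.pack f
  (isMeasurableFun.Build _ _ _ _ f mf).
have H := @lebesgue_measure_unique R (mscale (NngNum k0') (pushforward lebesgue_measure fm)).
have {}H := H mf _ A mA.
rewrite H /mscale /pushforward /=; last first.
  move=> _ [[a b]] _ <-; rewrite /mscale /pushforward /=.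
  rewrite [pushforward _ _ _](_ : _ = lebesgue_measure `]k * a, k * b]%classic); last first.
    congr (lebesgue_measure _); apply/seteqP; split => x /=; rewrite !in_itv /= /f => /andP[ax xb].
      by move: ax xb; rewrite ltr_pdivlMl// ler_pdivrMl// => -> ->.
    by rewrite ltr_pdivlMl// ler_pdivrMl// ax xb.
  rewrite !lebesgue_measure_itv /= !lte_fin ltr_pM2l//; case: ifP => _.
    by rewrite -!EFinD -EFinM -mulrBr mulKf// gt_eqF.
  by rewrite mule0.
by rewrite muleA -EFinM divff ?gt_eqF// mul1e.
Qed.

Lemma normal_prob_scale k s (A : set R) : 0 < k -> 0 < s -> measurable A ->
  normal_prob 0 (k * s) [set x | A (k^-1 * x)] = normal_prob 0 s A.
Proof.
move=> k0 s0 mA; rewrite /normal_prob.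
pose f : measurableTypeR R -> measurableTypeR R := fun x => k^-1 * x.
have mf : measurable_fun [set: measurableTypeR R] f.
  by apply: measurable_funM.
pose fm : {mfun measurableTypeR R >-> measurableTypeR R} := HB.pack f
  (isMeasurableFun.Build _ _ _ _ f mf).
have ks : k * s != 0 by rewrite gt_eqF// mulr_gt0.
have pdfE x : normal_pdf 0 (k * s) x = k^-1 * normal_pdf 0 s (f x).
  rewrite !normal_pdfE ?gt_eqF// ?mulr_gt0// /normal_fun !subr0 mulrA; congr (_ * expR _).
    rewrite /normal_peak exprMn -mulrA -mulrnAr sqrtrM ?sqr_ge0// sqrtr_sqr gtr0_norm//.
    by rewrite invfM.
  rewrite /f exprMn !exprMn -mulrnAr invfM exprVn; lra.
have mg : measurable_fun setT (fun y => (k^-1 * normal_pdf 0 s y)%:E).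
  by apply/measurable_EFinP; apply: measurable_funM => //; exact: measurable_normal_pdf.
have k0' : 0 <= k by rewrite ltW.
under eq_integral do rewrite pdfE.
rewrite -[X in (\int[_]_(x in X) _)%E]/(fm @^-1` A).
have := @ge0_integral_pushforward _ _ _ _ R fm mf lebesgue_measure A
  (fun y => (k^-1 * normal_pdf 0 s y)%:E) mA.
move=> <-; last 2 first.
- exact: measurable_funTS.
- by move=> y _; rewrite lee_fin mulr_ge0 ?normal_pdf_ge0// invr_ge0.
rewrite (@eq_measure_integral _ _ _ _ (mscale (NngNum k0') lebesgue_measure)); last first.
  by move=> B mB _; rewrite /mscale /pushforward /=; exact: lebesgue_measure_scale.
rewrite ge0_integral_mscale//; last 2 first.
- exact: measurable_funTS.
- by move=> y _; rewrite lee_fin mulr_ge0 ?normal_pdf_ge0// invr_ge0.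
rewrite -ge0_integralZl//=.
- by apply: eq_integral => y _; rewrite -EFinM mulVKf// gt_eqF.
- exact: measurable_funTS.
- by move=> y _; rewrite lee_fin mulr_ge0 ?normal_pdf_ge0// invr_ge0.
Qed.

(** On this interval an increment exceeds the unit cost by at least 1, which makes the mean block
    gain positive in [mean_gt0]. *)
Lemma normal_prob_gt0 s : 0 < s -> (0 < normal_prob 0 s `]2%R, 3%R])%E.
Proof.
move=> s0; rewrite /normal_prob.
pose c := normal_pdf 0 s 3.
have c0 : 0 < c by rewrite /c normal_pdfE ?gt_eqF// mulr_gt0 ?normal_peak_gt0 ?expR_gt0 ?gt_eqF.
apply: (@lt_le_trans _ _ (\int[lebesgue_measure]_(x in `]2%R, 3%R]) c%:E)%E).
  rewrite integral_cst//= lebesgue_measure_itv /= lte_fin ifT; last by lra.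
  by rewrite -EFinD -EFinM lte_fin mulr_gt0//; lra.
apply: ge0_le_integral => //=.
- by move=> x _; rewrite lee_fin ltW.
- by apply/measurable_EFinP; apply: measurable_funTS; exact: measurable_normal_pdf.
move=> x; rewrite in_itv /= => /andP[x2 x3].
rewrite lee_fin /c !normal_pdfE ?gt_eqF// ler_wpM2l ?normal_peak_ge0// ler_expR.
rewrite !subr0 ler_pM2r ?invr_gt0 ?mulrn_wgt0 ?exprn_gt0// lerN2.
by rewrite lerXn2r// ?nnegrE; lra.
Qed.

End NormalLaw.

(** * Block gains of Brownian motion *)

Section GainBlocks.
Context {R : realType}.
Implicit Types (x : nat -> R).

Lemma tradeDc x k i :
  trade (fun j => x j + k) i = ((trade x i).1, (trade x i).2 - k).
Proof.
elim: i => [|i IH] /=; first by rewrite opprD.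
have -> : Num.max (trade (fun j => x j + k) i).2
      ((trade (fun j => x j + k) i).1 - (x i.+1 + k)) =
    Num.max (trade x i).2 ((trade x i).1 - x i.+1) - k.
  rewrite IH /= opprD addrA.
  by case: (leP (trade x i).2) => ?; [rewrite max_r//; lra|rewrite max_l//; lra].
rewrite IH /=; set b := Num.max (trade x i).2 _; congr (_, _).
by congr Num.max; lra.
Qed.

Lemma gainDc x k i : gain (fun j => x j + k) i = gain x i.
Proof. by rewrite /gain tradeDc. Qed.

Lemma eq_gain x y i : (forall j, (j <= i)%N -> x j = y j) -> gain x i = gain y i.
Proof.
move=> xy; suff : trade x i = trade y i by rewrite /gain => ->.
elim: i xy => [|i IH] xy /=; first by rewrite xy.
by rewrite IH ?xy// => j ji; apply: xy; exact: leqW.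
Qed.

Lemma gain_window x a b l : (a <= b)%N -> adm a b l ->
  usum x 1 l <= gain (fun i => x (a + i)%N) (b - a).
Proof.
move=> ab al; pose f := fun i : nat => (i - a)%N.
have fl : adm (f a) (f b) (map (pair_map f) l).
  apply: adm_map al => i j; rewrite !inE !leEnat => _ _ ij.
  exact: leq_sub2r.
have := gain_ub (fun i => x (a + i)%N) fl; rewrite /f subnn.
have -> : gain (fun i => x (a + i)%N) 0 = 0 by [].
rewrite add0r; apply: le_trans; rewrite usum_map.
rewrite (eq_usum (h' := (fun i => x (a + i)%N) \o f) 1 al)//= => i.
by rewrite !leEnat /f => /andP[ai ib]; rewrite subnKC.
Qed.

(** Trading block by block is one way to trade, whence the lower bound; cutting an optimal list at
    each block boundary loses at most one unit by [usum_split], whence the upper bound. *)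
Lemma gain_blocks x m M :
  \sum_(j < m) gain (fun i => x (j * M + i)%N) M <= gain x (m * M) <=
  \sum_(j < m) gain (fun i => x (j * M + i)%N) M + m%:R.
Proof.
elim: m => [|m /andP[IH1 IH2]]; first by rewrite mul0n big_ord0 addr0 /gain /= lexx.
rewrite big_ord_recr /= mulSnr; set S := \sum_(_ < _) _ in IH1 IH2 *; apply/andP; split.
  have [l ml <-] := gain_attained (fun i => x (m * M + i)%N) M.
  pose f := fun i : nat => (m * M + i)%N.
  have fl : adm (f 0%N) (f M) (map (pair_map f) l).
    apply: adm_map ml => i j; rewrite !inE !leEnat => _ _ ij.
    by rewrite leq_add2l.
  have := gain_ub x fl; rewrite usum_map /f addn0 /comp; lra.
have [l ml <-] := gain_attained x (m * M + M).
have [||l1 [l2 [b1 b2]]] := usum_split x ler01 _ _ ml (t := (m * M)%N).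
- by rewrite leEnat.
- by rewrite leEnat leq_addr.
have := gain_ub x b1; have := gain_window x (leq_addr _ _) b2; rewrite addKn.
have -> : gain x 0 = 0 by [].
rewrite -natr1; lra.
Qed.

Lemma gain_refine x M : gain (fun i => x (i * 2)%N) M <= gain x (M * 2).
Proof.
have [l ml <-] := gain_attained (fun i => x (i * 2)%N) M.
pose f := fun i : nat => (i * 2)%N.
have fl : adm (f 0%N) (f M) (map (pair_map f) l).
  apply: adm_map ml => i j; rewrite !inE !leEnat => _ _ ij.
  by rewrite leq_mul2r ij orbT.
have := gain_ub x fl; rewrite usum_map /f /comp mul0n.
have -> : gain x 0 = 0 by [].
by rewrite add0r.
Qed.

Lemma measurable_trade d (T : measurableType d) (x : nat -> T -> R) i :
  (forall j, measurable_fun setT (x j)) ->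
  measurable_fun setT (fun w => (trade (x ^~ w) i).1) /\
  measurable_fun setT (fun w => (trade (x ^~ w) i).2).
Proof.
move=> mx; elim: i => [|i [m1 m2]] /=.
  by split; [exact: measurable_cst|exact: measurableT_comp].
have mb : measurable_fun setT (fun w => Num.max (trade (x^~ w) i).2
    ((trade (x^~ w) i).1 - x i.+1 w)).
  by apply: measurable_maxr => //; exact: measurable_funB.
split => //; apply: measurable_maxr => //; apply: measurable_funB => //.
exact: measurable_funD.
Qed.

Lemma measurable_gain d (T : measurableType d) (x : nat -> T -> R) i :
  (forall j, measurable_fun setT (x j)) ->
  measurable_fun setT (fun w => gain (x ^~ w) i).
Proof. by move=> mx; exact: (measurable_trade i mx).1. Qed.

End GainBlocks.

Section IidNormal.
Context d (T : measurableType d) (R : realType) (P : probability T R).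
Variable sigma : R.

Definition iid_normal (Z : T -> realseq R) : Prop :=
  forall n (A : nat -> set R), (forall i, measurable (A i)) ->
    P [set w | forall i, (i < n)%N -> A i (Z w i)] =
    (\prod_(i < n) normal_prob 0 sigma (A i))%E.

Lemma iid_normal_shift (Z : T -> realseq R) k : iid_normal Z ->
  iid_normal (fun w i => Z w (k + i)%N).
Proof.
move=> iZ n A mA.
rewrite (_ : [set _ | _] = [set w | forall i, (i < k + n)%N ->
    (if (i < k)%N then setT else A (i - k)%N) (Z w i)]); last first.
  apply/seteqP; split => w /= H i.
    move=> ikn; case: (ltnP i k) => // ki; have := H (i - k)%N; rewrite subnKC//; apply.
    by rewrite ltn_subLR.
  by move=> ni; have := H (k + i)%N; rewrite ltn_add2l (ltnNge (k + i)) leq_addr /= addKn; exact.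
rewrite (iZ _ (fun i => if (i < k)%N then setT else A (i - k)%N)); last by move=> i; case: ifP.
rewrite big_split_ord /= big1 ?mul1e; last first.
  by move=> i _; rewrite ltn_ord probability_setT.
by apply: eq_bigr => i _; rewrite ltnNge leq_addr /= addKn.
Qed.

(** Padding with zeros keeps the first [M] coordinates in [realseq R], the space in which the
    remaining ones live, so that [indep_integralM] applies to both. *)
Definition seq_trunc M (f : realseq R) : realseq R := fun i => if (i < M)%N then f i else 0.

Lemma iid_normal_indep (Z : {mfun T >-> realseq R}) M (F G : realseq R -> R) :
  iid_normal Z -> measurable_fun setT F -> measurable_fun setT G ->
  (forall x, 0 <= F x) -> (forall x, 0 <= G x) ->
  (\int[P]_w (F (seq_trunc M (Z w)) * G (fun i => Z w (M + i)%N))%:E =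
   \int[P]_w (F (seq_trunc M (Z w)))%:E *
   \int[P]_w (G (fun i => Z w (M + i)%N))%:E)%E.
Proof.
move=> iZ mF mG F0 G0.
have mZ i : measurable_fun setT (fun w => Z w i : R).
  by apply: (measurableT_comp (measurable_coord i)).
have mU : measurable_fun setT (fun w => seq_trunc M (Z w)).
  apply: measurable_fun_realseq => i; rewrite /seq_trunc.
  by case: (i < M)%N => //; exact: measurable_cst.
have mV : measurable_fun setT (fun w => (fun i => Z w (M + i)%N) : realseq R).
  exact: measurable_fun_realseq.
pose U : {mfun T >-> realseq R} := HB.pack (fun w => seq_trunc M (Z w))
  (isMeasurableFun.Build _ _ _ _ _ mU).
pose V : {mfun T >-> realseq R} := HB.pack (fun w => (fun i => Z w (M + i)%N) : realseq R)
  (isMeasurableFun.Build _ _ _ _ _ mV).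
apply: (@indep_integralM _ _ _ P U V) => // _ _ [n [A [mA ->]]] [n' [A' [mA' ->]]].
have iV := iid_normal_shift M iZ.
(* The padded coordinates are constantly 0: a constraint on them either holds always or empties the
   event. *)
have [A0|nA0] := pselect (forall i, (M <= i < n)%N -> A i 0); last first.
  have U0 : U @^-1` [set f | forall i, (i < n)%N -> A i (f i)] = set0.
    apply/seteqP; split => // w /= H; apply: nA0 => i /andP[Mi ni].
    by have := H i ni; rewrite /seq_trunc ltnNge Mi.
  by rewrite U0 set0I measure0 mul0e.
pose B i := if (i < n)%N then A i else setT.
have mB i : measurable (B i) by rewrite /B; case: ifP.
have UE : U @^-1` [set f | forall i, (i < n)%N -> A i (f i)] =
    [set w | forall i, (i < M)%N -> B i (Z w i)].
  apply/seteqP; split => w /= H i.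
    by move=> iM; rewrite /B; case: ifP => // ni; have := H i ni; rewrite /seq_trunc iM.
  move=> ni; rewrite /seq_trunc; case: ltnP => iM; last by apply: A0; rewrite iM.
  by have := H i iM; rewrite /B ni.
rewrite UE (iZ M B mB) [P (V @^-1` _)](iV n' A' mA').
pose C i := if (i < M)%N then B i else A' (i - M)%N.
rewrite (_ : _ `&` _ = [set w | forall i, (i < M + n')%N -> C i (Z w i)]); last first.
  apply/seteqP; split => [w [/= H1 H2] i iMn|w /= H].
    rewrite /C; case: ltnP => iM; first exact: H1.
    by have := H2 (i - M)%N; rewrite subnKC//; apply; rewrite ltn_subLR.
  split => i ii.
    by have := H i; rewrite /C ii; apply; exact: ltn_addr.
  by have := H (M + i)%N; rewrite /C ltn_add2l (ltnNge (M + i)) leq_addr /= addKn; exact.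
rewrite iZ; last by move=> i; rewrite /C; case: ifP.
rewrite big_split_ord /=; congr (_ * _)%E; apply: eq_bigr => i _.
  by rewrite /C ltn_ord.
by rewrite /C ltnNge leq_addr /= addKn.
Qed.

Lemma iid_normal_integral (Z Z' : {mfun T >-> realseq R}) (F : realseq R -> R) :
  iid_normal Z -> iid_normal Z' -> measurable_fun setT F -> (forall x, 0 <= F x) ->
  (\int[P]_w (F (Z w))%:E = \int[P]_w (F (Z' w))%:E)%E.
Proof.
move=> iZ iZ' mF F0.
have mF' : measurable_fun setT (EFin \o F) by exact/measurable_EFinP.
have F0' x : (0 <= (EFin \o F) x)%E by rewrite lee_fin.
rewrite -[LHS](@ge0_integral_distribution _ _ _ _ _ P Z (EFin \o F))//.
rewrite -[RHS](@ge0_integral_distribution _ _ _ _ _ P Z' (EFin \o F))//.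
apply: eq_measure_integral => A mA _.
apply: (@seq_measure_unique _ (distribution P Z) (distribution P Z')) => //.
  by apply: (@le_lt_trans _ _ 1%E); [apply: probability_le1|exact: ltry].
by move=> _ [n [B [mB ->]]]; rewrite [LHS]iZ// [RHS]iZ'.
Qed.

End IidNormal.

Section BrownianBlocks.
Context d (T : measurableType d) (R : realType) (P : probability T R).
Variable B : R -> {RV P >-> R}.
Hypothesis hB : brownian_motion B.

Lemma BM_increment_moment8 s t : 0 <= s -> s < t ->
  (\int[P]_w ((B t w - B s w) ^+ 8)%:E <= (2 ^+ 17 * (t - s) ^+ 4)%:E)%E.
Proof.
move=> s0 st; have [_ _ hN _] := hB.
have mX : measurable_fun setT (fun w => B t w - B s w) by exact: measurable_funB.
pose X : {mfun T >-> measurableTypeR R} := HB.pack (fun w => B t w - B s w : measurableTypeR R)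
  (isMeasurableFun.Build _ _ T (measurableTypeR R) _ mX).
have m8 : measurable_fun setT (fun x : R => x ^+ 8) by exact: measurable_funX.
have E0 x : (0 <= (x ^+ 8)%:E :> \bar R)%E by rewrite lee_fin exprn_even_ge0.
have := @ge0_integral_distribution _ _ _ _ _ P X (fun x => (x ^+ 8)%:E).
rewrite /comp /= => <-//; last exact/measurable_EFinP.
rewrite (eq_measure_integral (normal_prob 0 (Num.sqrt (t - s)))); last first.
  by move=> A mA _; exact: hN s0 st A mA.
apply: le_trans (normal_prob_moment8 _) _; first by rewrite sqrtr_gt0 subr_gt0.
by rewrite (exprM _ 2 4) sqr_sqrtr// subr_ge0 ltW.
Qed.

(* Increments over a mesh [tau], in units where time [eps ^+ 2] and space [eps] *)
(* become [1].                                                                  *)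
Definition scaled_incr (s eps tau : R) (w : T) : realseq R := fun i =>
  eps^-1 * (B (s + eps ^+ 2 * (tau * i.+1%:R)) w - B (s + eps ^+ 2 * (tau * i%:R)) w).

Lemma measurable_scaled_incr s eps tau : measurable_fun setT (scaled_incr s eps tau).
Proof.
apply: measurable_fun_realseq => i; apply: measurable_funM => //.
exact: measurable_funB.
Qed.

HB.instance Definition _ s eps tau := isMeasurableFun.Build _ _ _ _
  (scaled_incr s eps tau) (measurable_scaled_incr s eps tau).

Lemma scaled_incr_iid s eps tau : 0 <= s -> 0 < eps -> 0 < tau ->
  iid_normal P (Num.sqrt tau) (scaled_incr s eps tau).
Proof.
move=> s0 e0 t0 n A mA; have [_ _ hN hI] := hB.
pose t (i : nat) := s + eps ^+ 2 * (tau * i%:R).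
have tS i : t i < t i.+1.
  by rewrite /t ltrD2l ltr_pM2l ?exprn_gt0// ltr_pM2l// ltr_nat.
have t00 : 0 <= t 0 by rewrite /t mulr0 mulr0 addr0.
have ti0 i : 0 <= t i.
  by elim: i => // i IH; exact: le_trans IH (ltW (tS i)).
have mA' i : measurable [set x : R | A i (eps^-1 * x)].
  rewrite -[X in measurable X]setTI.
  by apply: (@measurable_funM _ _ _ setT (cst eps^-1) id) => //.
have := hI n t t00 (fun i => ltW (tS i)) (fun i => [set x : R | A i (eps^-1 * x)]) mA'.
move=> ->; apply: eq_bigr => i _.
rewrite (hN _ _ (ti0 i) (tS i)); last exact: mA'.
have -> : t i.+1 - t i = eps ^+ 2 * tau by rewrite /t -natr1; lra.
have -> : Num.sqrt (eps ^+ 2 * tau) = eps * Num.sqrt tau.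
  by rewrite sqrtrM ?sqr_ge0// sqrtr_sqr gtr0_norm.
by apply: normal_prob_scale => //; rewrite sqrtr_gt0.
Qed.

Definition scaled_path (s eps tau : R) (w : T) (i : nat) : R :=
  eps^-1 * B (s + eps ^+ 2 * (tau * i%:R)) w.

Definition gain_incr M (f : realseq R) : R := gain (fun i => \sum_(k < i) f k) M.

Lemma gain_incr_ge0 M f : 0 <= gain_incr M f. Proof. exact: gain_ge0. Qed.

Lemma gain_incr_trunc M f : gain_incr M (seq_trunc M f) = gain_incr M f.
Proof.
apply: eq_gain => j jM; apply: eq_bigr => i _; rewrite /seq_trunc ifT//.
exact: leq_trans (ltn_ord i) jM.
Qed.

Lemma measurable_gain_incr M : measurable_fun setT (gain_incr M).
Proof.
apply: (@measurable_gain R _ (realseq R) (fun i f => \sum_(k < i) f k) M) => j.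
by apply: measurable_sum => k; exact: measurable_coord.
Qed.

Definition block s eps tau M (j : nat) (w : T) : R :=
  gain (fun i => scaled_path s eps tau w (j * M + i)%N) M.

Lemma blockE s eps tau M j w :
  block s eps tau M j w = gain_incr M (fun i => scaled_incr s eps tau w (j * M + i)%N).
Proof.
rewrite /block /gain_incr.
rewrite -[RHS](gainDc _ (scaled_path s eps tau w (j * M))).
apply: eq_gain => i _; elim: i => [|i IH]; first by rewrite big_ord0 add0r addn0.
rewrite big_ord_recr /= addrAC -IH addnS /scaled_path /scaled_incr; lra.
Qed.

Lemma measurable_block s eps tau M j : measurable_fun setT (block s eps tau M j).
Proof.
apply: (@measurable_gain R _ T (fun i w => scaled_path s eps tau w (j * M + i)%N) M) => i.
by apply: measurable_funM.
Qed.

Lemma block_ge0 s eps tau M j w : 0 <= block s eps tau M j w.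
Proof. exact: gain_ge0. Qed.

Definition block_mean tau M : \bar R := (\int[P]_w (block 0 1 tau M 0 w)%:E)%E.

Definition shifted_incr s eps tau k w : realseq R :=
  fun i => scaled_incr s eps tau w (k + i)%N.

Lemma measurable_shifted_incr s eps tau k :
  measurable_fun setT (shifted_incr s eps tau k).
Proof.
apply: measurable_fun_realseq => i.
exact: (measurableT_comp (measurable_coord _) (measurable_scaled_incr s eps tau)).
Qed.

HB.instance Definition _ s eps tau k := isMeasurableFun.Build _ _ _ _
  (shifted_incr s eps tau k) (measurable_shifted_incr s eps tau k).

Lemma integral_block s eps tau M j : 0 <= s -> 0 < eps -> 0 < tau ->
  (\int[P]_w (block s eps tau M j w)%:E)%E = block_mean tau M.
Proof.
move=> s0 e0 t0; rewrite /block_mean.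
under eq_integral do rewrite blockE.
under [RHS]eq_integral do rewrite blockE.
apply: (@iid_normal_integral _ _ _ P (Num.sqrt tau)
  (shifted_incr s eps tau (j * M)) (shifted_incr 0 1 tau (0 * M))
  (gain_incr M)).
- exact/iid_normal_shift/scaled_incr_iid.
- by apply/iid_normal_shift/scaled_incr_iid.
- exact: measurable_gain_incr.
- exact: gain_incr_ge0.
Qed.

Lemma integral_blockM s eps tau M i j : 0 <= s -> 0 < eps -> 0 < tau -> (i < j)%N ->
  (\int[P]_w (block s eps tau M i w * block s eps tau M j w)%:E)%E =
  (block_mean tau M * block_mean tau M)%E.
Proof.
move=> s0 e0 t0 ij.
rewrite -{1}(integral_block M i s0 e0 t0) -(integral_block M j s0 e0 t0).
(* The sequence is made to start at block [i], so that this block reads the first [M] coordinates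
   and block [j] only later ones. *)
pose Z : {mfun T >-> realseq R} :=
  shifted_incr s eps tau (i * M).
have iZ : iid_normal P (Num.sqrt tau) Z by exact/iid_normal_shift/scaled_incr_iid.
pose G : realseq R -> R := fun f => gain_incr M (fun k => f ((j - i.+1) * M + k)%N).
have mG : measurable_fun setT G.
  apply: (measurableT_comp (measurable_gain_incr M)).
  by apply: measurable_fun_realseq => k; exact: measurable_coord.
have := @iid_normal_indep _ _ _ P (Num.sqrt tau) Z M (gain_incr M) G iZ
  (measurable_gain_incr M) mG (gain_incr_ge0 M) (fun f => gain_incr_ge0 _ _).
have GE w : G (fun k => Z w (M + k)%N) = block s eps tau M j w.
  rewrite blockE /G /Z /=; congr gain_incr; apply/funext => k.
  congr (scaled_incr _ _ _ _ _); rewrite !addnA; congr (_ + _)%N.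
  by rewrite -mulSnr -mulnDl subnKC.
have FE w : gain_incr M (seq_trunc M (Z w)) = block s eps tau M i w.
  by rewrite gain_incr_trunc blockE.
under eq_integral do rewrite GE FE.
under [X in _ = (X * _)%E -> _]eq_integral do rewrite FE.
by under [X in _ = (_ * X)%E -> _]eq_integral do rewrite GE.
Qed.

End BrownianBlocks.

(** * From meshes to continuous time *)

Section GridLimit.
Context {R : realType}.
Variables (h : R -> R) (s e : R) (L : nat).
Hypotheses (s0 : 0 <= s) (e0 : 0 < e).
Hypothesis ch : {within `[0, +oo[, continuous h}.

Let idx N (u : R) : nat := Num.truncn ((u - s) / e * 2 ^+ N).
Let pt N (u : R) : R := s + e * ((2 ^+ N)^-1 * (idx N u)%:R).

Let pt_near N u : s <= u -> u - e / 2 ^+ N < pt N u <= u.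
Proof.
move=> su; have p2 : 0 < 2 ^+ N :> R by rewrite exprn_gt0.
have e2 : e * (2 ^+ N)^-1 > 0 by rewrite mulr_gt0 ?invr_gt0.
have x0 : 0 <= (u - s) / e * 2 ^+ N.
  by rewrite mulr_ge0 ?(ltW p2)// divr_ge0 ?(ltW e0) ?subr_ge0.
have /andP[h1 h2] := truncn_itv x0; rewrite -/(idx N u) in h1 h2.
have uE : u = s + e * (2 ^+ N)^-1 * ((u - s) / e * 2 ^+ N).
  rewrite mulrAC mulrA (mulrC e) divfK ?gt_eqF// mulfK ?gt_eqF//; lra.
rewrite /pt mulrA; apply/andP; split.
  rewrite {1}uE; move: h2; rewrite -(ltr_pM2l e2) -(natr1 (idx N u)) mulrDr mulr1.
  lra.
rewrite {2}uE lerD2l ler_pM2l//.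
Qed.

Let pt_cvg u : s <= u -> (fun N => h (pt N u)) @ \oo --> h u.
Proof.
move=> su; apply/cvgrPdist_lt => d d0.
have u0 : `[0, +oo[%classic u by rewrite /= in_itv /= andbT (le_trans s0).
have /subspace_continuousP/(_ u u0) /cvgrPdist_lt/(_ d d0)[r /= r0 Hr] := ch.
have c0 : (fun N => 2^-1 ^+ N : R) @ \oo --> (0 : R).
  by apply: cvg_expr; rewrite ger0_norm ?invr_ge0// invf_lt1// ltr1n.
have re0 : 0 < r / e by rewrite divr_gt0.
have /cvgrPdist_lt/(_ _ re0) H := c0; near=> N.
have : `|0 - 2^-1 ^+ N| < r / e by near: N.
rewrite sub0r normrN ger0_norm ?exprn_ge0 ?invr_ge0// exprVn ltr_pdivlMr// mulrC => eN.
have /andP[p1 p2] := pt_near N su.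
apply: Hr => /=.
  by rewrite ger0_norm ?subr_ge0//; lra.
rewrite in_itv /= andbT /pt addr_ge0// !mulr_ge0 ?(ltW e0)// invr_ge0 exprn_ge0//.
Unshelve. all: by end_near. Qed.

Let usum_cvg (k t : R) l : adm s t l -> usum (h \o pt N) k l @[N --> \oo] --> usum h k l.
Proof.
suff H t' : s <= t' -> adm t' t l -> usum (h \o pt N) k l @[N --> \oo] --> usum h k l.
  by apply: H; exact: lexx.
elim: l t' => [|[a b] l IH] u su /=.
  by move=> _; under eq_fun do rewrite usum_nil; rewrite usum_nil; exact: cvg_cst.
move=> /and3P[ua ab bt]; under eq_fun do rewrite usum_cons; rewrite usum_cons /=.
have sa : s <= a by exact: le_trans ua.
have sb : s <= b by exact: le_trans ab.
apply: cvgD; last exact: IH bt.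
apply: cvgB; last exact: cvg_cst.
by apply: cvgB; exact: pt_cvg.
Qed.

(** Rounding a fixed list down to the mesh gives a list of grid indices, and its sum converges by
    continuity of [h] at finitely many times. *)
Lemma usum_le_grid (k th : R) l : 0 < k ->
  (forall N, gain (fun i => k^-1 * h (s + e * ((2 ^+ N)^-1 * i%:R))) (L * 2 ^ N) <= th) ->
  adm s (s + e * L%:R) l -> usum h k l <= k * th.
Proof.
move=> k0 H sl.
have Hk N : usum (h \o pt N) k l <= k * th.
  pose x i := k^-1 * h (s + e * ((2 ^+ N)^-1 * i%:R)).
  have fl : adm (idx N s) (idx N (s + e * L%:R)) (map (pair_map (idx N)) l).
    apply: adm_map sl => u v _ _ uv; rewrite leEnat; apply: le_truncn.
    by rewrite ler_wpM2r ?exprn_ge0// ler_wpM2r ?invr_ge0 ?(ltW e0)// lerB.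
  have := gain_ub x fl; rewrite usum_map.
  rewrite /idx subrr !mul0r truncn0 -/(idx N).
  have -> : gain x 0 = 0 by [].
  rewrite add0r (_ : (s + e * L%:R - s) / e * 2 ^+ N = L%:R * 2 ^+ N); last first.
    by rewrite addrAC subrr add0r (mulrC e) mulfK// gt_eqF.
  have -> : L%:R * 2 ^+ N = (L * 2 ^ N)%:R :> R by rewrite natrM natrX.
  rewrite natrK => /le_trans/(_ (H N)) => H1.
  have -> : usum (h \o pt N) k l = k * usum (x \o idx N) 1 l.
    rewrite -usumZ mulr1; congr (usum _ _ _); apply/funext => u /=.
    by rewrite /x mulVKf// gt_eqF.
  by rewrite ler_pM2l.
have /cvg_lim <-// := @usum_cvg k _ _ sl.
by apply: limr_le; [apply/cvg_ex; exists (usum h k l); exact: (@usum_cvg k _ _ sl)|exact: nearW].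
Qed.

Lemma grid_usum (k : R) N (y : R) : 0 < k ->
  y <= gain (fun i => k^-1 * h (s + e * ((2 ^+ N)^-1 * i%:R))) (L * 2 ^ N) ->
  exists2 l, adm s (s + e * L%:R) l & k * y <= usum h k l.
Proof.
move=> k0; have [l ml <-] := gain_attained
  (fun i => k^-1 * h (s + e * ((2 ^+ N)^-1 * i%:R))) (L * 2 ^ N)%N => yl.
pose f (i : nat) := s + e * ((2 ^+ N)^-1 * i%:R).
exists (map (pair_map f) l).
  have -> : s = f 0%N by rewrite /f !mulr0 addr0.
  have -> : f 0%N + e * L%:R = f (L * 2 ^ N)%N.
    by rewrite /f !mulr0 addr0 natrM natrX (mulrC _ (L%:R * _)) mulfK// expf_neq0.
  apply: adm_map ml => i j _ _ ij; rewrite /f lerD2l ler_pM2l// ler_pM2l ?invr_gt0 ?exprn_gt0//.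
  by rewrite ler_nat.
rewrite usum_map -(ler_pM2l (x := k^-1)) ?invr_gt0// mulKf ?gt_eqF//.
apply: (le_trans yl); rewrite -usumZ mulVf ?gt_eqF//.
Qed.

End GridLimit.

(** * Moments of block gains, uniformly in the mesh *)

Section BlockMoments.
Context d (T : measurableType d) (R : realType) (P : probability T R).
Variable B : R -> {RV P >-> R}.
Hypothesis hB : brownian_motion B.

Local Notation path := (scaled_path B).
Local Notation tau N := ((2 ^+ N)^-1 : R).
Local Notation blk s eps k N := (block B s eps (tau N) (2 ^ (k + N))).

(** 14^8 comes from [gain_moment], 2^17 from the eighth normal moment, and one more factor 2 from
    the geometric series over dyadic levels. The mesh index [N] does not enter. *)
Definition block_bound (k : nat) : R := 14 ^+ 8 * (2 ^+ 18 * (2 ^+ k) ^+ 4).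

Lemma scaled_path_moment8 s eps k N n i j : 0 <= s -> 0 < eps -> (n <= k + N)%N ->
  (\int[P]_w ((path s eps (tau N) w (j + i.+1 * 2 ^ (k + N - n)) -
               path s eps (tau N) w (j + i * 2 ^ (k + N - n))) ^+ 8)%:E <=
   (2 ^+ 17 * (2 ^+ k / 2 ^+ n) ^+ 4)%:E)%E.
Proof.
move=> s0 e0 nkN.
pose a := s + eps ^+ 2 * (tau N * (j + i * 2 ^ (k + N - n))%:R).
pose b := s + eps ^+ 2 * (tau N * (j + i.+1 * 2 ^ (k + N - n))%:R).
have e2 : 0 < eps ^+ 2 by rewrite exprn_gt0.
have a0 : 0 <= a by rewrite addr_ge0// mulr_ge0 ?(ltW e2)// mulr_ge0// ltW.
have baE : b - a = eps ^+ 2 * (2 ^+ k / 2 ^+ n).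
  have E : tau N * 2 ^+ (k + N - n) = 2 ^+ k / 2 ^+ n.
    have -> : 2 ^+ k / 2 ^+ n = tau N * (2 ^+ (k + N) / 2 ^+ n).
      have e : tau N * 2 ^+ N = 1 by rewrite mulVf// expf_neq0.
      rewrite exprD; set a' := 2 ^+ k; set c := (2 ^+ n)^-1.
      have -> : tau N * (a' * 2 ^+ N * c) = (tau N * 2 ^+ N) * (a' * c) by lra.
      by rewrite e mul1r.
    congr (_ * _); rewrite -{2}(subnK nkN) exprD mulfK// expf_neq0//.
  rewrite /b /a mulSn !natrD natrX -E; lra.
have ab : a < b by rewrite -subr_gt0 baE mulr_gt0// divr_gt0// exprn_gt0.
have mD : measurable_fun setT (fun w => (B b w - B a w) ^+ 8).
  by apply: measurable_funX; exact: measurable_funB.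
under eq_integral => w _.
  have -> : (path s eps (tau N) w (j + i.+1 * 2 ^ (k + N - n)) -
      path s eps (tau N) w (j + i * 2 ^ (k + N - n))) ^+ 8 =
      (eps^-1) ^+ 8 * (B b w - B a w) ^+ 8.
    by rewrite -exprMn mulrBr.
  rewrite EFinM; over.
have ie8 : 0 <= eps^-1 ^+ 8 by rewrite exprn_ge0// invr_ge0 ltW.
rewrite ge0_integralZl//=; last 2 first.
- exact/measurable_EFinP.
- by move=> w _; rewrite lee_fin exprn_even_ge0.
apply: le_trans (lee_wpmul2l _ (BM_increment_moment8 hB a0 ab)) _; first by rewrite lee_fin.
rewrite -EFinM lee_fin baE exprMn -exprM exprVn.
have -> : (eps ^+ 8)^-1 * (2 ^+ 17 * (eps ^+ (2 * 4) * (2 ^+ k / 2 ^+ n) ^+ 4)) =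
   (eps ^+ 8)^-1 * eps ^+ 8 * (2 ^+ 17 * (2 ^+ k / 2 ^+ n) ^+ 4) by lra.
by rewrite mulVf ?mul1r// expf_neq0// gt_eqF.
Qed.

(** Level [n] has [2 ^ n] increments of weight [4 ^+ n] and eighth moment at most
    [2 ^+ 17 * (2 ^+ k / 2 ^+ n) ^+ 4], hence contributes a constant times [2^-1 ^+ n]; the sum over
    levels stays bounded as the mesh shrinks. *)
Lemma block_moment2 s eps k N j : 0 <= s -> 0 < eps ->
  (\int[P]_w (blk s eps k N j w ^+ 2)%:E <= (block_bound k)%:E)%E.
Proof.
move=> s0 e0; set J := (k + N)%N.
pose D (n i : nat) w := (path s eps (tau N) w (j * 2 ^ J + i.+1 * 2 ^ (J - n)) -
               path s eps (tau N) w (j * 2 ^ J + i * 2 ^ (J - n))) ^+ 8.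
have D0 n i w : 0 <= D n i w by rewrite /D exprn_even_ge0.
have mp i : measurable_fun setT (fun w => path s eps (tau N) w i).
  by apply: measurable_funM.
have mD n i : measurable_fun setT (D n i).
  by apply: measurable_funX; exact: measurable_funB.
have S0 n w : 0 <= \sum_(i < 2 ^ n) 4 ^+ n * D n i w.
  by apply: sumr_ge0 => i _; rewrite mulr_ge0// exprn_ge0.
have mS (n : nat) : measurable_fun setT (fun w => \sum_(i < 2 ^ n) 4 ^+ n * D n i w).
  by apply: measurable_sum => i; exact: measurable_funM.
have mSS : measurable_fun setT
    (fun w => \sum_(n < J.+1) \sum_(i < 2 ^ n) 4 ^+ n * D n i w).
  by apply: measurable_sum => n; exact: mS.
apply: (@le_trans _ _ (\int[P]_w (14 ^+ 8 *
    \sum_(n < J.+1) \sum_(i < 2 ^ n) 4 ^+ n * D n i w)%:E)%E).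
  apply: ge0_le_integral => //=.
  - by move=> w _; rewrite lee_fin sqr_ge0.
  - by apply/measurable_EFinP; apply: measurable_funX; exact: measurable_block.
  - by apply/measurable_EFinP; exact: measurable_funM.
  - move=> w _; rewrite lee_fin.
    exact: (gain_moment (fun i => path s eps (tau N) w (j * 2 ^ J + i)%N) J).
under eq_integral do rewrite EFinM.
rewrite ge0_integralZl//=; last 2 first.
- exact/measurable_EFinP.
- by move=> w _; rewrite lee_fin; apply: sumr_ge0 => n _; exact: S0.
rewrite (_ : (block_bound k)%:E = ((14 ^+ 8)%:E * (2 ^+ 18 * (2 ^+ k) ^+ 4)%:E)%E)//.
apply: lee_wpmul2l; first by rewrite lee_fin exprn_ge0.
under eq_integral do rewrite -sumEFin.
rewrite ge0_integral_sum//=; last 2 first.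
- by move=> n; apply/measurable_EFinP; exact: mS.
- by move=> n w _; rewrite lee_fin; exact: S0.
apply: (@le_trans _ _ (\sum_(n < J.+1) (2 ^+ 17 * (2 ^+ k) ^+ 4 * 2^-1 ^+ n)%:E)%E).
  apply: lee_sum => -[n /=]; rewrite ltnS => nJ _.
  under eq_integral do rewrite -sumEFin.
  rewrite ge0_integral_sum//=; last 2 first.
  - by move=> i; apply/measurable_EFinP; exact: measurable_funM.
  - by move=> i w _; rewrite lee_fin mulr_ge0// exprn_ge0.
  apply: (@le_trans _ _ (\sum_(i < 2 ^ n) (4 ^+ n * (2 ^+ 17 * (2 ^+ k / 2 ^+ n) ^+ 4))%:E)%E).
    apply: lee_sum => i _; under eq_integral do rewrite EFinM.
    rewrite ge0_integralZl//=; last 2 first.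
    - exact/measurable_EFinP.
    - by move=> w _; rewrite lee_fin.
    rewrite [leRHS]EFinM; apply: lee_wpmul2l; first by rewrite lee_fin exprn_ge0.
    exact: scaled_path_moment8.
  rewrite sumEFin sumr_const card_ord lee_fin -[X in X <= _]mulr_natl natrX.
  have p2 : 2 ^+ n * (2 ^+ n)^-1 = 1 :> R by rewrite divff// expf_neq0.
  have -> : 4 ^+ n = 2 ^+ n * 2 ^+ n :> R by rewrite -exprMn; congr (_ ^+ _); lra.
  rewrite exprVn exprMn; set a := 2 ^+ n in p2 *; set b := 2 ^+ k; set c := a^-1 in p2 *.
  have -> : a * (a * a * (2 ^+ 17 * (b ^+ 4 * c ^+ 4))) =
    2 ^+ 17 * b ^+ 4 * ((a * c) ^+ 3 * c) by lra.
  by rewrite p2 expr1n mul1r.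
rewrite sumEFin lee_fin -mulr_sumr.
have H m : \sum_(n < m) 2^-1 ^+ n <= 2 - 2 * 2^-1 ^+ m :> R.
  elim: m => [|m IH]; first by rewrite big_ord0 expr0; lra.
  by rewrite big_ord_recr /= exprS; lra.
have h0 : 0 <= 2^-1 ^+ J.+1 :> R by rewrite exprn_ge0// invr_ge0.
have b0 : 0 <= 2 ^+ 17 * (2 ^+ k) ^+ 4 :> R by rewrite mulr_ge0// !exprn_ge0.
have H2 : \sum_(n < J.+1) 2^-1 ^+ n <= 2 :> R by have := H J.+1; lra.
have := ler_wpM2l b0 H2; lra.
Qed.

Definition mean (k N : nat) : R := fine (block_mean B (tau N) (2 ^ (k + N))).

Lemma meanE k N : block_mean B (tau N) (2 ^ (k + N)) = (mean k N)%:E.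
Proof.
rewrite /mean fineK// ge0_fin_numE; last first.
  by apply: integral_ge0 => w _; rewrite lee_fin block_ge0.
(* A nonnegative [x] is at most [1 + x ^+ 2], so the second moment gives finiteness. *)
apply: (@le_lt_trans _ _ (\int[P]_w (1 + blk 0 1 k N 0 w ^+ 2)%:E)%E).
  apply: ge0_le_integral => //=.
  - by move=> w _; rewrite lee_fin block_ge0.
  - by apply/measurable_EFinP; exact: measurable_block.
  - apply/measurable_EFinP; apply: measurable_funD => //.
    by apply: measurable_funX; exact: measurable_block.
  - by move=> w _; rewrite lee_fin; have := sqr_ge0 (blk 0 1 k N 0 w - 1);
    have := sqr_ge0 (blk 0 1 k N 0 w); lra.
under eq_integral do rewrite EFinD.
rewrite ge0_integralD//=; last 2 first.
- by move=> w _; rewrite lee_fin sqr_ge0.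
- by apply/measurable_EFinP; apply: measurable_funX; exact: measurable_block.
rewrite integral_cst//= probability_setT mule1.
apply: le_lt_trans (leeD (lexx _) (block_moment2 _ _ _ _ _)) _ => //.
by rewrite -EFinD ltry.
Qed.

(** The expectation of [gain_blocks] for two blocks, the extra 2 being its cutting cost. *)
Lemma mean_double k N : 2 * mean k N <= mean k.+1 N <= 2 * mean k N + 2.
Proof.
set M := (2 ^ (k + N))%N.
have ME : (2 ^ (k.+1 + N) = 2 * M)%N by rewrite addSn expnS.
have mb j : measurable_fun setT (blk 0 1 k N j) by exact: measurable_block.
have S2 : (\int[P]_w (blk 0 1 k N 0 w + blk 0 1 k N 1 w)%:E = (2 * mean k N)%:E)%E.
  under eq_integral do rewrite EFinD.
  rewrite ge0_integralD//=; last 4 first.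
  - by move=> w _; rewrite lee_fin block_ge0.
  - exact/measurable_EFinP.
  - by move=> w _; rewrite lee_fin block_ge0.
  - exact/measurable_EFinP.
  by rewrite !(integral_block hB)// meanE -EFinD; congr (_%:E); lra.
have bd w : blk 0 1 k N 0 w + blk 0 1 k N 1 w <= block B 0 1 (tau N) (2 * M) 0 w <=
    blk 0 1 k N 0 w + blk 0 1 k N 1 w + 2.
  have := gain_blocks (path 0 1 (tau N) w) 2 M.
  by rewrite !big_ord_recr big_ord0 /= add0r.
have mb2 : measurable_fun setT (block B 0 1 (tau N) (2 * M) 0) by exact: measurable_block.
rewrite -!lee_fin -(meanE k.+1) /block_mean ME -{1}S2; apply/andP; split.
  apply: ge0_le_integral => //=.
  - by move=> w _; rewrite lee_fin addr_ge0 ?block_ge0.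
  - by apply/measurable_EFinP; exact: measurable_funD.
  - exact/measurable_EFinP.
  - by move=> w _; rewrite lee_fin; have /andP[] := bd w.
have -> : (2 * mean k N + 2)%:E = (\int[P]_w (blk 0 1 k N 0 w + blk 0 1 k N 1 w + 2)%:E)%E.
  under eq_integral do rewrite EFinD.
  rewrite ge0_integralD//=; last 2 first.
  - by move=> w _; rewrite lee_fin addr_ge0 ?block_ge0.
  - by apply/measurable_EFinP; exact: measurable_funD.
  by rewrite S2 integral_cst//= probability_setT mule1.
apply: ge0_le_integral => //=.
- by move=> w _; rewrite lee_fin block_ge0.
- exact/measurable_EFinP.
- by apply/measurable_EFinP; apply: measurable_funD => //; exact: measurable_funD.
- by move=> w _; rewrite lee_fin; have /andP[] := bd w.
Qed.

(** Buying at time 0 and selling at time 1 already gains at least 1 whenever the increment lies in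
    [2, 3]. *)
Lemma mean_gt0 : 0 < mean 0 0.
Proof.
have [_ _ hN _] := hB.
pose I := `]2%R : R, 3%R]%classic.
pose A := [set w | I (B 1 w - B 0 w)].
have PA : P A = normal_prob 0 1 I.
  by have := hN 0 1 (lexx _) ltr01 I; rewrite subr0 sqrtr1; apply; exact: measurable_itv.
have mA : measurable A.
  have : measurable_fun setT (fun w => B 1 w - B 0 w) by exact: measurable_funB.
  by move=> /(_ measurableT I); rewrite setTI; apply; exact: measurable_itv.
rewrite -lte_fin -meanE; apply: (@lt_le_trans _ _ (\int[P]_(w in A) 1%:E)%E).
  by rewrite integral_cst//= mul1e PA; exact: normal_prob_gt0.
apply: (@le_trans _ _ (\int[P]_(w in A) (blk 0 1 0 0 0 w)%:E)%E).
  apply: ge0_le_integral => //=.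
  - by apply/measurable_EFinP; apply: measurable_funTS; exact: measurable_block.
  - move=> w; rewrite /A /I /= in_itv /= => /andP[w2 w3]; rewrite lee_fin.
    have al : adm 0%N 1%N [:: (0%N, 1%N)] by [].
    have := gain_ub (fun i => path 0 1 (tau 0) w (0 * 2 ^ (0 + 0) + i)%N) al.
    have pE i : path 0 1 (tau 0) w i = B i%:R w.
      by rewrite /scaled_path expr0 expr1n invr1 !mul1r add0r.
    rewrite usum_cons usum_nil /= !pE addr0.
    have -> : gain (fun i => path 0 1 (tau 0) w (0 * 2 ^ (0 + 0) + i)%N) 0 = 0 by [].
    rewrite /block; lra.
apply: ge0_subset_integral => //.
- by apply/measurable_EFinP; exact: measurable_block.
- by move=> w _; rewrite lee_fin block_ge0.
Qed.

End BlockMoments.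

Lemma measurable_le_set d (T : measurableType d) (R : realType) (f g : T -> R) :
  measurable_fun setT f -> measurable_fun setT g ->
  measurable [set w | f w <= g w].
Proof.
by move=> mf mg; rewrite -[X in measurable X]setTI; exact: measurable_fun_le.
Qed.

Lemma measurable_lt_set d (T : measurableType d) (R : realType) (f g : T -> R) :
  measurable_fun setT f -> measurable_fun setT g ->
  measurable [set w | f w < g w].
Proof.
move=> mf mg; rewrite (_ : [set _ | _] = ~` [set w | g w <= f w]).
  by apply: measurableC; exact: measurable_le_set.
by apply/seteqP; split => w /=; rewrite ltNge => /negP.
Qed.

(** * Upward variation of Brownian motion *)

Section BrownianVariation.
Context d (T : measurableType d) (R : realType) (P : probability T R).
Variable B : R -> {RV P >-> R}.
Hypothesis hB : brownian_motion B.

Local Notation path := (scaled_path B).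
Local Notation tau N := ((2 ^+ N)^-1 : R).
Local Notation blk s eps k N := (block B s eps (tau N) (2 ^ (k + N))).
Local Notation mean := (mean B).

Let p2gt0 k : 0 < 2 ^+ k :> R. Proof. by rewrite exprn_gt0. Qed.

(** Iterating [mean_double]: the mean per unit of scaled time increases with the block length, and
    decreases once the cutting cost 2 is added to the mean. *)
Let mean_ratio k j N : (k <= j)%N ->
  mean k N / 2 ^+ k <= mean j N / 2 ^+ j /\
  (mean j N + 2) / 2 ^+ j <= (mean k N + 2) / 2 ^+ k.
Proof.
move=> /subnKC <-; elim: (j - k)%N => [|i [IH1 IH2]]; first by rewrite addn0.
have /andP[h1 h2] := mean_double hB (k + i) N; rewrite addnS; split.
  apply: le_trans IH1 _; rewrite exprS invfM mulrA ler_wpM2r ?invr_ge0 ?(ltW (p2gt0 _))//.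
  by rewrite ler_pdivlMr// mulrC.
apply: le_trans IH2; rewrite exprS invfM mulrA ler_wpM2r ?invr_ge0 ?(ltW (p2gt0 _))//.
by rewrite ler_pdivrMr//; lra.
Qed.

Let means : set R := [set x | exists k N, x = mean k N / 2 ^+ k].

(** The gain per unit of scaled time for long blocks and fine meshes. A supremum stands for the
    limit; what is used of it is [rate_ub], [rate_lb] and [rate_gt0]. *)
Definition rate : R := sup means.

Let has_sup_means : has_sup means.
Proof.
split; first by exists (mean 0 0 / 2 ^+ 0), 0%N, 0%N.
exists (block_bound R 0 + 4) => _ [k [N ->]].
have [_ h2] := mean_ratio N (leq0n k); rewrite expr0 divr1 in h2.
have : mean 0 N <= 1 + block_bound R 0.
  rewrite -lee_fin -meanE// /block_mean.
  apply: (@le_trans _ _ (\int[P]_w (1 + blk 0 1 0 N 0 w ^+ 2)%:E)%E).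
    apply: ge0_le_integral => //=.
    - by move=> w _; rewrite lee_fin block_ge0.
    - by apply/measurable_EFinP; exact: measurable_block.
    - apply/measurable_EFinP; apply: measurable_funD => //.
      by apply: measurable_funX; exact: measurable_block.
    - move=> w _; rewrite lee_fin; have := sqr_ge0 (blk 0 1 0 N 0 w - 1).
      have := sqr_ge0 (blk 0 1 0 N 0 w); lra.
  under eq_integral do rewrite EFinD.
  rewrite ge0_integralD//=; last 2 first.
  - by move=> w _; rewrite lee_fin sqr_ge0.
  - by apply/measurable_EFinP; apply: measurable_funX; exact: measurable_block.
  rewrite integral_cst//= probability_setT mule1 EFinD.
  by apply: leeD => //; exact: block_moment2.
have : mean k N / 2 ^+ k <= (mean k N + 2) / 2 ^+ k.
  by rewrite ler_wpM2r ?invr_ge0 ?(ltW (p2gt0 _))//; lra.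
lra.
Qed.

Lemma rate_ub k N : mean k N <= rate * 2 ^+ k.
Proof.
rewrite -ler_pdivrMr//; apply: ub_le_sup; first exact: has_sup_means.2.
by exists k, N.
Qed.

(** Of the 3, a part 2 is the cutting cost in [mean_ratio] and 1 is the defect [(2 ^+ k)^-1] in the
    supremum, multiplied by [2 ^+ k]. *)
Lemma rate_lb k : exists N, rate * 2 ^+ k - 3 <= mean k N.
Proof.
have k0 : 0 < (2 ^+ k)^-1 :> R by rewrite invr_gt0.
have [_ [j [N ->]] jN] := sup_adherent k0 has_sup_means.
exists N; have : mean j N / 2 ^+ j <= (mean k N + 2) / 2 ^+ k.
  have [kj|/ltnW jk] := leqP k j.
    have [_] := mean_ratio N kj; apply: le_trans.
    by rewrite ler_wpM2r ?invr_ge0 ?(ltW (p2gt0 _))//; lra.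
  have [+ _] := mean_ratio N jk => /le_trans; apply.
  by rewrite ler_wpM2r ?invr_ge0 ?(ltW (p2gt0 _))//; lra.
move=> H; have := lt_le_trans jN H; rewrite -/rate ltr_pdivlMr// mulrBl mulVf ?gt_eqF//.
lra.
Qed.

Lemma rate_gt0 : 0 < rate.
Proof.
have := rate_ub 0 0; rewrite expr0 mulr1; apply: lt_le_trans; exact: mean_gt0.
Qed.

Let chebyshev_blocks s eps k N m (x : R) : 0 <= s -> 0 < eps -> 0 < x ->
  (P [set w | (x <= `|\sum_(j < m) blk s eps k N j w - m%:R * mean k N|)%R] <=
   (m%:R * block_bound R k / x ^+ 2)%:E)%E.
Proof.
move=> s0 e0 x0.
have t0 : 0 < tau N by rewrite invr_gt0.
apply: (@chebyshev_sum _ _ _ P (fun j => blk s eps k N j) (mean k N) (block_bound R k)) => //.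
- by move=> j; exact: measurable_block.
- by move=> j w; exact: block_ge0.
- by move=> j; rewrite (integral_block hB)// meanE.
- by move=> j; exact: block_moment2.
- by move=> i j ij; rewrite (integral_blockM hB)// meanE// -EFinM.
Qed.

Let mgain s eps N M : measurable_fun setT (fun w => gain (path s eps (tau N) w) M).
Proof.
apply: (@measurable_gain R _ T (fun i w => path s eps (tau N) w i) M) => i.
by apply: measurable_funM.
Qed.

Let gain_pathE s eps N k m w :
  gain (path s eps (tau N) w) (m * 2 ^ (k + N)) =
  gain (fun i => eps^-1 * B (s + eps ^+ 2 * ((2 ^+ N)^-1 * i%:R)) w) (m * 2 ^ k * 2 ^ N).
Proof. by rewrite expnD mulnA. Qed.

Let blocks_sum s eps k N m w :
  \sum_(j < m) blk s eps k N j w <= gain (path s eps (tau N) w) (m * 2 ^ (k + N)) <=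
  \sum_(j < m) blk s eps k N j w + m%:R.
Proof. exact: gain_blocks. Qed.

Let cB w : {within `[0, +oo[, continuous (fun t => B t w)}.
Proof. by have [_ + _ _] := hB. Qed.

(** The exceptional event is a union over all meshes. Refining a mesh only increases the gain, so
    these events increase and their union obeys the same Chebyshev bound as each of them. The single
    [m%:R] pays for cutting into blocks. *)
Lemma upper_tail s eps k m (x : R) : 0 <= s -> 0 < eps -> 0 < x ->
  exists E, [/\ measurable E, (P E <= (m%:R * block_bound R k / x ^+ 2)%:E)%E &
    forall w, ~ E w -> forall l, adm s (s + eps ^+ 2 * (m * 2 ^ k)%:R) l ->
      usum (fun t => B t w) eps l <= eps * (m%:R * (rate * 2 ^+ k) + m%:R + x)].
Proof.
move=> s0 e0 x0; set th := m%:R * (rate * 2 ^+ k) + m%:R + x.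
pose F N := [set w | (th < gain (path s eps (tau N) w) (m * 2 ^ (k + N)))%R].
have mF N : measurable (F N).
  exact: measurable_lt_set.
have PF N : (P (F N) <= (m%:R * block_bound R k / x ^+ 2)%:E)%E.
  apply: le_trans (chebyshev_blocks k N m s0 e0 x0); apply: le_measure; rewrite ?inE//.
    apply: measurable_le_set => //.
    apply: measurableT_comp => //; apply: measurable_funB => //.
    by apply: measurable_sum => j; exact: measurable_block.
  move=> w; rewrite /F /th /= => Fw; have /andP[_ h2] := blocks_sum s eps k N m w.
  have h3 := rate_ub k N.
  have h4 : m%:R * mean k N <= m%:R * (rate * 2 ^+ k) by rewrite ler_wpM2l.
  by apply: le_trans (ler_norm _); lra.
have ndF : nondecreasing_seq F.
  apply/nondecreasing_seqP => N; apply/subsetPset => w; rewrite /F /= => /lt_le_trans; apply.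
  rewrite addnS expnSr mulnA; apply: le_trans (gain_refine _ _); rewrite le_eqVlt.
  apply/orP; left; apply/eqP; apply: eq_gain => i _; rewrite /scaled_path.
  congr (_ * B (_ + _ * _) w); rewrite natrM exprS invfM; lra.
exists (\bigcup_N F N); split.
- exact: bigcupT_measurable.
- have cv : (P \o F) @ \oo --> P (\bigcup_N F N).
    by apply: nondecreasing_cvg_mu => //; exact: bigcupT_measurable.
  rewrite -(cvg_lim _ cv)//; apply: lime_le; first by apply/cvg_ex; exists (P (\bigcup_N F N)).
  by apply: nearW => N; exact: PF.
- move=> w nE l sl.
  have e2 : 0 < eps ^+ 2 by rewrite exprn_gt0.
  have := @usum_le_grid R (fun t => B t w) s (eps ^+ 2) (m * 2 ^ k)%N s0 e2 (@cB w) eps th l e0 _ sl; apply.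
  move=> N; rewrite -gain_pathE leNgt; apply/negP => H; apply: nE; exists N => //.
Qed.

(** One mesh suffices, since a list on it is already a list of real times; [rate_lb] selects it. *)
Lemma lower_tail s eps k m (x : R) : 0 <= s -> 0 < eps -> 0 < x ->
  exists E, [/\ measurable E, (P E <= (m%:R * block_bound R k / x ^+ 2)%:E)%E &
    forall w, ~ E w -> exists2 l, adm s (s + eps ^+ 2 * (m * 2 ^ k)%:R) l &
      eps * (m%:R * (rate * 2 ^+ k - 3) - x) <= usum (fun t => B t w) eps l].
Proof.
move=> s0 e0 x0; have [N hN] := rate_lb k.
set th := m%:R * (rate * 2 ^+ k - 3) - x.
pose F := [set w | (gain (path s eps (tau N) w) (m * 2 ^ (k + N)) < th)%R].
have mF : measurable F.
  exact: measurable_lt_set.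
exists F; split => //.
  apply: le_trans (chebyshev_blocks k N m s0 e0 x0); apply: le_measure; rewrite ?inE//.
    apply: measurable_le_set => //.
    apply: measurableT_comp => //; apply: measurable_funB => //.
    by apply: measurable_sum => j; exact: measurable_block.
  move=> w; rewrite /F /th /= => Fw; have /andP[h1 _] := blocks_sum s eps k N m w.
  have h4 : m%:R * (rate * 2 ^+ k - 3) <= m%:R * mean k N by rewrite ler_wpM2l.
  by rewrite distrC; apply: le_trans (ler_norm _); lra.
move=> w nF; apply: (@grid_usum _ _ s (eps ^+ 2) (m * 2 ^ k) _ eps N) => //.
  by rewrite exprn_gt0.
rewrite -gain_pathE leNgt; apply/negP => H; exact: nF.
Qed.


(** About [(t - s) / (2 ^+ k * eps ^+ 2)] blocks may deviate in sum by an amount of order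
    [eta / eps ^+ 2], so Chebyshev gives a probability of order [eps ^+ 2], summable along
    [eps = 1/n]. *)
Lemma regular_probability s t eta : 0 <= s -> s < t -> 0 < eta ->
  exists C eps1, [/\ 0 <= C, 0 < eps1 & forall eps, 0 < eps -> eps < eps1 ->
    exists E, [/\ measurable E, (P E <= (C * eps ^+ 2)%:E)%E &
      forall w, ~ E w -> regular_at (fun t => B t w) rate eps eta s t]].
Proof.
move=> s0 st eta0; set D := t - s; have D0 : 0 < D by rewrite subr_gt0.
have r0 := rate_gt0.
(* Blocks of scaled length [2 ^+ k] are long enough for the bounded loss per block to total a small
   fraction of [eta]. *)
pose k := (Num.truncn (12 * (D + 1) / eta)).+1.
have hk : 12 * (D + 1) <= eta * 2 ^+ k.
  rewrite -ler_pdivrMl// mulrC; apply: (@le_trans _ _ k%:R).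
    exact/ltW/truncnS_gt.
  by rewrite -natrX ler_nat ltnW// ltn_expl.
set K := 2 ^+ k in hk; have K0 : 0 < K := p2gt0 k.
set W := block_bound R k.
have W0 : 0 <= W by rewrite /W /block_bound !mulr_ge0// ?exprn_ge0// exprn_ge0.
(* The first two bounds keep the length [dl] of a block at most 1; the third keeps the effect of
   rounding [t - s] to whole blocks below [eta / 4]. *)
pose e1 := Num.min 1 (Num.min K^-1 (eta / (4 * rate * K))).
exists (32 * (D + 1) * W / eta ^+ 2), e1; split.
- by rewrite divr_ge0 ?sqr_ge0// !mulr_ge0//; lra.
- by rewrite /e1 !lt_min ltr01 invr_gt0 K0 divr_gt0// !mulr_gt0.
move=> e e0; rewrite /e1 !lt_min => /and3P[el1 eK er].
set a := e ^+ 2; have a0 : 0 < a by rewrite exprn_gt0.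
have ae : a <= e by rewrite /a expr2 ler_piMl// ltW.
have a1 : a <= 1 by rewrite (le_trans ae)// ltW.
set dl := K * a; have dl0 : 0 < dl by rewrite mulr_gt0.
have dl1 : dl <= 1.
  have : K * a <= K * K^-1 by rewrite ler_pM2l// (le_trans ae)// ltW.
  by rewrite divff ?gt_eqF.
have rdl : rate * dl <= eta / 4.
  have : a < eta / (4 * rate * K) by exact: le_lt_trans er.
  rewrite ltr_pdivlMr ?mulr_gt0// /dl; lra.
(* [m] blocks fit inside the interval and serve the lower bound; [m.+1] blocks cover it and serve
   the upper bound. *)
pose m := Num.truncn (D / dl).
have /andP[mD Dm] : m%:R <= D / dl < m.+1%:R by apply: truncn_itv; rewrite divr_ge0// ltW.
rewrite ler_pdivlMr// in mD; rewrite ltr_pdivrMr// in Dm.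
pose x := eta / 4 / a; have x0 : 0 < x by rewrite !divr_gt0.
have ax : a * x = eta / 4 by rewrite /x mulrC divfK// gt_eqF.
have [E1 [mE1 PE1 H1]] := upper_tail k m.+1 s0 e0 x0.
have [E2 [mE2 PE2 H2]] := lower_tail k m s0 e0 x0.
have Smm : m.+1%:R = m%:R + 1 :> R by rewrite natr1.
have tail : m.+1%:R * W / x ^+ 2 <= 16 * (D + 1) * W / eta ^+ 2 * a.
  have -> : (x ^+ 2)^-1 = 16 * a * a / eta ^+ 2.
    have x2 : x ^+ 2 * (16 * a * a / eta ^+ 2) = 1.
      have -> : x ^+ 2 * (16 * a * a / eta ^+ 2) = 16 * (a * x) ^+ 2 / eta ^+ 2 by lra.
      rewrite ax; have -> : 16 * (eta / 4) ^+ 2 = eta ^+ 2 by lra.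
      by rewrite divff// expf_neq0// gt_eqF.
    have x20 : x ^+ 2 != 0 by rewrite expf_neq0// gt_eqF.
    by apply: (mulfI x20); rewrite x2 divff.
  have -> : m.+1%:R * W * (16 * a * a / eta ^+ 2) = (m.+1%:R * a) * (16 * W / eta ^+ 2 * a) by lra.
  have -> : 16 * (D + 1) * W / eta ^+ 2 * a = (D + 1) * (16 * W / eta ^+ 2 * a) by lra.
  apply: ler_wpM2r; first by rewrite mulr_ge0 ?(ltW a0)// divr_ge0 ?sqr_ge0// mulr_ge0.
  have K1 : 1 <= K by rewrite /K exprn_ege1// ler1n.
  have : m%:R * (1 * a) <= m%:R * (K * a) by rewrite ler_wpM2l// ler_pM2r.
  rewrite Smm -/dl; lra.
exists (E1 `|` E2); split; first exact: measurableU.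
  apply: le_trans (measureU2 _ _ _) _ => //.
  apply: (@le_trans _ _ ((m.+1%:R * W / x ^+ 2)%:E + (m.+1%:R * W / x ^+ 2)%:E)%E).
    apply: leeD => //; apply: le_trans PE2 _; rewrite lee_fin.
    rewrite -/W; apply: ler_wpM2r; first by rewrite invr_ge0 sqr_ge0.
    by apply: ler_wpM2r => //; rewrite ler_nat.
  by rewrite -EFinD lee_fin -/a; lra.
move=> w nE; have nE1 : ~ E1 w by move=> ?; apply: nE; left.
have nE2 : ~ E2 w by move=> ?; apply: nE; right.
have natE j : e ^+ 2 * (j * 2 ^ k)%:R = j%:R * dl by rewrite natrM natrX -/K -/a /dl; lra.
have ma : 12 * (m.+1%:R * a) <= eta.
  rewrite -(ler_pM2r K0); apply: le_trans hk.
  have : m.+1%:R * dl <= D + 1 by rewrite Smm; lra.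
  rewrite /dl; lra.
have ma' : m%:R * a <= m.+1%:R * a by rewrite ler_wpM2r ?ler_nat// ltW.
split.
  move=> l sl; have sl' : adm s (s + e ^+ 2 * (m.+1 * 2 ^ k)%:R) l.
    by apply: adm_widen sl => //; rewrite natE; move: Dm; rewrite /D; lra.
  have := ler_wpM2l (ltW e0) (H1 w nE1 l sl').
  have -> : e * (e * (m.+1%:R * (rate * 2 ^+ k) + m.+1%:R + x)) =
    rate * (m.+1%:R * dl) + m.+1%:R * a + a * x by rewrite /dl /a -/K; lra.
  have : rate * (m.+1%:R * dl) <= rate * (D + dl) by rewrite ler_pM2l// Smm; lra.
  rewrite -/D; lra.
have [l sl hl] := H2 w nE2.
exists l.
  by apply: adm_widen sl => //; rewrite natE; move: mD; rewrite /D; lra.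
have := ler_wpM2l (ltW e0) hl.
have -> : e * (e * (m%:R * (rate * 2 ^+ k - 3) - x)) =
    rate * (m%:R * dl) - 3 * (m%:R * a) - a * x by rewrite /dl /a -/K; lra.
have : rate * (D - dl) <= rate * (m%:R * dl) by rewrite ler_pM2l//; move: Dm; rewrite Smm; lra.
rewrite -/D; lra.
Qed.

(** Telescoping, from [(a ^+ 2)^-1 <= 2 / a - 2 / (a + 1)] for [a >= 1]. *)
Let sum_inv_sqr (N : nat) : \sum_(0 <= n < N) (n.+1%:R ^+ 2)^-1 <= 3 - 2 / N.+1%:R :> R.
Proof.
elim: N => [|N IH]; first by rewrite big_geq//; lra.
rewrite big_nat_recr//=.
have a0 : 0 < N.+1%:R :> R by rewrite ltr0n.
have b0 : 0 < N.+2%:R :> R by rewrite ltr0n.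
have ab : N.+2%:R = N.+1%:R + 1 :> R by rewrite natr1.
have a1 : 1 <= N.+1%:R :> R by rewrite ler1n.
move: IH a0 b0 ab a1; move: (\sum_(0 <= n < N) _) => S.
move: (N.+1%:R : R) (N.+2%:R : R) => a b IH a0 b0 ab a1.
have -> : 2 / b = 2 / a - 2 / (a * b).
  apply: (mulIf (x := a * b)); first by rewrite mulf_neq0// gt_eqF.
  rewrite mulrBl divfK ?mulf_neq0 ?gt_eqF// {1}(mulrC a) !mulrA divfK ?gt_eqF//.
  by rewrite divfK ?gt_eqF// ab; lra.
suff : (a ^+ 2)^-1 <= 2 / (a * b) by lra.
rewrite ler_pdivlMr ?mulr_gt0// ler_pdivrMl ?exprn_gt0// ab.
have := ler_pM2l a0 1 a; rewrite a1; lra.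
Qed.

Lemma brownian_regular s t eta : 0 <= s -> s < t -> 0 < eta ->
  P.-negligible [set w | ~ exists n0, forall n, (n0 <= n)%N ->
    regular_at (fun t => B t w) rate n.+1%:R^-1 eta s t].
Proof.
move=> s0 st eta0.
have [C [e1 [C0 e10 H]]] := regular_probability s0 st eta0.
have [E HE] : {E : nat -> set T & forall n, [/\ measurable (E n),
    (P (E n) <= (C * (n.+1%:R ^+ 2)^-1)%:E)%E &
    n.+1%:R^-1 < e1 -> forall w, ~ E n w ->
      regular_at (fun t => B t w) rate n.+1%:R^-1 eta s t]}.
  apply: (@choice _ _ (fun n E => [/\ measurable E, (P E <= (C * (n.+1%:R ^+ 2)^-1)%:E)%E &
    n.+1%:R^-1 < e1 -> forall w, ~ E w ->
      regular_at (fun t => B t w) rate n.+1%:R^-1 eta s t])) => n.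
  have [ne|ne] := ltP n.+1%:R^-1 e1.
    have [|E [mE PE HE]] := H n.+1%:R^-1 _ ne; first by rewrite invr_gt0.
    by exists E; split => //; rewrite -exprVn.
  (* For the finitely many [n] with [n.+1%:R^-1] not below [e1] the last clause is vacuous; [n2]
     discards them at the end. *)
  exists set0; split => //; first by rewrite measure0 lee_fin mulr_ge0// invr_ge0 sqr_ge0.
have mE n : measurable (E n) by have [] := HE n.
exists (lim_sup_set E); split.
- by apply: bigcap_measurable => // k _; apply: bigcup_measurable => j _; exact: mE.
- apply: lim_sup_set_cvg0 => //.
  apply: (@le_lt_trans _ _ (C * 3)%:E); last exact: ltry.
  apply: lime_le; first by apply: is_cvg_nneseries.
  apply: nearW => N.
  apply: (@le_trans _ _ (\sum_(0 <= n < N) (C * (n.+1%:R ^+ 2)^-1)%:E)%E).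
    by apply: lee_sum => n _; have [] := HE n.
  rewrite sumEFin lee_fin -mulr_sumr ler_wpM2l//.
  by apply: le_trans (sum_inv_sqr N) _; rewrite gerBl divr_ge0.
- move=> w /= nw; apply: contrapT => nlim; apply: nw.
  have [n1 Hn1] : exists n1, forall n, (n1 <= n)%N -> ~ E n w.
    apply: contrapT => hn; apply: nlim => n _; apply: contrapT => nE; apply: hn.
    by exists n => j nj Ej; apply: nE; exists j.
  pose n2 := Num.truncn e1^-1.
  exists (maxn n1 n2) => n; rewrite geq_max => /andP[nn1 nn2].
  have [_ _] := HE n; apply; last exact: Hn1.
  rewrite invf_plt ?posrE// ?ltr0n//.
  by apply: (lt_le_trans (truncnS_gt _)); rewrite ler_nat.
Qed.

End BrownianVariation.

(** * The metric determines the mass *)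

Section SpannedLength.
Context {R : realType} {X : eqType}.
Variables (w : X -> X -> R) (base : R).

Definition top_meet (x : X) (S : seq X) : R := foldr (fun y => Num.max (w x y)) base S.

(* Length of the tree spanned by the points of a list, above height [base]: a   *)
(* point [x] added to the span of [S] contributes its height above [S].         *)
Fixpoint span_length (S : seq X) : R :=
  if S is x :: S' then w x x - top_meet x S' + span_length S' else 0.

Lemma top_meet_le x S z : (top_meet x S <= z) = (base <= z) && all (fun y => w x y <= z) S.
Proof.
elim: S => [|y S IH] /=; first by rewrite andbT.
by rewrite ge_max IH andbCA.
Qed.

Lemma eq_mem_top_meet x S S' : S =i S' -> top_meet x S = top_meet x S'.
Proof.
move=> SS; apply/eqP; rewrite eq_le !top_meet_le.
have h y T : (forall z, z \in T -> z \in y) -> (base <= top_meet x y) && all (fun y0 => w x y0 <= top_meet x y) T.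
  move=> yT; have : top_meet x y <= top_meet x y by [].
  rewrite top_meet_le => /andP[-> /allP H] /=; apply/allP => z /yT; exact: H.
by rewrite !h// => z; rewrite SS.
Qed.

Lemma le_top_meet_base x S : base <= top_meet x S.
Proof. by have := lexx (top_meet x S); rewrite top_meet_le => /andP[]. Qed.

Lemma le_top_meet x S y : y \in S -> w x y <= top_meet x S.
Proof. by move=> yS; have := lexx (top_meet x S); rewrite top_meet_le => /andP[_ /allP]; exact. Qed.

Variable D : pred X.
Hypothesis w_sym : {in D &, forall x y, w x y = w y x}.
Hypothesis w_ultra : {in D & &, forall x y z, w x y <= w x z \/ w y z <= w x z}.

Let top_meet_ultra x y S : D x -> D y -> all D S ->
  top_meet y S <= top_meet x S \/ w x y <= top_meet x S.
Proof.
move=> Dx Dy; elim: S => [_|z S IH /= /andP[Dz DS]]; first by left.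
have [le1|le1] := IH DS; last by right; rewrite le_max le1 orbT.
have [h|h] := w_ultra Dx Dy Dz; first by right; rewrite le_max h.
by left; rewrite ge_max !le_max h le1 orbT.
Qed.

Let span_length_swap x y S : D x -> D y -> all D S ->
  span_length (x :: y :: S) = span_length (y :: x :: S).
Proof.
move=> Dx Dy DS /=; rewrite (w_sym Dy Dx).
suff : Num.max (w x y) (top_meet x S) + top_meet y S =
    Num.max (w x y) (top_meet y S) + top_meet x S by lra.
have := top_meet_ultra Dx Dy DS; have := top_meet_ultra Dy Dx DS; rewrite (w_sym Dy Dx).
by case: (leP (w x y) (top_meet x S)) => ?; case: (leP (w x y) (top_meet y S)) => ?;
  case=> ? [] ?; lra.
Qed.

Let span_length_rem x S : all D S -> x \in S ->
  span_length S = span_length (x :: rem x S).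
Proof.
elim: S => [//|y S IH] /= /andP[Dy DS]; rewrite inE.
have [->|xy] //= := eqVneq x y => xS. have Dx : D x by have /allP := DS; exact.
rewrite (IH DS xS) -[RHS]/(span_length (x :: y :: rem x S)).
rewrite span_length_swap//; last by apply/allP => z /mem_rem; have /allP := DS; exact.
rewrite -[RHS]/(w y y - top_meet y (x :: rem x S) + span_length (x :: rem x S)).
by congr (_ - _ + _); apply: eq_mem_top_meet; exact/perm_mem/perm_to_rem.
Qed.

(** An isometry of trees need not respect the order of times, so the length must be that of a set of
    points. The ultrametric inequality for [w] allows two neighbours in the list to be exchanged. *)
Lemma perm_span_length S S' : all D S -> perm_eq S S' -> span_length S = span_length S'.
Proof.
elim: S S' => [|x S IH] S' DS SS; first by rewrite perm_sym in SS; rewrite (perm_nilP SS).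
have xS : x \in S' by rewrite -(perm_mem SS) mem_head.
have DS' : all D S' by rewrite -(perm_all _ SS).
have S2 : perm_eq S (rem x S').
  by rewrite -(perm_cons x); apply: (perm_trans SS); exact: perm_to_rem.
move: DS => /= /andP[Dx DS]; rewrite (span_length_rem DS' xS) /= (IH _ DS S2).
by congr (_ - _ + _); apply: eq_mem_top_meet; exact: perm_mem.
Qed.

End SpannedLength.

Lemma eq_span_length (R : realType) (X X' : eqType) (w : X -> X -> R) (w' : X' -> X' -> R)
    (base : R) (f : X -> X') (S : seq X) :
  {in S &, forall x y, w' (f x) (f y) = w x y} ->
  span_length w' base (map f S) = span_length w base S.
Proof.
elim: S => [//|x S IH] H /=; rewrite H ?mem_head//; congr (_ - _ + _); last first.
  by apply: IH => y z yS zS; apply: H; rewrite inE ?yS ?zS orbT.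
have {}H y : y \in S -> w' (f x) (f y) = w x y.
  by move=> yS; apply: H; rewrite ?mem_head// inE yS orbT.
elim: S {IH} H => [//|y S IH] H /=; rewrite H ?mem_head// IH// => z zS.
by apply: H; rewrite inE zS orbT.
Qed.

Section SpanPath.
Context {R : realType} (h : coding_fun R).
Local Notation m := (code_min h).
Local Notation I x := (0 <= x <= 1).

Let minle (s t u : R) : I s -> I t -> s <= u -> u <= t -> m s t <= h u.
Proof.
by move=> Is It su ut; apply: code_min_le => //; rewrite itv_minmaxE su ut.
Qed.

(** Only the upper ends of the pairs join the span. The time [a] separates [b] from all points of
    [S], so [b] branches off the span at height at most [h a], and [h b - h a] is at most the length
    that [b] contributes. *)
Lemma usum_le_span (base e s r : R) (S : seq R) (l : seq (R * R)) :
  0 <= s -> r <= 1 -> (forall u, s <= u <= r -> base <= h u) ->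
  (forall y, y \in S -> 0 <= y <= s) -> adm s r l ->
  usum h e l + span_length m base S <=
  span_length m base (catrev (map snd l) S) - (size l)%:R * e.
Proof.
move=> + r1; elim: l s S => [|[a b] l IH] s S s0 hb hS /=.
  by rewrite usum_nil add0r mul0r subr0.
move=> /and3P[sa ab br]; have br' := adm_le br.
have Ia : I a by apply/andP; split; lra.
have Ib : I b by apply/andP; split; lra.
have {}IH := IH b (b :: S) _ _ _ br.
apply: le_trans (_ : _ <= usum h e l + span_length m base (b :: S) - e) _; last first.
  have -> : (size l).+1%:R * e = (size l)%:R * e + e.
    by rewrite -(natr1 (size l)) mulrDl mul1r.
  suff : usum h e l + span_length m base (b :: S) <=
      span_length m base (catrev [seq i.2 | i <- l] (b :: S)) - (size l)%:R * e.
    by move=> /= ?; lra.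
  apply: IH.
  - by case/andP: Ib.
  - by move=> u /andP[bu ur]; apply: hb; rewrite ur andbT; lra.
  - move=> y; rewrite inE => /predU1P[->|/hS /andP[y0 ys]]; first by case/andP: Ib => -> _ /=.
    by rewrite y0 /=; lra.
rewrite usum_cons /= code_minxx//.
suff : top_meet m base b S <= h a by lra.
rewrite top_meet_le; apply/andP; split; first by apply: hb; apply/andP; split; lra.
apply/allP => y /hS /andP[y0 ys]; rewrite code_minC.
have Iy : I y by apply/andP; split; lra.
by apply: minle => //; lra.
Qed.

Lemma code_argmin (s t : R) : 0 <= s -> s <= t -> t <= 1 ->
  exists a, [/\ s <= a, a <= t & h a = m s t].
Proof.
move=> s0 st t1.
have ch : {within `[s, t], continuous h}.
  apply: continuous_subspaceW (coding_continuous (c := h)) => u /=; rewrite !in_itv/=.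
  by move=> /andP[su ut]; apply/andP; split; lra.
have [a + Ha] := EVT_min st ch; rewrite in_itv/= => /andP[sa at_].
exists a; split => //; apply/eqP; rewrite eq_le; apply/andP; split.
  apply: code_min_ge => u; rewrite itv_minmaxE => /orP[|] /andP[u1 u2].
    by apply: Ha; rewrite in_itv /= u1.
  by apply: Ha; rewrite in_itv /=; apply/andP; split; lra.
by apply: minle => //; apply/andP; split; lra.
Qed.

(** Conversely, each point [b] is paired with a minimum [a] of [h] since the previous point; as that
    point belongs to the span, [b] branches off at height [h a] or above. The alternative
    [h s <= base] covers the first point. *)
Lemma span_le_usum (base e s r : R) (S bs : seq R) :
  0 <= s -> s <= r -> r <= 1 -> (s \in S) || (h s <= base) ->
  path <=%R s bs -> all (fun b => b <= r) bs ->
  exists2 l, adm s r l &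
    span_length m base (catrev bs S) - (size bs)%:R * e <=
    usum h e l + span_length m base S.
Proof.
move=> + + r1; elim: bs s S => [|b bs IH] s S s0 sr sS /=.
  by move=> _ _; exists [::]; rewrite //= usum_nil add0r mul0r subr0.
move=> /andP[sb pb] /andP[br ar].
have [|l bl hl] := IH b (b :: S) (le_trans s0 sb) br _ pb ar.
  by rewrite mem_head.
have [a [sa ab aE]] := code_argmin s0 sb (le_trans br r1).
have Is : I s by apply/andP; split; lra.
have Ib : I b by apply/andP; split; lra.
exists ((a, b) :: l); first by rewrite /= sa ab.
rewrite usum_cons /= -natr1 mulrDl mul1r.
move: hl; rewrite /= code_minxx//.
suff : h a <= top_meet m base b S by lra.
rewrite aE; case/orP: sS => [sS|hs].
  by rewrite code_minC; apply: le_top_meet.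
apply: le_trans (le_top_meet_base _ _ _ _); apply: le_trans hs; exact: code_min_lel.
Qed.

End SpanPath.

(** The upper ends of the pairs are mapped by [f], which may scramble them, and sorted again. The
    spanned length survives, since it depends only on the values of [code_min] and not on the
    order. *)
Lemma usum_transfer (R : realType) (h h' : coding_fun R) (f : R -> R) (e s r s' r' : R) l :
  0 <= s -> r <= 1 -> 0 <= s' -> s' <= r' -> r' <= 1 ->
  (forall u, s <= u <= r -> h s <= h u) -> h' s' = h s ->
  (forall u, s <= u <= r -> s' <= f u <= r') ->
  (forall u v, s <= u <= r -> s <= v <= r -> code_min h' (f u) (f v) = code_min h u v) ->
  adm s r l -> exists2 l', adm s' r' l' & usum h e l <= usum h' e l'.
Proof.
move=> s0 r1 s'0 sr' r'1 hmin hs fI fm sl.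
have nil y : y \in [::] -> 0 <= y <= s by [].
have := @usum_le_span R h (h s) e s r [::] l s0 r1 hmin nil sl.
rewrite /= addr0 => H1; set bs := map snd l in H1.
have bsI b : b \in bs -> s <= b <= r.
  move=> /mapP[p pl ->]; have /and3P[h1 h2 h3] := adm_mem sl pl.
  by rewrite h3 (le_trans h1).
pose bs' := sort <=%R (map f bs).
have sbs' : path <=%R s' bs'.
  rewrite path_min_sorted; first by apply: sort_sorted; exact: le_total.
  by apply/allP => b; rewrite mem_sort => /mapP[b0 /bsI/fI/andP[? _] ->].
have abs' : all (fun b => b <= r') bs'.
  by apply/allP => b; rewrite mem_sort => /mapP[b0 /bsI/fI/andP[_ ?] ->].
have [|l' sl' H2] := @span_le_usum R h' (h s) e s' r' [::] bs' s'0 sr' r'1 _ sbs' abs'.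
  by rewrite hs lexx orbT.
exists l' => //; move: H2; rewrite /= addr0; apply: le_trans.
apply: (le_trans H1); rewrite /bs' size_sort !size_map lerD2r le_eqVlt; apply/orP; left; apply/eqP.
rewrite -(@eq_span_length R _ _ (code_min h) (code_min h') (h s) f); last first.
  by move=> x y; rewrite !catrevE !cats0 !mem_rev => /bsI xI /bsI yI; exact: fm.
pose D : pred R := fun x => 0 <= x <= 1.
apply: (@perm_span_length _ _ _ _ D).
- by move=> x y _ _; exact: code_minC.
- by move=> x y z Dx Dy Dz; exact: code_min_ultra.
- apply/allP => x /mapP[b]; rewrite catrevE cats0 mem_rev => /bsI/fI/andP[? ?] ->.
  by rewrite /D; apply/andP; split; lra.
- by rewrite !catrevE !cats0 map_rev perm_rev perm_sym perm_rev perm_sort.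
Qed.

(** Stated for a bare function with explicit moduli, so that it applies to [h] and to its reflection
    [h (1 - u)], which gives the right end of a superlevel interval. *)
Lemma superlevel_left (R : realType) (g : R -> R) (s b : R) :
  (forall u e, 0 <= u <= 1 -> 0 < e -> exists2 r, 0 < r &
     forall v, 0 <= v <= 1 -> `|u - v| < r -> `|g u - g v| < e) ->
  0 <= s <= 1 -> g 0 <= b -> b <= g s ->
  exists l, [/\ 0 <= l <= s, g l = b, forall u, l <= u <= s -> b <= g u &
    forall t, 0 <= t <= s -> (forall u, t <= u <= s -> b <= g u) -> l <= t].
Proof.
move=> cg /andP[s0 s1] g0 bs.
(* The left end is the supremum of the earlier times where [g] is below [b], or 0 if there are none;
   in that case [g 0 <= b] forces the value [b]. *)
pose A := [set u | 0 <= u <= s /\ g u < b].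
have [A0|/set0P[a0 Aa0]] := eqVneq A set0.
  have Ab u : 0 <= u <= s -> b <= g u.
    move=> us; rewrite leNgt; apply/negP => gu.
    by have : A u by []; rewrite A0.
  exists 0; split; rewrite ?lexx ?s0//.
    by apply/eqP; rewrite eq_le g0 Ab// lexx s0.
  by move=> t /andP[].
have Aub : has_ubound A by exists s => u [/andP[]].
have supA : has_sup A by split => //; exists a0.
pose l := sup A.
have a0l : a0 <= l by apply: ub_le_sup.
have l0 : 0 <= l by case: Aa0 => /andP[? _] _; lra.
have ls : l <= s by apply: ge_sup; [exists a0|move=> u [/andP[]]].
have Il : 0 <= l <= 1 by apply/andP; split; lra.
have gl : g l <= b.
  rewrite leNgt; apply/negP => bl.
  have e0 : 0 < g l - b by rewrite subr_gt0.
  have [r r0 Hr] := cg _ _ Il e0.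
  have [u Au lu] := sup_adherent r0 supA.
  have ul : u <= l by apply: ub_le_sup.
  case: Au => /andP[u0 us] gu.
  have /Hr : 0 <= u <= 1 by apply/andP; split; lra.
  rewrite ger0_norm ?subr_ge0// => /(_ _).
  have -> : l - u < r by rewrite -/l in lu; lra.
  by move=> /(_ isT); have := ler_norm (g l - g u); lra.
have aft u : l < u -> u <= s -> b <= g u.
  move=> lu us; rewrite leNgt; apply/negP => gu.
  suff : u <= l by lra.
  by apply: ub_le_sup => //; split => //; apply/andP; split; lra.
have glE : g l = b.
  apply/eqP; rewrite eq_le gl leNgt /=; apply/negP => bl.
  have lts : l < s by rewrite lt_neqAle ls andbT; apply/eqP => lE; rewrite -lE in bs; lra.
  have e0 : 0 < b - g l by rewrite subr_gt0.
  have [r r0 Hr] := cg _ _ Il e0.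
  pose u := Num.min s (l + r / 2).
  have lu : l < u by rewrite lt_min lts /=; lra.
  have us : u <= s by rewrite ge_min lexx.
  have ul : u <= l + r / 2 by rewrite ge_min lexx orbT.
  have /Hr : 0 <= u <= 1 by apply/andP; split; lra.
  rewrite ltr0_norm ?subr_lt0// => /(_ _).
  have -> : - (l - u) < r by lra.
  move=> /(_ isT); rewrite distrC; have := ler_norm (g u - g l).
  have := aft _ lu us; lra.
exists l; split => //; first by rewrite l0.
  move=> u /andP[+ us]; rewrite le_eqVlt => /predU1P[<-|lu]; first by rewrite glE.
  exact: aft.
move=> t /andP[t0 ts] H; rewrite leNgt; apply/negP => tl.
have e0 : 0 < l - t by rewrite subr_gt0.
have [a Aa ta] := sup_adherent e0 supA.
have al : a <= l by apply: ub_le_sup.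
case: Aa => /andP[_ as_] ga; have : b <= g a; last by lra.
by apply: H; rewrite as_ andbT; rewrite -/l in ta; lra.
Qed.

Section SuperlevelInterval.
Context {R : realType} (h : coding_fun R).
Local Notation m := (code_min h).
Local Notation I x := (0 <= x <= 1).

Lemma superlevel_itv (s b : R) : I s -> 0 <= b -> b <= h s ->
  exists l r, [/\ 0 <= l, l <= s <= r, r <= 1, h l = b &
    (forall u, l <= u <= r -> b <= h u) /\
    (forall t, I t -> (b <= m s t) = (l <= t <= r))].
Proof.
move=> Is b0 bs; have /andP[s0 s1] := Is.
have h0b : h 0 <= b by rewrite coding0.
have [l [/andP[l0 ls] hl lH lmax]] := superlevel_left (coding_cont h) Is h0b bs.
have crev u e : I u -> 0 < e -> exists2 r, 0 < r &
     forall v, I v -> `|u - v| < r -> `|h (1 - u) - h (1 - v)| < e.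
  move=> /andP[u0 u1] e0.
  have Iu : I (1 - u) by apply/andP; split; lra.
  have [r r0 H] := coding_cont h Iu e0; exists r => // v /andP[v0 v1] uv.
  apply: H; first by apply/andP; split; lra.
  by rewrite (_ : _ - _ = v - u) ?(distrC v)//; lra.
have Is' : I (1 - s) by apply/andP; split; lra.
have h1b : h (1 - 0) <= b by rewrite subr0 coding1.
have bs' : b <= h (1 - (1 - s)) by rewrite (_ : 1 - (1 - s) = s)//; lra.
have [r' [/andP[r0 rs] hr rH rmax]] := superlevel_left crev Is' h1b bs'.
have {}rH u : s <= u <= 1 - r' -> b <= h u.
  move=> /andP[su ur]; have := rH (1 - u).
  rewrite (_ : 1 - (1 - u) = u); last by lra.
  by apply; apply/andP; split; lra.
have {}rmax t : s <= t <= 1 -> (forall u, s <= u <= t -> b <= h u) -> t <= 1 - r'.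
  move=> /andP[st t1] H; suff : r' <= 1 - t by lra.
  apply: rmax => [|u /andP[u1 u2]]; first by apply/andP; split; lra.
  by apply: H; apply/andP; split; lra.
have sr : l <= s <= 1 - r' by rewrite ls /=; lra.
exists l, (1 - r'); split => //; first by lra.
have H u : l <= u <= 1 - r' -> b <= h u.
  move=> /andP[lu ur]; have [us|su] := leP u s; first by apply: lH; rewrite lu.
  by apply: rH; rewrite ur ltW.
split=> // t It; have /andP[t0 t1] := It; apply/idP/idP => [bst|/andP[lt tr]]; last first.
  apply: code_min_ge => u; rewrite itv_minmaxE => /orP[|] /andP[u1 u2]; apply: H.
    by rewrite (le_trans ls u1) (le_trans u2 tr).
  by rewrite (le_trans lt u1) (le_trans u2)//; case/andP: sr.
have K u : Num.min s t <= u <= Num.max s t -> b <= h u.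
  by move=> ust; apply: (le_trans bst); exact: code_min_le.
have [ts|st] := leP t s.
  apply/andP; split; last by lra.
  apply: lmax => [|u /andP[u1 u2]]; first by rewrite t0.
  by apply: K; rewrite itv_minmaxE u1 u2 orbT.
apply/andP; split; first by lra.
apply: rmax => [|u /andP[u1 u2]]; first by rewrite (ltW st).
by apply: K; rewrite itv_minmaxE u1 u2.
Qed.

End SuperlevelInterval.

Lemma countable_bigcup_measurable d (T : measurableType d) (U : countType) (D : set U)
    (F : U -> set T) :
  (forall i, D i -> measurable (F i)) -> measurable (\bigcup_(i in D) F i).
Proof.
move=> mF; rewrite bigcup_mkcond; apply: countable_bigcupT_measurable => [|i]; first exact: countableP.
by case: ifPn => // /set_mem; exact: mF.
Qed.

Lemma uniform_prob01E (R : realType) (A : set R) : measurable A ->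
  uniform_prob (@ltr01 R) A = lebesgue_measure (A `&` `[0, 1]).
Proof.
move=> mA; rewrite /uniform_prob integral_uniform_pdf.
rewrite (eq_integral (fun=> 1%:E)); last first.
  by move=> x; rewrite inE => -[_] /=; rewrite in_itv/= /uniform_pdf => ->; rewrite subr0 invr1.
by rewrite integral_cst ?mul1e//; apply: measurableI.
Qed.

(** * Subtrees and the Borel sets they generate *)

Section GromovProduct.
Context {R : realType}.
Implicit Types T : pointedMetricType R.

Definition gprod T (x y : T) : R := (mdist point x + mdist point y - mdist x y) / 2.

(** In a tree, [gprod x y] is the height at which the branches from the root to [x] and [y] part, so
    for [b] between 0 and the height of [x] this is the subtree above the ancestor of [x] at height
    [b]. Only the metric and the root enter. *)
Definition gball T (x : T) (b : R) : set T := [set z | b <= gprod x z].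

Lemma gprod_lip T (x y z : T) : gprod x y - gprod x z <= mdist y z.
Proof.
have := @metric_triangle R T point z y; have := @metric_triangle R T x y z.
by rewrite /gprod (metric_sym z y); lra.
Qed.

Lemma measurable_gball T (x : T) b : measurable (gball x b : set (borel T)).
Proof.
rewrite -[gball _ _]setCK; apply: measurableC; apply: sub_sigma_algebra.
rewrite openE => z /= /negP; rewrite -ltNge => xz.
apply/metricType_numDomainType.nbhs_mdistP; exists (b - gprod x z) => /=; first by rewrite subr_gt0.
move=> y /= zy; apply/negP; rewrite -ltNge.
by have := gprod_lip x y z; rewrite (metric_sym y z); lra.
Qed.

Lemma gprod_isometry T T' (f : T -> T') (x y : T) :
  (forall x y, mdist (f x) (f y) = mdist x y) -> f point = point ->
  gprod (f x) (f y) = gprod x y.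
Proof. by move=> fi f0; rewrite /gprod -f0 !fi. Qed.

End GromovProduct.

Section CodedSubtrees.
Context {R : realType} (h : coding_fun R).
Local Notation m := (code_min h).
Local Notation I x := (0 <= x <= 1).
Local Notation p := (code_proj h).
Local Notation T := (coded_tree h).

Lemma mdist_root t : I t -> mdist (point : T) (p t) = h t.
Proof.
move=> It; have I0 : I (0 : R) by rewrite lexx ler01.
rewrite [point]/(p 0) mdist_projE// /code_dist coding0.
suff -> : m 0 t = 0 by lra.
apply/eqP; rewrite eq_le code_min_ge0// andbT.
by have := code_min_lel h I0 It; rewrite coding0.
Qed.

Lemma gprod_proj s t : I s -> I t -> gprod (p s : T) (p t) = m s t.
Proof. by move=> Is It; rewrite /gprod !mdist_root// mdist_projE// /code_dist; lra. Qed.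

Definition gballs : set (set T) := [set A | exists x b, A = gball x b].

(** By the ultrametric inequality two such sets are nested or disjoint. *)
Lemma gballs_setI : setI_closed gballs.
Proof.
suff H (x y : T) b c : b <= c -> gballs (gball x b `&` gball y c).
  move=> _ _ [x [b ->]] [y [c ->]]; have [/H//|/ltW/H] := leP b c.
  by rewrite setIC.
move=> bc; have [s Is sE] := code_proj_surj x; have [t It tE] := code_proj_surj y.
have [bst|stb] := leP b (m s t); last first.
  (* A level above the height of [x] gives the empty set, which thus belongs to the family. *)
  exists x, (h s + 1); apply/seteqP; split => z; have [u Iu <-] := code_proj_surj z;
    rewrite /gball /= -sE -?tE !gprod_proj//.
    by case; have := code_min_ultra h Is Iu It; rewrite (code_minC h u); lra.
  by have := code_min_lel h Is Iu; lra.
exists y, c; apply/seteqP; split => z; have [u Iu <-] := code_proj_surj z;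
  rewrite /gball /= -?sE -tE !gprod_proj//; first by case.
by have := code_min_ultra h Is It Iu; lra.
Qed.

Lemma gball_root : gball (point : T) 0 = setT.
Proof.
by apply/seteqP; split => // z _; rewrite /gball /= /gprod mdistxx add0r subrr mul0r.
Qed.

Lemma rat_dense01 (t : R) e : I t -> 0 < e -> exists q : rat, I (ratr q : R) /\ `|t - ratr q| < e.
Proof.
move=> /andP[t0 t1] e0.
have [] := @dense_rat R `](Num.max 0 (t - e)), (Num.min 1 (t + e))[%classic.
- exists ((Num.max 0 (t - e) + Num.min 1 (t + e)) / 2) => /=; rewrite in_itv/=.
  suff : Num.max 0 (t - e) < Num.min 1 (t + e) by move=> ?; apply/andP; split; lra.
  by rewrite lt_min !gt_max; apply/andP; split; apply/andP; split; lra.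
- exact: itv_open.
- move=> x [/= + [q _ qE]]; rewrite -qE in_itv/= gt_max lt_min => /andP[/andP[a b] /andP[c d]].
  exists q; split; first by apply/andP; split; lra.
  by rewrite ltr_norml; apply/andP; split; lra.
Qed.

(** The distance from [y] to [x] is the sum of their heights minus twice their Gromov product. So a
    subtree rooted just below [z], with the points noticeably higher than [z] removed, is a small
    neighbourhood of [z]. Rational parameters make the family of such sets countable. *)
Lemma borel_gballs : <<s @open T >> = <<s gballs >>.
Proof.
apply/seteqP; split; last first.
  apply: smallest_sub; first exact: smallest_sigma_algebra.
  by move=> _ [x [b ->]]; exact: measurable_gball.
apply: smallest_sub; first exact: smallest_sigma_algebra.
move=> U oU.
pose G := g_sigma_algebraType gballs.
have mG x b : measurable (gball x b : set G) by apply: sub_sigma_algebra; exists x, b.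
(* between [{|z| > a}] and [{|z| >= a}] *)
pose W (a : R) : set G := \bigcup_(q in [set q : rat | I (ratr q : R) /\ a <= h (ratr q)])
  gball (p (ratr q)) a.
have mW a : measurable (W a) by apply: countable_bigcup_measurable.
have W1 a z : W a z -> a <= mdist point (z : T).
  move=> [q [Iq aq]]; have [u Iu <-] := code_proj_surj z.
  by rewrite /gball /= gprod_proj// mdist_root//; have := code_min_ler h Iq Iu; lra.
have W2 a z : a < mdist point (z : T) -> W a z.
  have [u Iu <-] := code_proj_surj z; rewrite mdist_root// => au.
  have e0 : 0 < h u - a by rewrite subr_gt0.
  have [r r0 Hr] := coding_cont h Iu e0.
  have [q [Iq uq]] := rat_dense01 Iu r0.
  have am : a <= m (ratr q) u.
    have /andP[? ?] := Iq; have /andP[? ?] := Iu.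
    apply: code_min_ge => v; rewrite itv_minmaxE => vq.
    have uv : `|u - v| < r.
      apply: le_lt_trans uq; case/orP: vq => /andP[? ?].
        by rewrite (ger0_norm (x := u - v)) ?ger0_norm; lra.
      by rewrite !ler0_norm; lra.
    have /Hr/(_ uv) : I v by case/orP: vq => /andP[? ?]; apply/andP; split; lra.
    have := ler_norm (h u - h v); lra.
  exists q => //; first by split => //; have := code_min_lel h Iq Iu; lra.
  by rewrite /gball /= gprod_proj.
pose V (qs : rat * (rat * rat)) : set G := let y : T := p (ratr qs.1) in
  gball y (ratr qs.2.1) `\` W (ratr qs.2.2).
pose near_ (qs : rat * (rat * rat)) : set T := let y : T := p (ratr qs.1) in
  [set z | mdist y z < mdist point y + ratr qs.2.2 - 2 * ratr qs.2.1 + 0].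
suff -> : U = \bigcup_(q in [set q | V q `<=` U]) V q.
  by apply: (@countable_bigcup_measurable _ G) => q _; apply: measurableD.
apply/seteqP; split => [z Uz|z [q qU]]; last exact: qU.
move: oU; rewrite openE => /(_ z Uz) /metricType_numDomainType.nbhs_mdistP[e /= e0 He].
have [u Iu uE] := code_proj_surj z.
have e8 : 0 < e / 8 by rewrite divr_gt0.
have [r r0 Hr] : exists2 r, 0 < r & forall t, I t -> `|u - t| < r -> mdist z (p t) < e / 8.
  have /metricType_numDomainType.cvgrPdist_lt/(_ _ e8) := @code_proj_continuous R h u.
  by case=> r /= r0 Hr; exists r => // t _ /Hr; rewrite uE.
have [q [Iq uq]] := rat_dense01 Iu r0; have {Hr}uq := Hr _ Iq uq.
set y := p (ratr q) in uq.
have [b /andP[b1 b2]] : exists b : rat, gprod y z - e / 8 < ratr b < gprod y z.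
  have [|b] := rat_in_itvoo (_ : gprod y z - e / 8 < gprod y z); first by lra.
  by rewrite in_itv/= => ?; exists b.
have [a /andP[a1 a2]] : exists a : rat, mdist point z < ratr a < mdist point z + e / 8.
  have [|a] := rat_in_itvoo (_ : mdist point z < mdist point z + e / 8); first by lra.
  by rewrite in_itv/= => ?; exists a.
exists (q, (b, a)); last first.
  by split; [exact: ltW|move=> /W1 /=; rewrite leNgt => /negP].
move=> x [/= xb xa]; apply: He => /=.
have {}xa : mdist point x <= ratr a.
  by rewrite leNgt; apply/negP => /W2.
have arith (dzx dzy dyz dyx ry rz rx a' b' : R) : dzx <= dzy + dyx -> dzy < e / 8 ->
    dzy = dyz -> a' < rz + e / 8 -> rx <= a' -> (ry + rz - dyz) / 2 - e / 8 < b' ->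
    b' <= (ry + rx - dyx) / 2 -> dzx < e by move: e0; clear; lra.
exact: (arith _ _ _ _ _ _ _ _ _ (metric_triangle z y x) uq (metric_sym z y) a2 xa b1 xb).
Qed.

Lemma mass_gball (s b l r : R) : I s -> 0 <= l -> l <= r -> r <= 1 ->
  (forall t, I t -> (b <= m s t) = (l <= t <= r)) ->
  mass_measure h (gball (p s : T) b) = (r - l)%:E.
Proof.
move=> Is l0 lr r1 H.
have mB := @borel_proj_measurable R h.
have := mB measurableT _ (measurable_gball (p s : T) b); rewrite setTI => mP.
rewrite -[LHS]/(uniform_prob (@ltr01 R) (@borel_proj R h @^-1` gball (p s : T) b)).
rewrite uniform_prob01E//.
rewrite (_ : _ `&` _ = `[l, r]%classic).
  by rewrite lebesgue_measure_itv/= lte_fin; case: ltP => // ?; congr EFin; lra.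
apply/seteqP; split => t /=; rewrite !in_itv/= /gball /=.
  by move=> [+ It]; rewrite gprod_proj// H.
move=> ltr; have It : I t by case/andP: ltr => ? ?; apply/andP; split; lra.
by split => //; rewrite gprod_proj// H.
Qed.

End CodedSubtrees.

(** Uniformity in [s] and [t] matters: it is applied at the ends of superlevel intervals, which
    depend on the path. *)
Definition variation_regular (R : realType) (h : R -> R) (c : R) :=
  forall eta, 0 < eta -> exists2 e0, 0 < e0 &
    forall e s t, 0 < e < e0 -> 0 <= s -> s <= t -> t <= 1 -> regular_at h c e eta s t.

Section Determination.
Context {R : realType}.

(** One inequality is enough: the other is the same statement for the inverse isometry. *)
Let mass_gball_le (h h' : coding_fun R) (c : R) (phi : coded_tree h -> coded_tree h') x b :
  0 < c -> variation_regular h c -> variation_regular h' c -> rooted_isometry phi ->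
  (mass_measure h (gball x b) <= mass_measure h' (gball (phi x) b))%E.
Proof.
move=> c0 hR hR' [bij iso root].
have gp y z : gprod (phi y) (phi z) = gprod y z by exact: gprod_isometry.
(* A lift of [phi] to times: it preserves meets but not the order of times. *)
pose f (u : R) := tree_repr (phi (code_proj h u)).
have If u : 0 <= f u <= 1 by exact: tree_repr_itv.
have pf u : code_proj h' (f u) = phi (code_proj h u) by exact: code_projK.
have fm u v : 0 <= u <= 1 -> 0 <= v <= 1 -> code_min h' (f u) (f v) = code_min h u v.
  by move=> Iu Iv; rewrite -!gprod_proj// !pf gp.
have [s Is <-] := code_proj_surj x.
have hf u : 0 <= u <= 1 -> h' (f u) = h u.
  by move=> Iu; rewrite -!mdist_root// pf -root iso.
have [b0|b0] := leP b 0.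
  suff -> : gball (phi (code_proj h s)) b = setT.
    by rewrite probability_setT; apply: probability_le1; exact: measurable_gball.
  apply/seteqP; split => // z _; rewrite /gball /=.
  by have := @metric_triangle R _ (phi (code_proj h s)) point z; rewrite /gprod (metric_sym _ point); lra.
have [bs|sb] := leP b (h s); last first.
  suff -> : gball (code_proj h s) b = set0 by rewrite measure0 measure_ge0.
  apply/seteqP; split => // z; have [t It <-] := code_proj_surj z; rewrite /gball /= gprod_proj//.
  have := code_min_lel h Is It; lra.
have [l [r [l0 /andP[ls sr] r1 hl [hlr H]]]] := superlevel_itv Is (ltW b0) bs.
have bfs : b <= h' (f s) by rewrite hf.
have [l' [r' [l'0 /andP[ls' sr'] r'1 hl' [_ H']]]] := superlevel_itv (If s) (ltW b0) bfs.
rewrite (mass_gball Is l0 _ r1 H); last by lra.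
rewrite -pf (mass_gball (If s) l'0 _ r'1 H'); last by lra.
rewrite lee_fin -subr_le0 leNgt; apply/negP => gap.
(* If the mass dropped by [g > 0], a nearly optimal list for [h] would transfer to one for [h'] that
   beats the upper bound on the shorter interval; [c * g / 4] leaves room for both errors. *)
set g := r - l - _ in gap.
have eta0 : 0 < c * g / 4 by rewrite divr_gt0// mulr_gt0.
have [e1 e10 E1] := hR _ eta0; have [e2 e20 E2] := hR' _ eta0.
pose e := Num.min e1 e2 / 2.
have e0 : 0 < Num.min e1 e2 by rewrite lt_min e10.
have ee1 : 0 < e < e1.
  by rewrite divr_gt0//= (lt_le_trans (_ : _ < Num.min e1 e2))// ?ge_min ?lexx// gtr_pMr// invf_lt1// ltr1n.
have ee2 : 0 < e < e2.
  by rewrite divr_gt0//= (lt_le_trans (_ : _ < Num.min e1 e2))// ?ge_min ?lexx ?orbT// gtr_pMr// invf_lt1// ltr1n.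
have [_ [L aL LB]] := E1 e l r ee1 l0 (le_trans ls sr) r1.
have lr' : l' <= r' by lra.
have [UB _] := E2 e l' r' ee2 l'0 lr' r'1.
have I01 u : l <= u <= r -> 0 <= u <= 1.
  by move=> /andP[lu ur]; rewrite (le_trans l0 lu) (le_trans ur r1).
have [] := @usum_transfer R h h' f e l r l' r' L l0 r1 l'0 lr' r'1 _ _ _ _ aL.
- by move=> u; rewrite hl; exact: hlr.
- by rewrite hl' hl.
- by move=> u lur; have Iu := I01 _ lur; rewrite -H'// fm// H.
- by move=> u v /I01 Iu /I01; exact: fm.
move=> L' aL' LL; have {UB}UB := UB L' aL'.
have : e * usum h e L <= e * usum h' e L' by rewrite ler_pM2l//; case/andP: ee1.
have : c * g = c * (r - l) - c * (r' - l') by rewrite /g !mulrBr; lra.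
lra.
Qed.

Lemma isometric_misometric (h h' : coding_fun R) (c : R) :
  0 < c -> variation_regular h c -> variation_regular h' c ->
  isometric (coded_rtree h) (coded_rtree h') ->
  misometric (coded_mrtree h) (coded_mrtree h').
Proof.
move=> c0 hR hR' [phi phi_iso]; exists phi => // A mA.
have [[psi phiK psiK] iso root] := phi_iso.
have psi_iso : rooted_isometry psi.
  split; first by exists phi.
  - by move=> x y; rewrite -iso !psiK.
  - by rewrite -root phiK.
have mphi : measurable_fun setT (phi : borel (coded_tree h) -> borel (coded_tree h')).
  apply: (@measurability _ _ (borel (coded_tree h)) (borel (coded_tree h')) setT phi
    (@open (coded_tree h'))) => // _ [U oU <-].
  rewrite setTI; apply: sub_sigma_algebra; rewrite openE => x Ux.
  move: oU; rewrite openE => /(_ _ Ux) /metricType_numDomainType.nbhs_mdistP[e /= e0 He].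
  by apply/metricType_numDomainType.nbhs_mdistP; exists e => // y /= xy; apply: He => /=; rewrite iso.
have pre x b : phi @^-1` gball (phi x) b = gball x b.
  by apply/seteqP; split => z; rewrite /gball /= (gprod_isometry _ _ iso root).
pose Phi : {mfun borel (coded_tree h) >-> borel (coded_tree h')} := mfun_Sub (mem_set mphi).
have PhiE : (Phi : coded_tree h -> coded_tree h') = phi by [].
change (mass_measure h' A = distribution (mass_measure h) Phi A).
have Hu := @measure_unique _ R (borel (coded_tree h')) (@gballs R h') (fun=> setT)
  (borel_gballs h') (@gballs_setI R h').
apply: Hu => //.
- by move=> _; exists point, 0; rewrite gball_root.
- by rewrite bigcup_const.
- move=> _ [x [b ->]]; rewrite -[RHS]/(mass_measure h (phi @^-1` gball x b)) -(psiK x) pre.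
  apply/eqP; rewrite eq_le; apply/andP; split; last exact: mass_gball_le hR hR' phi_iso.
  by rewrite -{2}(phiK (psi x)); exact: mass_gball_le hR' hR psi_iso.
- by move=> _; apply: (@le_lt_trans _ _ 1%E); [exact: probability_le1|rewrite ltry].
Qed.

End Determination.

(** * Gromov-Hausdorff limits and glueing *)

(** Limits along an ultrafilter replace the extraction of subsequences: every sequence in a compact
    set converges at once, so uncountably many can be handled together. *)
Lemma ultra_cvg (R : realType) (T : pseudoMetricType R) (I : Type) (U : set_system I)
    (K : set T) (f : I -> T) :
  UltraFilter U -> compact K -> (forall n, K (f n)) ->
  exists2 l, K l & forall e, 0 < e -> U [set n | ball l e (f n)].
Proof.
move=> UU cK fK.
have UP : ProperFilter U by exact: ultra_proper.
have fU : U (f @^-1` K) by apply: filterE => n; exact: fK.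
have [l [Kl cl]] := cK (f @ U) _ fU.
exists l => // e e0; have [//|UC] := in_ultra_setVsetC [set n | ball l e (f n)] UU.
have [x [/= nx xl]] := cl (~` ball l e) (ball l e) UC (nbhsx_ballx _ _ e0).
by have := nx xl.
Qed.

Lemma ultra_nat : exists2 U : set_system nat, UltraFilter U &
  forall N, U [set n | (N <= n)%N].
Proof.
have [U [UU oU]] := ultraFilterLemma (@eventually_filter).
by exists U => // N; apply: oU; exists N.
Qed.

Section NearIsometry.
Context {R : realType}.
Implicit Types T : pointedMetricType R.

Definition near_isometry (e : R) T T' (f : T -> T') :=
  [/\ forall x y, `|mdist (f x) (f y) - mdist x y| <= e,
      forall y, exists x, mdist (f x) y <= e &
      mdist (f point) point <= e].

Lemma near_isometry_comp T T' T'' (f : T -> T') (g : T' -> T'') e1 e2 :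
  near_isometry e1 f -> near_isometry e2 g -> near_isometry (e1 + 2 * e2) (g \o f).
Proof.
move=> [f1 f2 f3] [g1 g2 g3].
have e20 : 0 <= e2 := le_trans (normr_ge0 _) (g1 point point).
split=> [x y|z|] /=.
- have := g1 (f x) (f y); have := f1 x y; rewrite !ler_norml => /andP[? ?] /andP[? ?].
  by apply/andP; split; lra.
- have [y yz] := g2 z; have [x xy] := f2 y; exists x.
  have := metric_triangle (g (f x)) (g y) z; have := g1 (f x) y.
  by rewrite ler_norml => /andP[? ?]; lra.
- have := metric_triangle (g (f point)) (g point) point; have := g1 (f point) point.
  by rewrite ler_norml => /andP[? ?]; lra.
Qed.

Lemma near_isometry_le T T' (f : T -> T') e1 e2 : e1 <= e2 ->
  near_isometry e1 f -> near_isometry e2 f.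
Proof.
move=> ee [f1 f2 f3]; split=> [x y|y|]; last exact: le_trans ee.
  exact: le_trans ee.
by have [x xy] := f2 y; exists x; exact: le_trans ee.
Qed.

Lemma rooted_isometry_near T T' (f : T -> T') : rooted_isometry f -> near_isometry 0 f.
Proof.
move=> [[g fK gK] fi fp]; split.
- by move=> x y; rewrite fi subrr normr0.
- by move=> y; exists (g y); rewrite gK mdistxx.
- by rewrite fp mdistxx.
Qed.

(** The limit is taken pointwise along one ultrafilter. A preimage of [y] is the ultralimit of its
    approximate preimages. *)
Lemma near_isometry_limit T T' : compact [set: T] -> compact [set: T'] ->
  (forall e, 0 < e -> exists f : T -> T', near_isometry e f) ->
  exists f : T -> T', rooted_isometry f.
Proof.
move=> cT cT' H.
have [U UU UN] := ultra_nat.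
have UP : ProperFilter U by exact: ultra_proper.
have inv0 n : 0 < n.+1%:R^-1 :> R by rewrite invr_gt0.
have [f fn] := choice (fun n : nat => H _ (inv0 n)).
have Ue (e : R) : 0 < e -> U [set n | n.+1%:R^-1 < e].
  move=> e0; apply: filterS (UN (Num.truncn e^-1)) => n /= en.
  by rewrite invf_plt ?posrE//; apply: lt_le_trans (truncnS_gt _) _; rewrite ler_nat.
have lim (T0 : pointedMetricType R) (u : nat -> T0) : compact [set: T0] ->
    exists l, forall e, 0 < e -> U [set n | mdist l (u n) < e].
  move=> cT0; have [//|l _ Hl] := @ultra_cvg R T0 nat U setT u UU cT0 _.
  by exists l => e e0; apply: filterS (Hl e e0) => n /=; rewrite ballEmdist.
have [F HF] := choice (fun x => lim T' (fun n => f n x) cT').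
have Fi x y : mdist (F x) (F y) = mdist x y.
  suff K (e : R) : 0 < e -> `|mdist (F x) (F y) - mdist x y| <= e.
    by apply/eqP; rewrite -subr_eq0 -normr_le0; apply/ler_addgt0Pr => e /K; rewrite add0r.
  move=> e0; have e3 : 0 < e / 3 by rewrite divr_gt0.
  have [n [[/= xn yn] ne]] := filter_ex (filterI (filterI (HF x _ e3) (HF y _ e3)) (Ue _ e3)).
  move: xn yn ne => /= xn yn ne.
  have [fi _ _] := fn n; have := fi x y; move: (n.+1%:R^-1) ne => r ne.
  have := metric_triangle (F x) (f n x) (F y); have := metric_triangle (f n x) (f n y) (F y).
  have := metric_triangle (f n x) (F x) (f n y); have := metric_triangle (F x) (F y) (f n y).
  rewrite (metric_sym (f n x) (F x)) (metric_sym (f n y) (F y)) !ler_norml.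
  by move=> ? ? ? ? /andP[? ?]; apply/andP; split; lra.
have F0 : F point = point.
  apply: (@mdist_positivity R); apply/eqP; rewrite eq_le mdist_ge0 andbT.
  apply/ler_addgt0Pr => /= e e0; have e3 : 0 < e / 3 by rewrite divr_gt0.
  have [n [/= xn ne]] := filter_ex (filterI (HF point _ e3) (Ue _ e3)).
  have [_ _ fp] := fn n; move: (n.+1%:R^-1) ne fp => r ne fp.
  have := metric_triangle (F point) (f n point) point; lra.
have Fs y : exists x, F x = y.
  have [x xE] := choice (fun n => let: And3 _ s _ := fn n in s y).
  have [l Hl] := lim T x cT; exists l.
  apply: (@mdist_positivity R); apply/eqP; rewrite eq_le mdist_ge0 andbT.
  apply/ler_addgt0Pr => /= e e0; have e4 : 0 < e / 4 by rewrite divr_gt0.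
  have [n [/= [ln xn] ne]] := filter_ex (filterI (filterI (HF l _ e4) (Hl _ e4)) (Ue _ e4)).
  have [fi _ _] := fn n; have := fi l (x n); have := xE n; move: (n.+1%:R^-1) ne => r ne.
  have := metric_triangle (F l) (f n l) y; have := metric_triangle (f n l) (f n (x n)) y.
  by rewrite ler_norml => ? ? ? /andP[? ?]; lra.
have [G FG] := choice Fs.
exists F; split => //; exists G => // x.
by apply: (@mdist_positivity R); rewrite -Fi FG mdistxx.
Qed.

Lemma compact_mdist_bounded T : compact [set: T] -> exists M, forall x y : T, mdist x y <= M.
Proof.
move=> cT; apply: contrapT => nM.
have H (n : nat) : exists xy : T * T, n%:R < mdist xy.1 xy.2.
  apply: contrapT => nx; apply: nM; exists n%:R => x y; rewrite leNgt; apply/negP => xy.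
  by apply: nx; exists (x, y).
have [u un] := choice H.
have [U UU UN] := ultra_nat.
have UP : ProperFilter U by exact: ultra_proper.
have lim (v : nat -> T) : exists l, U [set n | mdist l (v n) < 1].
  have [//|l _ Hl] := @ultra_cvg R T nat U setT v UU cT _.
  by exists l; apply: filterS (Hl _ ltr01) => n /=; rewrite ballEmdist.
have [l Hl] := lim (fun n => (u n).1); have [l' Hl'] := lim (fun n => (u n).2).
have [n [/= [ln ln'] nN]] := filter_ex (filterI (filterI Hl Hl')
  (UN (Num.truncn (mdist l l' + 2)).+1)).
have := un n; have := metric_triangle (u n).1 l (u n).2; have := metric_triangle l l' (u n).2.
have : mdist l l' + 2 < n%:R :> R.
  by apply: lt_le_trans (truncnS_gt _) _; rewrite ler_nat.
rewrite (metric_sym _ l); lra.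
Qed.

End NearIsometry.

(** * Glueing two spaces along a correspondence *)

Section Glue.
Context {R : realType} (T T' : pointedMetricType R) (a : R -> T) (b : R -> T') (e : R).
Hypothesis e0 : 0 < e.
Hypothesis ab : forall u v, `|mdist (a u) (a v) - mdist (b u) (b v)| <= 2 * e.

Let cross_set x y := range (fun u => mdist x (a u) + e + mdist (b u) y).

Definition cross x y : R := inf (cross_set x y).

Let cross_set_lb x y : lbound (cross_set x y) e.
Proof.
by move=> _ [u _ <-]; have := mdist_ge0 x (a u); have := mdist_ge0 (b u) y; lra.
Qed.

Let cross_le x y u : cross x y <= mdist x (a u) + e + mdist (b u) y.
Proof. by apply: ge_inf; [exists e; exact: cross_set_lb|exists u]. Qed.

Let cross_ge x y c : (forall u, c <= mdist x (a u) + e + mdist (b u) y) -> c <= cross x y.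
Proof.
by move=> H; apply: lb_le_inf => [|_ [u _ <-]//]; exists (mdist x (a 0) + e + mdist (b 0) y), 0.
Qed.

(** The pairs [(a u, b u)] form a correspondence of distortion at most [2 * e], and putting the
    points of each pair at distance [e] extends both metrics to the disjoint union. The two proofs
    are arguments of the type because its metric instance depends on them. *)
Definition mglue (_ : 0 < e)
  (_ : forall u v, `|mdist (a u) (a v) - mdist (b u) (b v)| <= 2 * e) : Type := (T + T')%type.

Local Notation Z := (mglue e0 ab).

Definition mglue_dist (z z' : Z) : R :=
  match z, z' with
  | inl x, inl x' => mdist x x'
  | inl x, inr y => cross x y
  | inr y, inl x => cross x y
  | inr y, inr y' => mdist y y'
  end.

Let mglue_distxx z : mglue_dist z z = 0.
Proof. by case: z => x /=; rewrite mdistxx. Qed.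

Let cross_gt0 x y : 0 < cross x y.
Proof. by apply: lt_le_trans e0 _; apply: cross_ge => u; apply: cross_set_lb; exists u. Qed.

Let mglue_dist_positivity z z' : mglue_dist z z' = 0 -> z = z'.
Proof.
case: z z' => x [] y /=.
- by move/(@mdist_positivity R) => ->.
- by move=> xy; have := cross_gt0 x y; rewrite xy ltxx.
- by move=> xy; have := cross_gt0 y x; rewrite xy ltxx.
- by move/(@mdist_positivity R) => ->.
Qed.

Let mglue_dist_sym z z' : mglue_dist z z' = mglue_dist z' z.
Proof. by case: z z' => x [] y //=; exact: metric_sym. Qed.

Let mglue_dist_triangle (z' z z'' : Z) :
  mglue_dist z z'' <= mglue_dist z z' + mglue_dist z' z''.
Proof.
case: z z' z'' => x [] y [] z /=; try exact: metric_triangle.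
- rewrite -lerBlDl; apply: cross_ge => u; rewrite lerBlDl.
  have := cross_le x z u; have := metric_triangle x y (a u); lra.
- rewrite -lerBlDr; apply: cross_ge => u; rewrite lerBlDr -lerBlDl.
  apply: cross_ge => v; rewrite lerBlDl.
  have := ab u v; rewrite ler_norml => /andP[? ?].
  have := metric_triangle x (a u) z; have := metric_triangle (a u) (a v) z.
  have := metric_triangle (b u) y (b v).
  rewrite (metric_sym (a v) z) (metric_sym y (b v)); lra.
- rewrite -lerBlDr; apply: cross_ge => u; rewrite lerBlDr.
  have := cross_le x z u; have := metric_triangle (b u) y z; lra.
- rewrite -lerBlDr; apply: cross_ge => u; rewrite lerBlDr.
  by have := cross_le z x u; have := metric_triangle z y (a u); rewrite (metric_sym z y); lra.
- rewrite -lerBlDr; apply: cross_ge => u; rewrite lerBlDr -lerBlDl.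
  apply: cross_ge => v; rewrite lerBlDl.
  have := ab u v; rewrite ler_norml => /andP[? ?].
  have := metric_triangle x (b u) z; have := metric_triangle (b u) (b v) z.
  have := metric_triangle (a u) y (a v).
  rewrite (metric_sym x (b u)) (metric_sym (a u) y); lra.
- rewrite -lerBlDl; apply: cross_ge => u; rewrite lerBlDl.
  by have := cross_le z x u; have := metric_triangle (b u) y x; rewrite (metric_sym x y); lra.
Qed.

HB.instance Definition _ := Choice.copy Z (T + T')%type.
HB.instance Definition _ := isPointed.Build Z (inl point).
HB.instance Definition _ := isMetric.Build R Z
  mglue_distxx mglue_dist_positivity mglue_dist_sym mglue_dist_triangle.

Definition mglue_inl (x : T) : Z := inl x.
Definition mglue_inr (y : T') : Z := inr y.

Lemma mdist_inl_inr u : mdist (mglue_inl (a u)) (mglue_inr (b u)) <= e.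
Proof. by have := cross_le (a u) (b u) u; rewrite !mdistxx add0r addr0. Qed.

End Glue.

Section GluePolish.
Context {R : realType}.

Lemma embedding_continuous (T Z : metricType R) (f : T -> Z) : embedding f -> continuous f.
Proof.
move=> fi x; apply/metricType_numDomainType.cvgrPdist_lt => r r0.
near=> y; rewrite fi; near: y.
by apply/metricType_numDomainType.nbhs_mdistP; exists r.
Unshelve. all: by end_near. Qed.

Lemma compact_polish (Z : pointedMetricType R) : compact [set: Z] -> polish Z.
Proof.
move=> cZ; split=> [F FF cF|].
  by exists (lim F); exact: compact_cauchy_cvg FF cF filterT cZ.
have [B cB [oB bB]] := @compact_second_countable R Z cZ.
exists [set xget point b | b in B]; first by apply: sub_countable cB; exact: card_image_le.
move=> O [z Oz] oO; have /bB[V [BV Vz] VO] : nbhs z O by exact: open_nbhs_nbhs.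
have Vx : V (xget point V) by apply: xgetPex; exists z.
by exists (xget point V); split; [exact: VO|exists V].
Qed.

Lemma polish_mglue (T T' : pointedMetricType R) a b e (e0 : 0 < e)
    (ab : forall u v, `|mdist (a u : T) (a v) - mdist (b u : T') (b v)| <= 2 * e) :
  compact [set: T] -> compact [set: T'] -> polish (mglue e0 ab).
Proof.
move=> cT cT'; apply: compact_polish.
rewrite (_ : setT = range (@mglue_inl _ _ _ _ _ _ e0 ab) `|` range (@mglue_inr _ _ _ _ _ _ e0 ab)); last first.
  by apply/seteqP; split => // -[x|y] _; [left; exists x|right; exists y].
by apply: compactU; apply: continuous_compact => //;
  apply: continuous_subspaceT; exact: embedding_continuous.
Qed.

End GluePolish.

Section GromovHausdorffFacts.
Context {R : realType}.

Lemma hausdorff_dist_ge0 (Z : metricType R) (A B : set Z) : 0 <= hausdorff_dist A B.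
Proof.
rewrite /hausdorff_dist; set S := [set _ | _].
have [->|/set0P S0] := eqVneq S set0; first by rewrite inf0.
by apply: lb_le_inf => // x [/ltW].
Qed.

Lemma prokhorov_dist_ge0 (Z : metricType R) (mu nu : set Z -> \bar R) : 0 <= prokhorov_dist mu nu.
Proof.
rewrite /prokhorov_dist; set S := [set _ | _].
have [->|/set0P S0] := eqVneq S set0; first by rewrite inf0.
by apply: lb_le_inf => // x [/ltW].
Qed.

Lemma GH_dist_lt (T T' : rtree R) (e : R) : GH_dist T T' < e ->
  exists (Z : metricType R) (f : T -> Z) (f' : T' -> Z),
    [/\ embedding f, embedding f' &
        hausdorff_dist (range f) (range f') + mdist (f point) (f' point) < e].
Proof.
rewrite /GH_dist; set S := [set _ | _] => Se.
(* An infimum over the empty set would be 0, so a common embedding must be exhibited: the trees are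
   glued with their roots at distance 1. *)
have S0 : S !=set0.
  have ab (u v : R) : `|mdist (point : T) point - mdist (point : T') point| <= 2 * 1.
    by rewrite !mdistxx subrr normr0.
  eexists; exists (mglue ltr01 ab), (@mglue_inl _ _ _ _ _ _ ltr01 ab), (@mglue_inr _ _ _ _ _ _ ltr01 ab).
  by split; [exact: polish_mglue (@rtree_compact R T) (@rtree_compact R T')|by []|by []|reflexivity].
have [r [Z [f [f' [_ fi fi' ->]]]] re] := inf_lt S0 Se.
by exists Z, f, f'.
Qed.

Lemma near_isometry_GH (T T' : rtree R) (e : R) : GH_dist T T' < e ->
  exists f : T -> T', near_isometry (2 * e) f.
Proof.
move=> /GH_dist_lt[Z [f [f' [fi fi' He]]]].
pose S := [set e | [/\ 0 < e, range f `<=` fattening (range f') e & range f' `<=` fattening (range f) e]].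
have [M HM] := compact_mdist_bounded (@rtree_compact R T).
have [M' HM'] := compact_mdist_bounded (@rtree_compact R T').
have bnd x y : mdist (f x) (f' y) <= M + mdist (f point) (f' point) + M'.
  have := metric_triangle (f x) (f point) (f' y).
  have := metric_triangle (f point) (f' point) (f' y).
  by rewrite fi fi'; have := HM x point; have := HM' point y; lra.
(* The same caution for the Hausdorff infimum: compactness bounds all distances, so a large radius
   is admissible. *)
have S0 : S !=set0.
  exists (M + mdist (f point) (f' point) + M' + 1); split.
  - by have := bnd point point; have := mdist_ge0 (f point) (f' point); lra.
  - move=> _ [x _ <-]; exists (f' point); first by exists point.
    by rewrite metric_sym; have := bnd x point; lra.
  - move=> _ [y _ <-]; exists (f point); first by exists point.
    by have := bnd point y; lra.
have He' : inf S < e - mdist (f point) (f' point) by rewrite /hausdorff_dist -/S in He; lra.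
have [r [r0 H1 H2] re] := inf_lt S0 He'.
have m0 := mdist_ge0 (f point) (f' point).
have /choice[g gP] x : exists y, mdist (f x) (f' y) < r.
  have [|_ [y _ <-] yx] := H1 (f x); first by exists x.
  by exists y; rewrite metric_sym.
exists g; split.
- move=> x y; rewrite -fi' -(fi x y).
  have := gP x; have := gP y.
  have := metric_triangle (f' (g x)) (f x) (f' (g y)); have := metric_triangle (f x) (f y) (f' (g y)).
  have := metric_triangle (f x) (f' (g x)) (f y); have := metric_triangle (f' (g x)) (f' (g y)) (f y).
  rewrite (metric_sym (f' (g x)) (f x)) (metric_sym (f' (g y)) (f y)) ler_norml.
  by move=> *; apply/andP; split; lra.
- move=> y; have [|_ [x _ <-] xy] := H2 (f' y); first by exists y.
  exists x; rewrite -fi'; have := metric_triangle (f' (g x)) (f x) (f' y).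
  by rewrite (metric_sym _ (f x)); have := gP x; lra.
- rewrite -fi'; have := metric_triangle (f' (g point)) (f point) (f' point).
  by rewrite (metric_sym _ (f point)); have := gP point; lra.
Qed.

Lemma open_fattening (Z : metricType R) (A : set Z) (e : R) : open (fattening A e).
Proof.
rewrite openE => z [a Aa az]; apply/metricType_numDomainType.nbhs_mdistP.
exists (e - mdist a z) => /=; first by rewrite subr_gt0.
by move=> y /= zy; exists a => //; have := metric_triangle a z y; lra.
Qed.

End GromovHausdorffFacts.

Section UniformlyClose.
Context {R : realType} (h h' : coding_fun R) (eta : R).
Hypothesis eta0 : 0 < eta.
Hypothesis hh : forall t, 0 <= t <= 1 -> `|h t - h' t| <= eta.

Let code_min_close_le (g g' : coding_fun R) s t :
  (forall t, 0 <= t <= 1 -> `|g t - g' t| <= eta) -> 0 <= s <= 1 -> 0 <= t <= 1 ->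
  code_min g s t - eta <= code_min g' s t.
Proof.
move=> gg Is It; apply: code_min_ge => u ust.
have Iu : 0 <= u <= 1.
  move: ust; rewrite itv_minmaxE; move/andP: Is => [? ?]; move/andP: It => [? ?].
  by move=> /orP[|] /andP[? ?]; apply/andP; split; lra.
by have := gg u Iu; have := code_min_le g Is It ust; rewrite ler_norml => ? /andP[? ?]; lra.
Qed.

Lemma code_dist_close s t : 0 <= s <= 1 -> 0 <= t <= 1 ->
  `|code_dist h s t - code_dist h' s t| <= 4 * eta.
Proof.
move=> Is It; rewrite /code_dist; have := hh Is; have := hh It.
have := code_min_close_le hh Is It.
have := @code_min_close_le h' h s t _ Is It.
move=> H1; have {}H1 := H1 (fun t It => etrans (congr1 (fun x => x <= eta) (distrC _ _)) (hh It)).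
by rewrite !ler_norml => ? /andP[? ?] /andP[? ?]; apply/andP; split; lra.
Qed.

Lemma near_isometry_coded :
  exists f : coded_rtree h -> coded_rtree h', near_isometry (4 * eta) f.
Proof.
have I0 : 0 <= (0 : R) <= 1 by rewrite lexx ler01.
exists (fun x => code_proj h' (tree_repr x)); split.
- move=> x y; rewrite mdist_projE ?tree_repr_itv//.
  by rewrite distrC; apply: code_dist_close; exact: tree_repr_itv.
- move=> y; have [t It <-] := code_proj_surj y; exists (code_proj h t).
  rewrite mdist_projE ?tree_repr_itv//.
  have := code_dist_close (tree_repr_itv (code_proj h t)) It.
  by rewrite (tree_reprE h It) ler_norml => /andP[? ?]; lra.
- rewrite [X in mdist _ X]/(code_proj h' 0) mdist_projE ?tree_repr_itv//.
  have := code_dist_close (tree_repr_itv (code_proj h 0)) I0.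
  by rewrite (tree_reprE h I0) ler_norml => /andP[? ?]; lra.
Qed.

(** The trees are glued along the common time parameter. Both masses are images of the same measure
    on times, so matching times control the Prokhorov distance too. In units of [eta] the Hausdorff
    and Prokhorov parts cost 3 each and the roots 2. *)
Lemma GHP_dist_coded : GHP_dist (coded_mrtree h) (coded_mrtree h') <= 8 * eta.
Proof.
have e0 : 0 < 2 * eta by have := eta0; lra.
have ab (u v : R) : `|mdist (code_proj h u) (code_proj h v) -
    mdist (code_proj h' u) (code_proj h' v)| <= 2 * (2 * eta).
  rewrite (code_proj_clamp h u) (code_proj_clamp h v) (code_proj_clamp h' u) (code_proj_clamp h' v).
  rewrite !mdist_projE ?clamp01_itv//.
  have := code_dist_close (clamp01_itv u) (clamp01_itv v).
  by rewrite (_ : 2 * (2 * eta) = 4 * eta)//; lra.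
pose f := @mglue_inl _ _ _ _ _ _ e0 ab; pose f' := @mglue_inr _ _ _ _ _ _ e0 ab.
have ff u : mdist (f (code_proj h u)) (f' (code_proj h' u)) < 3 * eta.
  by apply: le_lt_trans (mdist_inl_inr e0 ab u) _; lra.
pose D := hausdorff_dist (range f) (range f') + mdist (f point) (f' point) +
  prokhorov_dist (fun A => mass (coded_mrtree h) (f @^-1` A))
                 (fun A => mass (coded_mrtree h') (f' @^-1` A)).
have eta3 : 0 < 3 * eta by lra.
apply: (@le_trans _ _ D).
  apply: ge_inf.
    exists 0 => _ [Z [g [g' [_ _ _ ->]]]].
    by rewrite !addr_ge0 ?mdist_ge0 ?hausdorff_dist_ge0 ?prokhorov_dist_ge0.
  exists (mglue e0 ab), f, f'; split => //.
  by apply: polish_mglue; exact: coded_tree_compact.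
suff [H1 H2] : hausdorff_dist (range f) (range f') <= 3 * eta /\
  prokhorov_dist (fun A => mass (coded_mrtree h) (f @^-1` A))
                 (fun A => mass (coded_mrtree h') (f' @^-1` A)) <= 3 * eta.
  have H3 : mdist (f point) (f' point) <= 2 * eta by exact: (mdist_inl_inr e0 ab 0).
  by rewrite /D; lra.
split.
  apply: ge_inf; first by exists 0 => x [/ltW].
  split=> // [_ [x _ <-]|_ [y _ <-]].
    have [t It <-] := code_proj_surj x; exists (f' (code_proj h' t)); first by exists (code_proj h' t).
    by rewrite metric_sym; exact: ff.
  have [t It <-] := code_proj_surj y; exists (f (code_proj h t)); first by exists (code_proj h t).
  exact: ff.
have mpre (g : coding_fun R) (k : coded_tree g -> mglue e0 ab) A : embedding k ->
    <<s @open (mglue e0 ab) >> A -> measurable ((@borel_proj R g) @^-1` (k @^-1` A)).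
  move=> ki mA; have mk : measurable_fun setT (k \o @borel_proj R g : _ -> borel (mglue e0 ab)).
    apply: (@measurability _ _ (measurableTypeR R) (borel (mglue e0 ab)) setT _ (@open (mglue e0 ab))) => //.
    move=> _ [U oU <-]; rewrite setTI; apply: measurable_realfun.open_measurable.
    move: U oU; apply/continuousP => t; apply: continuous_comp; first exact: code_proj_continuous.
    exact: embedding_continuous.
  by have := mk measurableT A mA; rewrite setTI.
have massE (g : coding_fun R) (B : set (coded_tree g)) :
  mass (coded_mrtree g) B = uniform_prob (@ltr01 R) (@borel_proj R g @^-1` B) by [].
apply: ge_inf; first by exists 0 => x [/ltW].
split=> // A mA; rewrite !massE.
have mF (B : set (mglue e0 ab)) : <<s @open (mglue e0 ab) >> (fattening B (3 * eta)).
  by apply: sub_sigma_algebra; exact: open_fattening.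
have fi : embedding f by []. have fi' : embedding f' by [].
split.
  apply: (@le_trans _ _ (uniform_prob (@ltr01 R) (@borel_proj R h' @^-1` (f' @^-1` fattening A (3 * eta))))).
    apply: le_measure; rewrite ?inE; [exact: mpre|exact: mpre|].
    by move=> t /= At; exists (f (code_proj h t)).
  by rewrite leeDl// lee_fin; lra.
apply: (@le_trans _ _ (uniform_prob (@ltr01 R) (@borel_proj R h @^-1` (f @^-1` fattening A (3 * eta))))).
  apply: le_measure; rewrite ?inE; [exact: mpre|exact: mpre|].
  by move=> t /= At; exists (f' (code_proj h' t)) => //; rewrite metric_sym; exact: ff.
by rewrite leeDl// lee_fin; lra.
Qed.

End UniformlyClose.

Section Classes.
Context {R : realType}.
Implicit Types T : rtree R.

Lemma isometric_sym T T' : isometric T T' -> isometric T' T.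
Proof.
move=> [f [[g fK gK] fi fp]]; exists g; split; first by exists f.
- by move=> x y; rewrite -fi !gK.
- by rewrite -fp fK.
Qed.

Lemma isometric_trans T T' T'' : isometric T T' -> isometric T' T'' -> isometric T T''.
Proof.
move=> [f [bf fi fp]] [g [bg gi gp]]; exists (g \o f); split; first exact: bij_comp.
- by move=> x y; rewrite /= gi fi.
- by rewrite /= fp gp.
Qed.

Lemma isometric_refl T : isometric T T.
Proof. by exists id; split => //; exists id. Qed.

Lemma rtree_cls_isometric T T' : rtree_cls T = rtree_cls T' <-> isometric T T'.
Proof.
split=> [/(congr1 sval) /= TT|TT].
  have : [set T'' | isometric T' T''] T' by exact: isometric_refl.
  by rewrite -TT.
apply: eq_exist; apply/seteqP; split => S /=; last exact: isometric_trans.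
exact: isometric_trans (isometric_sym TT).
Qed.

Lemma isometry_borel_measurable (T T' : pointedMetricType R) (f : T -> T') :
  (forall x y, mdist (f x) (f y) = mdist x y) ->
  forall A : set (borel T'), measurable A -> measurable (f @^-1` A : set (borel T)).
Proof.
move=> fi; suff mf : measurable_fun setT (f : borel T -> borel T').
  by move=> A mA; have := mf measurableT A mA; rewrite setTI.
apply: (@measurability _ _ (borel T) (borel T') setT f (@open T')) => // _ [U oU <-].
rewrite setTI; apply: sub_sigma_algebra.
by move: U oU; apply/continuousP; exact: embedding_continuous.
Qed.

Lemma mrtree_cls_eq (T T' : mrtree R) : misometric T T' -> mrtree_cls T = mrtree_cls T'.
Proof.
have trans (T1 T2 T3 : mrtree R) : misometric T1 T2 -> misometric T2 T3 -> misometric T1 T3.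
  move=> [f [bf fi fp] fm] [g [bg gi gp] gm]; exists (g \o f).
    by split; [exact: bij_comp|move=> x y; rewrite /= gi fi|rewrite /= fp gp].
  by move=> A mA; rewrite gm// fm//; exact: isometry_borel_measurable.
have sym (T1 T2 : mrtree R) : misometric T1 T2 -> misometric T2 T1.
  move=> [f [[g fK gK] fi fp] fm].
  have gi x y : mdist (g x) (g y) = mdist x y by rewrite -fi !gK.
  exists g; first by split; [exists f|exact: gi|rewrite -fp fK].
  move=> A mA; rewrite fm; last exact: isometry_borel_measurable.
  by congr (mass _ _); apply/seteqP; split => x /=; rewrite fK.
move=> TT; apply: eq_exist; apply/seteqP; split => S /=; last exact: trans.
exact: trans (sym _ _ TT).
Qed.

End Classes.

(** * A measurable map on isometry classes *)

Section MeasurableSelection.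
Context {R : realType} (S : nat -> set (coding_fun R)) (h0 : coding_fun R).
Local Notation I x := (0 <= x <= 1).

Hypothesis compactS : forall j (u : nat -> coding_fun R), (forall n, S j (u n)) ->
  exists2 h, S j h & forall (e : R) N, 0 < e ->
    exists2 n, (N <= n)%N & forall t, I t -> `|h t - u n t| <= e.
Hypothesis detS : forall h h' j j', S j h -> S j' h' ->
  isometric (coded_rtree h) (coded_rtree h') -> misometric (coded_mrtree h) (coded_mrtree h').

Let codes j (F : set (mrtree_class R)) : set (rtree_class R) :=
  [set C | exists h, [/\ S j h, C = rtree_cls (coded_rtree h) & F (mrtree_cls (coded_mrtree h))]].

(** Near-isometries from [T] to trees coded in the family, followed by those that a uniform limit of
    the coding paths provides, have errors tending to 0; [near_isometry_limit] then identifies [T]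
    with the tree of the limit path. *)
Let GH_open_codesC j F : GHP_open (~` F) -> GH_open (~` codes j F).
Proof.
move=> oF T nT; apply: contrapT => nE.
have H (n : nat) : exists h, [/\ S j h, F (mrtree_cls (coded_mrtree h)) &
    exists f : T -> coded_rtree h, near_isometry (2 * n.+1%:R^-1 + 2 * 0) f].
  have [T' TT' [h [Sh T'h Fh]]] : exists2 T' : rtree R, GH_dist T T' < n.+1%:R^-1 &
      codes j F (rtree_cls T').
    apply: contrapT => nT'; apply: nE; exists n.+1%:R^-1; first by rewrite invr_gt0.
    by move=> T' TT' T'F; apply: nT'; exists T'.
  exists h; split => //; have [f fn] := near_isometry_GH TT'.
  have /rtree_cls_isometric[g gi] := T'h.
  exists (g \o f); apply: (near_isometry_comp fn).
  exact: rooted_isometry_near.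
have [u uP] := choice H.
have [h Sh hu] := compactS (fun n => let: And3 s _ _ := uP n in s).
apply: nT; exists h; split => //.
  apply/rtree_cls_isometric; apply: near_isometry_limit; [exact: rtree_compact|exact: rtree_compact|].
  move=> e e0; have e16 : 0 < e / 16 by rewrite divr_gt0.
  have [n Nn hn] := hu _ (Num.truncn (e / 4)^-1).+1 e16.
  have [_ _ [f fn]] := uP n.
  have hn' t : I t -> `|u n t - h t| <= e / 16 by move=> It; rewrite distrC; exact: hn.
  have [g gn] := near_isometry_coded hn'.
  exists (g \o f); apply: near_isometry_le (near_isometry_comp fn gn).
  have : n.+1%:R^-1 < e / 4.
    rewrite invf_plt ?posrE//; last by rewrite divr_gt0.
    by apply: lt_le_trans (truncnS_gt _) _; rewrite ler_nat ltnW.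
  by move: (n.+1%:R^-1) => r; lra.
apply: contrapT => nF; have [e e0 He] := oF _ nF.
have e16 : 0 < e / 16 by rewrite divr_gt0.
have [n _ hn] := hu _ 0%N e16; have [_ Fn _] := uP n.
by apply: (He (coded_mrtree (u n))) => //; apply: le_lt_trans (GHP_dist_coded e16 hn) _; lra.
Qed.

Let good (C : rtree_class R) :=
  exists h, (exists j, S j h) /\ C = rtree_cls (coded_rtree h).

(** On coded classes the choice of the path is harmless by [detS]; elsewhere the value is the
    default given by [h0]. *)
Let Phi (C : rtree_class R) : mrtree_class R :=
  if pselect (good C) is left H then mrtree_cls (coded_mrtree (projT1 (cid H)))
  else mrtree_cls (coded_mrtree h0).

Let PhiE j h : S j h -> Phi (rtree_cls (coded_rtree h)) = mrtree_cls (coded_mrtree h).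
Proof.
move=> Sh; rewrite /Phi; case: pselect => [H|[]]; last by exists h; split=> //; exists j.
case: cid => h' /= [[j' Sh'] /rtree_cls_isometric hh'].
by apply/esym/mrtree_cls_eq; exact: detS Sh Sh' hh'.
Qed.

Lemma measurable_selection : exists2 Phi : rtree_class R -> mrtree_class R,
  GH_GHP_measurable Phi &
  forall j h, S j h -> Phi (rtree_cls (coded_rtree h)) = mrtree_cls (coded_mrtree h).
Proof.
exists Phi; last exact: PhiE.
have [s0 sC sU] := smallest_sigma_algebra setT (@GH_open R).
have {}sC A : <<s @GH_open R >> (~` A) -> <<s @GH_open R >> A.
  by move=> /sC; rewrite setTD setCK.
have mcodes F : GHP_open (~` F) -> <<s @GH_open R >> (\bigcup_j codes j F).
  move=> oF; apply: sU => j; apply: sC; apply: sub_sigma_algebra; exact: GH_open_codesC.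
suff : <<s @GHP_open R >> `<=` image_set_system setT Phi <<s @GH_open R >>.
  by move=> H B /H; rewrite /image_set_system /= setTI.
apply: smallest_sub; first exact/sigma_algebra_image/smallest_sigma_algebra.
move=> O oO; rewrite /image_set_system /= setTI; apply: sC.
have m1 : <<s @GH_open R >> (\bigcup_j codes j (~` O)) by apply: mcodes; rewrite setCK.
have m2 : <<s @GH_open R >> (\bigcup_j codes j setT).
  by apply: mcodes; rewrite setCT => T.
(* [Phi] is constant off the coded classes. If the default lies in [O], the complement of the
   preimage consists of coded classes; otherwise the preimage itself does. *)
have [Oh|Oh] := pselect (O (mrtree_cls (coded_mrtree h0))).
  suff -> : ~` (Phi @^-1` O) = \bigcup_j codes j (~` O) by [].
  apply/seteqP; split => C /=; last first.
    by move=> [j _ [h [Sh -> /= nO]]]; rewrite (PhiE Sh).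
  rewrite {1}/Phi; case: pselect => // H; case: cid => h [[j Sh] CE] nO.
  by exists j => //; exists h.
have [_ sD sU'] := smallest_sigma_algebra setT (@GH_open R).
rewrite -setTD; apply: (sD).
suff -> : Phi @^-1` O = (\bigcup_j codes j setT) `\` (\bigcup_j codes j (~` O)).
  rewrite setDE -[X in X `&` _]setCK -setCU -setTD; apply: (sD).
  have -> : ~` (\bigcup_j codes j setT) `|` \bigcup_j codes j (~` O) =
     \bigcup_k (if k is 0%N then ~` (\bigcup_j codes j setT) else \bigcup_j codes j (~` O)).
    apply/seteqP; split => C /=; first by case=> ?; [exists 0%N|exists 1%N].
    by case=> -[|k] _ ?; [left|right].
  by apply: sU' => -[|k] //; rewrite -setTD; exact: sD.
apply/seteqP; split => C /=.
  move=> OC; split; last first.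
    by move=> [j _ [h [Sh CE nO]]]; apply: nO; rewrite -(PhiE Sh) -CE.
  move: OC; rewrite /Phi; case: pselect => // H; case: cid => h [[j Sh] CE] _.
  by exists j => //; exists h.
move=> [[j _ [h [Sh CE _]]] nO]; rewrite CE (PhiE Sh).
by apply: contrapT => nO'; apply: nO; exists j => //; exists h.
Qed.

End MeasurableSelection.

(** * Compact families of regular paths *)

Lemma le_of_forall_add (R : realType) (x y : R) : (forall e, 0 < e -> x <= y + e) -> x <= y.
Proof. by move=> H; apply/ler_addgt0Pr. Qed.

(** In contrast with [usum_perturb] the threshold is kept and the error grows with the list, which
    is harmless when the list is fixed first. *)
Lemma usum_close {disp} {T : orderType disp} {R : realType} (h h' : T -> R) e d s t
    (l : seq (T * T)) : adm s t l -> (forall a, (s <= a <= t)%O -> `|h a - h' a| <= d) ->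
  usum h e l <= usum h' e l + 2 * d * (size l)%:R.
Proof.
move=> sl hh; have := usum_perturb e sl hh.
rewrite (_ : usum h (e + d *+ 2) l = usum h e l - 2 * d * (size l)%:R); first by lra.
elim: l {sl} => [|p l IH]; first by rewrite !usum_nil mulr0 subr0.
by rewrite !usum_cons IH /= -(natr1 (size l)) mulrDr mulr1 mulr2n; lra.
Qed.

Section RegularFamily.
Context {R : realType}.
Local Notation I x := (0 <= x <= 1).

(** The clauses are chosen to survive uniform limits. In the last one, the strict inequalities on
    [e] and on [e * y] leave room to raise the threshold slightly. *)
Definition regular_cond (c : R) (k N : nat) (h : R -> R) : Prop :=
  [/\ forall t, I t -> h t <= N%:R,
      forall s t, I s -> I t -> `|s - t| <= N.+1%:R^-1 -> `|h s - h t| <= k.+1%:R^-1,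
      forall e s t l, 0 < e < N.+1%:R^-1 -> 0 <= s -> s <= t -> t <= 1 -> adm s t l ->
        e * usum h e l <= c * (t - s) + k.+1%:R^-1 &
      forall e s t y, 0 < e < N.+1%:R^-1 -> 0 <= s -> s <= t -> t <= 1 ->
        e * y < c * (t - s) - k.+1%:R^-1 -> exists2 l, adm s t l & y <= usum h e l].

Definition regular_family (c : R) (f : nat -> nat) : set (coding_fun R) :=
  [set h | forall k, regular_cond c k (f k) h].

Lemma inv_natS_lt (e : R) : 0 < e -> exists k : nat, k.+1%:R^-1 < e.
Proof.
move=> e0; exists (Num.truncn e^-1).
by rewrite invf_plt ?posrE//; exact: truncnS_gt.
Qed.

Lemma regular_family_variation c f h : regular_family c f h -> variation_regular h c.
Proof.
move=> H eta eta0; have [k ke] := inv_natS_lt eta0.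
have [_ _ H1 H2] := H k; exists (f k).+1%:R^-1; first by rewrite invr_gt0.
move=> e s t ef s0 st t1; have e0 : 0 < e by case/andP: ef.
split=> [l sl|]; first by apply: le_trans (H1 _ _ _ _ ef s0 st t1 sl) _; rewrite lerD2l ltW.
have [|l sl yl] := H2 e s t ((c * (t - s) - eta) / e) ef s0 st t1.
  by rewrite mulrC divfK ?gt_eqF// ltrD2l ltrN2.
by exists l => //; rewrite (mulrC e) -ler_pdivrMr.
Qed.

(** The Arzelà-Ascoli argument with an ultrafilter: the pointwise limit inherits the moduli, and
    these make the convergence uniform. *)
Lemma regular_family_compact c f (u : nat -> coding_fun R) :
  (forall n, regular_family c f (u n)) ->
  exists2 h, regular_family c f h & forall (e : R) N, 0 < e ->
    exists2 n, (N <= n)%N & forall t, I t -> `|h t - u n t| <= e.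
Proof.
move=> uf; have [U UU UN] := ultra_nat; have UP : ProperFilter U by exact: ultra_proper.
have lim (t : R) : exists l, forall e, 0 < e -> U [set n | `|l - u n (clamp01 t)| < e].
  have [|l _ Hl] := @ultra_cvg R R nat U `[0, (f 0)%:R]%classic (fun n => u n (clamp01 t)) UU
    (@segment_compact _ _ _).
    move=> n /=; rewrite in_itv/= code_ge0 ?clamp01_itv//=.
    by have [+ _ _ _] := uf n 0; apply; exact: clamp01_itv.
  by exists l => e e0; exact: Hl.
have [h0 h0P] := choice lim; pose h : R -> R := h0.
have hP t e : I t -> 0 < e -> U [set n | `|h t - u n t| < e].
  by move=> It e0; have := h0P t _ e0; rewrite clamp01_id.
have hmod k s t : I s -> I t -> `|s - t| <= (f k).+1%:R^-1 -> `|h s - h t| <= k.+1%:R^-1.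
  move=> Is It st; apply: le_of_forall_add => /= e e0; have e2 : 0 < e / 2 by rewrite divr_gt0.
  have [n [/= ns nt]] := filter_ex (filterI (hP s _ Is e2) (hP t _ It e2)).
  have [_ H _ _] := uf n k; have := H s t Is It st.
  move: ns nt; move: (k.+1%:R^-1) => r; rewrite !(ltr_norml, ler_norml).
  by move=> /andP[? ?] /andP[? ?] /andP[? ?]; apply/andP; split; lra.
have hge0 : {in `[0, 1], forall t, 0 <= h t}.
  move=> t; rewrite in_itv/= => It; apply: le_of_forall_add => /= e e0.
  have [n /= nt] := filter_ex (hP t _ It e0).
  have := code_ge0 (u n) It; move: nt; rewrite ltr_norml => /andP[? ?]; lra.
have hzero t : I t -> (forall n, u n t = 0) -> h t = 0.
  move=> It ut; apply/eqP; rewrite -normr_le0; apply: le_of_forall_add => /= e e0.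
  by have [n /=] := filter_ex (hP t _ It e0); rewrite ut subr0 add0r => /ltW.
have I0 : I (0 : R) by rewrite lexx ler01.
have I1 : I (1 : R) by rewrite lexx ler01.
have hc : {within `[0, 1], continuous h}.
  apply/subspace_continuousP => t; rewrite /= in_itv/= => It.
  apply/cvgrPdist_lt => e e0; have [k ke] := inv_natS_lt e0.
  have r0 : 0 < (f k).+1%:R^-1 :> R by rewrite invr_gt0.
  rewrite near_withinE; apply: filterS (nbhsx_ballx t _ r0) => s ts /=; rewrite in_itv/= => Is.
  by apply: le_lt_trans ke; apply: hmod => //; exact: ltW.
pose g := CodingFun hc hge0 (hzero _ I0 (fun n => coding0 (u n))) (hzero _ I1 (fun n => coding1 (u n))).
have Un (e : R) : 0 < e -> U [set n | forall t, I t -> `|h t - u n t| <= e].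
  move=> e0; set A := [set n | _]; have [//|UA] := in_ultra_setVsetC A UU.
  have bad n : exists t, I t /\ (~ A n -> e < `|h t - u n t|).
    have [An|nA] := pselect (A n); first by exists 0.
    apply: contrapT => nt; apply: nA => t It; rewrite leNgt; apply/negP => et.
    by apply: nt; exists t.
  have [t tP] := choice bad.
  have [|l] := @ultra_cvg R R nat U `[0, 1]%classic t UU (@segment_compact _ _ _).
    by move=> n /=; rewrite in_itv/=; case: (tP n).
  rewrite /= in_itv/= => Il Hl.
  have e4 : 0 < e / 4 by rewrite divr_gt0.
  have [k ke] := inv_natS_lt e4.
  have r0 : 0 < (f k).+1%:R^-1 :> R by rewrite invr_gt0.
  have [n [[/= nA nl] nt]] := filter_ex (filterI (filterI UA (hP l _ Il e4)) (Hl _ r0)).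
  move: nA nl nt => /= nA nl nt; have [It et] := tP n.
  have lt : `|l - t n| <= (f k).+1%:R^-1 by exact: ltW.
  have [_ H _ _] := uf n k; have := H l (t n) Il It lt; have := hmod k l (t n) Il It lt.
  have := et nA; have := ler_normD (h (t n) - h l) (u n l - u n (t n) + (h l - u n l)).
  have := ler_normD (u n l - u n (t n)) (h l - u n l).
  rewrite (_ : h (t n) - h l + _ = h (t n) - u n (t n)); last by lra.
  by rewrite (distrC (h (t n)) (h l)); move: (k.+1%:R^-1) ke nl => r ? ? *; exfalso; lra.
exists g; last first.
  move=> e N e0; have [n [/= nN nU]] := filter_ex (filterI (UN N) (Un e e0)).
  by exists n.
move=> k; split; last first.
- move=> e s t y /andP[e0 eN] s0 st t1 yl.
  (* A list found for [u n] at a slightly larger threshold [e'] serves the limit at [e]: by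
     [usum_perturb] the gap absorbs a uniform error of [(e' - e) / 2]. *)
  have [e' ee' [e'N ye']] : exists2 e', e < e' & e' < (f k).+1%:R^-1 /\
      e' * y < c * (t - s) - k.+1%:R^-1.
    move: (k.+1%:R^-1) yl => r yl; move: ((f k).+1%:R^-1) eN => r' eN.
    have [y0|y0] := leP y 0.
      exists ((e + r') / 2); first by lra.
      split; first by lra.
      apply: le_lt_trans yl; rewrite -subr_ge0 -mulrBl mulr_le0 //; lra.
    pose z := (c * (t - s) - r) / y.
    have ez : e < z by rewrite /z ltr_pdivlMr.
    exists ((e + Num.min r' z) / 2); have ltm : e < Num.min r' z by rewrite lt_min eN.
      lra.
    have : Num.min r' z <= r' by rewrite ge_min lexx.
    have : Num.min r' z <= z by rewrite ge_min lexx orbT.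
    move=> h1 h2; split; first by lra.
    by rewrite -ltr_pdivlMr// -/z; lra.
  have d0 : 0 < (e' - e) / 2 by lra.
  have [n /= nU] := filter_ex (Un _ d0).
  have [_ _ _ H] := uf n k.
  have [|//|//|//|//|l sl yu] := H e' s t y; first by rewrite (lt_trans e0 ee').
  exists l => //; apply: (le_trans yu).
  have -> : e' = e + ((e' - e) / 2) *+ 2 by rewrite mulr2n; lra.
  apply: usum_perturb sl _ => a /andP[sa at_]; rewrite distrC; apply: nU.
  by apply/andP; split; lra.
- move=> e s t l eN s0 st t1 sl; have /andP[e0 _] := eN.
  (* The list is given before [n] is chosen, so the accuracy [d] may depend on its length. *)
  apply: le_of_forall_add => /= z z0; pose d := z / (e * (2 * (size l).+1%:R)).
  have s20 : 0 < 2 * (size l).+1%:R :> R by rewrite mulr_gt0.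
  have d0 : 0 < d by rewrite divr_gt0// mulr_gt0.
  have [n /= nU] := filter_ex (Un _ d0).
  have [_ _ H _] := uf n k; have := H e s t l eN s0 st t1 sl.
  have H1 : usum h e l <= usum (u n) e l + 2 * d * (size l)%:R.
    apply: (usum_close _ sl) => a /andP[sa at_]; apply: nU.
    by apply/andP; split; lra.
  have : e * usum h e l <= e * (usum (u n) e l + 2 * d * (size l)%:R) by rewrite ler_pM2l.
  have : e * (2 * d * (size l)%:R) <= z.
    have -> : z = e * (2 * d * (size l).+1%:R).
      have : d * (e * (2 * (size l).+1%:R)) = z by rewrite /d divfK// gt_eqF// mulr_gt0.
      by move: (_.+1%:R) => q; lra.
    apply: ler_wpM2l; first exact: ltW.
    by apply: ler_wpM2l; rewrite ?ler_nat// mulr_ge0// ltW.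
  by rewrite mulrDr; move: (k.+1%:R^-1) => r; lra.
- exact: hmod.
- move=> t It; apply: le_of_forall_add => /= e e0.
  have [n /= nt] := filter_ex (hP t _ It e0).
  have [H _ _ _] := uf n k; have := H t It.
  by move: nt; rewrite ltr_norml => /andP[? ?]; lra.
Qed.

End RegularFamily.

Section CodingUniform.
Context {R : realType} (h : coding_fun R).
Local Notation I x := (0 <= x <= 1).

Lemma coding_bounded : exists N : nat, forall t, I t -> h t <= N%:R.
Proof.
have [a _ Ha] := EVT_max (@ler01 R) (@coding_continuous _ h).
exists (Num.truncn (h a)).+1 => t It; apply: (le_trans (Ha _ _)); first by rewrite in_itv.
exact/ltW/truncnS_gt.
Qed.

Lemma coding_uniform (e : R) : 0 < e ->
  exists N : nat, forall s t, I s -> I t -> `|s - t| <= N.+1%:R^-1 -> `|h s - h t| <= e.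
Proof.
move=> e0; apply: contrapT => nN.
have H (n : nat) : exists st : R * R, [/\ I st.1, I st.2, `|st.1 - st.2| <= n.+1%:R^-1 &
    e < `|h st.1 - h st.2|].
  apply: contrapT => nst; apply: nN; exists n => s t Is It st; rewrite leNgt; apply/negP => hst.
  by apply: nst; exists (s, t).
have [u uP] := choice H.
have [U UU UN] := ultra_nat; have UP : ProperFilter U by exact: ultra_proper.
have [|l] := @ultra_cvg R R nat U `[0, 1]%classic (fun n => (u n).1) UU (@segment_compact _ _ _).
  by move=> n /=; rewrite in_itv/=; case: (uP n).
rewrite /= in_itv/= => Il Hl; have e2 : 0 < e / 2 by rewrite divr_gt0.
have [r r0 Hr] := coding_cont h Il e2; have r2 : 0 < r / 2 by rewrite divr_gt0.
have [k kr] := inv_natS_lt r2.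
have [n [/= nl nk]] := filter_ex (filterI (Hl _ r2) (UN k)).
have [I1 I2 u12 uh] := uP n; move: nl => /= nl.
have l1 : `|l - (u n).1| < r by apply: (lt_trans nl); lra.
have kn : n.+1%:R^-1 <= k.+1%:R^-1 :> R by rewrite lef_pV2 ?posrE// ler_nat.
have l2 : `|l - (u n).2| < r.
  have := ler_normD (l - (u n).1) ((u n).1 - (u n).2).
  rewrite addrA subrK; move: (n.+1%:R^-1) (k.+1%:R^-1) u12 kn kr => p q ? ? ?.
  by move: nl; rewrite /ball/=; lra.
have := Hr _ I1 l1; have := Hr _ I2 l2.
have := ler_normD (h (u n).1 - h l) (h l - h (u n).2).
by rewrite addrA subrK (distrC (h (u n).1) (h l)); lra.
Qed.

End CodingUniform.

(** * Regularity read off from countably many times *)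

Section GridConditions.
Context {R : realType}.
Local Notation I x := (0 <= x <= 1).

Definition grid_time (n : nat) : R :=
  if (unpickle n : option (nat * nat)) is Some (i, m) then Num.min 1 (i%:R / m.+1%:R) else 0.

Lemma grid_time_itv n : I (grid_time n).
Proof.
rewrite /grid_time; case: unpickle => [[i m]|]; last by rewrite lexx ler01.
by rewrite le_min ler01 divr_ge0//= ge_min lexx.
Qed.

Lemma grid_timeE i m : (i <= m.+1)%N -> grid_time (pickle (i, m)) = i%:R / m.+1%:R.
Proof.
by move=> im; rewrite /grid_time pickleK min_r// ler_pdivrMr// mul1r ler_nat.
Qed.

(** Meshes have successors as denominators; the predecessor makes [(refine k m).+1] the product of
    the two denominators. *)
Definition refine (k m : nat) : nat := (k.+1 * m.+1).-1.
Arguments refine : simpl never.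

Lemma refineE k m : (refine k m).+1 = (k.+1 * m.+1)%N.
Proof. by rewrite prednK// muln_gt0. Qed.

Definition sampled_usum (x : nat -> R) (k m : nat) (e : R) (l : seq (nat * nat)) : R :=
  usum (fun a : nat => x (pickle (a, (refine k m)))) e l.

(* A countable form of [regular_cond] for the values of a path at the times      *)
(* [grid_time], so that it cuts out a measurable set of sequences.               *)
Definition grid_cond (c : R) (k N : nat) (x : nat -> R) : Prop :=
  [/\ forall n, x n <= N%:R,
      forall n n', `|grid_time n - grid_time n'| <= N.+1%:R^-1 -> `|x n - x n'| <= k.+1%:R^-1,
      forall n i j m l, (N <= n)%N -> (i <= j)%N -> (j <= k.+1)%N ->
        adm (i * m.+1)%N (j * m.+1)%N l ->
        n.+1%:R^-1 * sampled_usum x k m n.+1%:R^-1 l <= (c * (j%:R - i%:R) + 1) / k.+1%:R &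
      forall n i j, (N <= n)%N -> (i <= j)%N -> (j <= k.+1)%N ->
        exists m l, adm (i * m.+1)%N (j * m.+1)%N l /\
          (c * (j%:R - i%:R) - 1) / k.+1%:R <= n.+1%:R^-1 * sampled_usum x k m n.+1%:R^-1 l].

Lemma grid_cond_le c k N N' x : (N <= N')%N -> grid_cond c k N x -> grid_cond c k N' x.
Proof.
move=> NN [H1 H2 H3 H4]; split.
- by move=> n; apply: le_trans (H1 n) _; rewrite ler_nat.
- move=> n n' nn; apply: H2; apply: (le_trans nn).
  by rewrite lef_pV2 ?posrE// ler_nat.
- by move=> n i j m l N'n; apply: H3; exact: leq_trans N'n.
- by move=> n i j N'n; apply: H4; exact: leq_trans N'n.
Qed.

Let gpt (m : nat) (a : nat) : R := a%:R / m.+1%:R.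

Let gpt_homo m a b : (a <= b)%N -> gpt m a <= gpt m b.
Proof. by move=> ab; rewrite ler_pM2r ?invr_gt0// ler_nat. Qed.

Let gpt_mul k m i : gpt (refine k m) (i * m.+1) = gpt k i.
Proof.
by rewrite /gpt refineE !natrM invfM mulrACA divff ?pnatr_eq0// mulr1.
Qed.

Lemma sampled_usumE (h : coding_fun R) k m i j e l : (j <= k.+1)%N -> adm (i * m.+1)%N (j * m.+1)%N l ->
  sampled_usum (h \o grid_time) k m e l = usum h e (map (pair_map (gpt (refine k m))) l).
Proof.
move=> jk al; rewrite usum_map /sampled_usum; apply: eq_usum al _ => a /andP[_ aj] /=.
rewrite grid_timeE// refineE; rewrite leEnat in aj; apply: (leq_trans aj).
by rewrite leq_mul2r jk orbT.
Qed.

Let gpt_adm k m i j l : adm (i * m.+1)%N (j * m.+1)%N l ->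
  adm (gpt k i) (gpt k j) (map (pair_map (gpt (refine k m))) l).
Proof.
rewrite -!(gpt_mul k m); apply: adm_map => a b _ _; exact: gpt_homo.
Qed.

Let rnd (m : nat) (u : R) : nat := Num.truncn (u * m.+1%:R).

Let rnd_itv m u : 0 <= u -> gpt m (rnd m u) <= u < gpt m (rnd m u) + m.+1%:R^-1.
Proof.
move=> u0; have := @truncn_itv R (u * m.+1%:R); rewrite mulr_ge0// => /(_ isT)/andP[a b].
rewrite /gpt ler_pdivrMr// a /= -[X in _ + X]mul1r -mulrDl ltr_pdivlMr//.
by move: b; rewrite -(natr1 (Num.truncn _)).
Qed.

Let rnd_le m u : u <= 1 -> (rnd m u <= m.+1)%N.
Proof.
move=> u1; rewrite -[leqRHS](@natrK R); apply: le_truncn.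
by rewrite -[leRHS]mul1r ler_pM2r.
Qed.

Lemma grid_time_dense u (e : R) : I u -> 0 < e -> exists n, `|u - grid_time n| < e.
Proof.
move=> /andP[u0 u1] e0; have [m me] := inv_natS_lt e0; exists (pickle (rnd m u, m)).
rewrite grid_timeE ?rnd_le// -/(gpt m _); have /andP[h1 h2] := rnd_itv m u0.
by rewrite ger0_norm ?subr_ge0//; move: (m.+1%:R^-1) h2 me => r; lra.
Qed.

Let gpt_rnd (h : coding_fun R) (e : R) : 0 < e ->
  exists M, forall m u, (M <= m)%N -> I u -> `|h u - h (gpt m (rnd m u))| <= e.
Proof.
move=> e0; have [M HM] := coding_uniform h e0; exists M => m u Mm Iu.
have /andP[u0 u1] := Iu; have /andP[ua ub] := rnd_itv m u0.
have Mm' : m.+1%:R^-1 <= M.+1%:R^-1 :> R by rewrite lef_pV2 ?posrE// ler_nat.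
apply: HM => //.
  by rewrite divr_ge0//=; exact: le_trans u1.
rewrite ger0_norm ?subr_ge0//; move: ub Mm'.
by move: (m.+1%:R^-1) (M.+1%:R^-1) => p q; lra.
Qed.

(** The mesh refines the one that carries the end points, which rounding down therefore leaves in
    place. *)
Let usum_round (h : coding_fun R) k i j e l d : (i <= j)%N -> (j <= k.+1)%N -> 0 < d ->
  adm (gpt k i) (gpt k j) l ->
  exists m l', adm (i * m.+1)%N (j * m.+1)%N l' /\
    usum h e l <= sampled_usum (h \o grid_time) k m e l' + d.
Proof.
move=> ij jk d0 al; have s0 : 0 < 2 * (size l).+1%:R :> R by rewrite mulr_gt0.
have d'0 : 0 < d / (2 * (size l).+1%:R) by rewrite divr_gt0.
have [M HM] := gpt_rnd h d'0.
have rE x : rnd (refine k M) (gpt k x) = (x * M.+1)%N.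
  by rewrite /rnd -(gpt_mul k M) /gpt mulfVK ?pnatr_eq0// natrK.
have al' : adm (i * M.+1)%N (j * M.+1)%N (map (pair_map (rnd (refine k M))) l).
  rewrite -!rE; apply: adm_map al => a b _ _ ab; rewrite leEnat; apply: le_truncn.
  by rewrite ler_wpM2r.
exists M, (map (pair_map (rnd (refine k M))) l); split => //.
rewrite (sampled_usumE _ _ jk al') !usum_map.
have g0 x : 0 <= gpt k x by rewrite divr_ge0.
have gk : gpt k j <= 1 by rewrite ler_pdivrMr// mul1r ler_nat.
apply: le_trans (_ : _ <= usum (h \o gpt (refine k M) \o rnd (refine k M)) e l +
   2 * (d / (2 * (size l).+1%:R)) * (size l)%:R) _.
  apply: usum_close al _ => a /andP[ga aj]; apply: HM.
    by rewrite -ltnS refineE leq_pmull.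
  by rewrite (le_trans (g0 i) ga) (le_trans aj).
rewrite lerD2l -{2}[d](@divfK _ (2 * (size l).+1%:R)) ?gt_eqF// mulrAC mulrC.
by rewrite ler_pM2l// ler_pM2l// ler_nat.
Qed.

Lemma variation_regular_grid (h : coding_fun R) c : variation_regular h c ->
  forall k, exists N, grid_cond c k N (h \o grid_time).
Proof.
move=> hc k; have k0 : 0 < k.+1%:R^-1 / 2 :> R by rewrite divr_gt0.
have [N1 H1] := coding_bounded h.
have k1 : 0 < k.+1%:R^-1 :> R by rewrite invr_gt0.
have [N2 H2] := coding_uniform h k1.
have [e0 e00 H3] := hc _ k0; have [N3 N3e] := inv_natS_lt e00.
exists (maxn N1 (maxn N2 N3)).
have reg n i j : (maxn N1 (maxn N2 N3) <= n)%N -> (i <= j)%N -> (j <= k.+1)%N ->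
    regular_at h c n.+1%:R^-1 (k.+1%:R^-1 / 2) (gpt k i) (gpt k j).
  rewrite !geq_max => /and3P[_ _ n3] ij jk; apply: H3.
  - rewrite invr_gt0 ltr0n /=; apply: le_lt_trans N3e.
    by rewrite lef_pV2 ?posrE// ler_nat.
  - by rewrite divr_ge0.
  - exact: gpt_homo.
  - by rewrite ler_pdivrMr// mul1r ler_nat.
split.
- move=> n; apply: le_trans (H1 _ (grid_time_itv n)) _.
  by rewrite ler_nat leq_max leqnn.
- move=> n n' nn; apply: H2; [exact: grid_time_itv|exact: grid_time_itv|apply: (le_trans nn)].
  by rewrite lef_pV2 ?posrE// ler_nat ltnS !leq_max leqnn orbT.
- move=> n i j m l nN ij jk al; rewrite (sampled_usumE _ _ jk al).
  have [H _] := reg n i j nN ij jk; apply: le_trans (H _ (gpt_adm k al)) _.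
  rewrite /gpt -mulrBl mulrA mulrDl mul1r lerD2l.
  by move: k0; move: (k.+1%:R^-1) => r; lra.
- move=> n i j nN ij jk; have [_ [l al Hl]] := reg n i j nN ij jk.
  have d0 : 0 < n.+1%:R * (k.+1%:R^-1 / 2) :> R by rewrite mulr_gt0.
  have [m [l' [al' ll']]] := usum_round h n.+1%:R^-1 ij jk d0 al.
  exists m, l'; split => //; move: ll'.
  rewrite -(ler_pM2l (x := n.+1%:R^-1)) ?invr_gt0// mulrDr mulKf ?pnatr_eq0//.
  move: Hl; rewrite /gpt -mulrBl mulrA mulrDl mulNr mul1r.
  have arith (z r u v : R) : z - r / 2 <= u -> u <= v + r / 2 -> z - r <= v by lra.
  exact: arith.
Qed.

Let grid_upper (h : coding_fun R) c k n i j l : (i <= j)%N -> (j <= k.+1)%N ->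
  (forall m l, adm (i * m.+1)%N (j * m.+1)%N l ->
     n.+1%:R^-1 * sampled_usum (h \o grid_time) k m n.+1%:R^-1 l <= c) ->
  adm (gpt k i) (gpt k j) l -> n.+1%:R^-1 * usum h n.+1%:R^-1 l <= c.
Proof.
move=> ij jk H al; apply: le_of_forall_add => /= e e0.
have d0 : 0 < n.+1%:R * e by rewrite mulr_gt0.
have [m [l' [al' ll']]] := usum_round h n.+1%:R^-1 ij jk d0 al.
have := H m l' al'; move: ll'.
rewrite -(ler_pM2l (x := n.+1%:R^-1)) ?invr_gt0// mulrDr mulKf ?pnatr_eq0//.
by move=> h1 h2; apply: (le_trans h1); rewrite lerD2r.
Qed.

(** By monotonicity, [[s, t]] is enlarged or shrunk to grid points and [e] is squeezed between
    consecutive inverses of integers. In [5 * c + 2], a part [2 * c + 1] pays for the end points and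
    the given error, and [3 * c + 1] for the change of threshold. *)
Lemma regular_upgrade (h : R -> R) c K N eta : 0 <= c -> (K <= N)%N ->
  (5 * c + 2) * K.+1%:R^-1 <= eta ->
  (forall n i j, (N <= n)%N -> (i <= j)%N -> (j <= K.+1)%N ->
    regular_at h c n.+1%:R^-1 K.+1%:R^-1 (i%:R / K.+1%:R) (j%:R / K.+1%:R)) ->
  forall e s t, 0 < e < N.+1%:R^-1 -> 0 <= s -> s <= t -> t <= 1 -> regular_at h c e eta s t.
Proof.
move=> c0 NK KQ H e s t eN s0 st t1.
have K0 : 0 < K.+1%:R^-1 :> R by rewrite invr_gt0.
have [n' [Nn ne en']] : exists n, [/\ (N < n)%N, n.+1%:R^-1 <= e & e <= n%:R^-1].
  have /andP[e0 e1] := eN; exists (Num.truncn e^-1).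
  have Ne : N.+1%:R <= e^-1 by rewrite -[leLHS]invrK lef_pV2 ?posrE ?invr_gt0// ltW.
  have ei : 0 <= e^-1 by rewrite invr_ge0 ltW.
  have /andP[a b] := truncn_itv ei.
  have Nn : (N < Num.truncn e^-1)%N by rewrite -[(N < _)%N]/(N.+1 <= _)%N -(@natrK R N.+1) le_truncn.
  split => //.
    by rewrite -[leRHS]invrK lef_pV2 ?posrE ?invr_gt0// ltW.
  by rewrite -[leLHS]invrK lef_pV2 ?posrE ?invr_gt0// ltr0n (leq_trans _ Nn).
case: n' Nn ne en' => [//|n] Nn ne en'.
have /andP[e0 _] := eN.
have nV : n.+1%:R^-1 <= K.+1%:R^-1 :> R by rewrite lef_pV2 ?posrE// ler_nat ltnS; exact: leq_trans NK _.
have cts : c * (t - s) <= c by rewrite -[leRHS]mulr1; apply: ler_wpM2l => //; lra.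
have /andP[is_ si] := rnd_itv K s0.
have /andP[jt tj] := rnd_itv K (le_trans s0 st).
split.
- move=> l sl; pose i := rnd K s; pose j := minn K.+1 (rnd K t).+1.
  have ij : (i <= j)%N.
    rewrite leq_min rnd_le ?(le_trans st)// leqW//; apply: le_truncn.
    by rewrite ler_wpM2r.
  have jk : (j <= K.+1)%N by rewrite geq_minl.
  have tj' : t <= gpt K j.
    rewrite /j /minn; case: ifP => _; first by rewrite /gpt divff ?pnatr_eq0.
    by rewrite /gpt -natr1 mulrDl mul1r ltW.
  have jt' : gpt K j <= t + K.+1%:R^-1.
    apply: (@le_trans _ _ (gpt K (rnd K t).+1)); first by apply: gpt_homo; rewrite geq_minr.
    by rewrite /gpt -natr1 mulrDl mul1r lerD2r.
  have al : adm (gpt K i) (gpt K j) l by apply: adm_widen sl.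
  have [{}H _] := H n.+1 i j (ltnW Nn) ij jk.
  have := H l al; set B := _ + _ => HB.
  have B1 : B <= c * (t - s) + (2 * c + 1) * K.+1%:R^-1.
    have : c * (gpt K j - gpt K i) <= c * (t - s + 2 * K.+1%:R^-1).
      apply: ler_wpM2l => //; move: si; rewrite -/i; move: (K.+1%:R^-1) jt' => r ? ?; lra.
    by rewrite /B mulrDr mulrDl -!/(gpt _ _); move: (K.+1%:R^-1) => r; lra.
  have K1 : K.+1%:R^-1 <= 1 :> R by rewrite invf_le1// ler1n.
  have B0 : 0 <= B.
    by rewrite addr_ge0 ?(ltW K0)// mulr_ge0// subr_ge0 gpt_homo.
  have B3 : B <= 3 * c + 1.
    apply: (le_trans B1); have : (2 * c + 1) * K.+1%:R^-1 <= (2 * c + 1) * 1.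
      by apply: ler_wpM2l => //; lra.
    by move: (_ / K.+1%:R) => z; lra.
  (* The bound is available at the smaller threshold [n.+2%:R^-1]; since [e <= n.+1%:R^-1], using it
     costs a factor [(n + 2) / (n + 1)]. *)
  have ub : e * usum h e l <= B * (1 + n.+1%:R^-1).
    apply: (@le_trans _ _ (e * usum h n.+2%:R^-1 l)).
      by apply: ler_wpM2l; [exact: ltW|exact: usum_eps_le].
    have u1 : usum h n.+2%:R^-1 l <= n.+2%:R * B.
      by rewrite -ler_pdivrMl.
    apply: (@le_trans _ _ (e * (n.+2%:R * B))); first by apply: ler_wpM2l; [exact: ltW|].
    rewrite mulrA mulrC; apply: ler_wpM2l => //.
    apply: (@le_trans _ _ (n.+1%:R^-1 * n.+2%:R)); first by rewrite ler_pM2r.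
    by rewrite -(natr1 n.+1) mulrDr mulVf ?pnatr_eq0// mulr1.
  apply: (le_trans ub); rewrite mulrDr mulr1.
  have : B * n.+1%:R^-1 <= (3 * c + 1) * K.+1%:R^-1.
    by apply: ler_pM => //; rewrite invr_ge0.
  by move: KQ B1; move: (K.+1%:R^-1) (B * _) => p q; lra.
- set Q := c * (t - s) - eta.
  have [Q0|Q0] := leP Q 0; first by exists [::]; rewrite ?usum_nil ?mulr0.
  pose i := (rnd K s).+1; pose j := rnd K t.
  have si' : s <= gpt K i by rewrite /gpt /i -(natr1 (rnd K s)) mulrDl mul1r ltW.
  have is' : gpt K i <= s + K.+1%:R^-1 by rewrite /gpt /i -(natr1 (rnd K s)) mulrDl mul1r lerD2r.
  have jk : (j <= K.+1)%N by exact: rnd_le.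
  have cK : c * (t - s) <= c * (gpt K j - gpt K i) + 2 * c * K.+1%:R^-1.
    have : c * (t - s) <= c * (gpt K j - gpt K i + 2 * K.+1%:R^-1).
      apply: ler_wpM2l => //; rewrite -/j in tj; move: (K.+1%:R^-1) is' tj => r; lra.
    by rewrite mulrDr; move: (K.+1%:R^-1) => r; lra.
  have ij : (i <= j)%N.
    rewrite leqNgt; apply/negP => /ltnW ji.
    have : c * (gpt K j - gpt K i) <= 0 by rewrite mulr_ge0_le0// subr_le0 gpt_homo.
    have : c * K.+1%:R^-1 >= 0 by rewrite mulr_ge0// ltW.
    by move: Q0 KQ K0 cK; rewrite /Q; move: (K.+1%:R^-1) => p; lra.
  have [_ [L aL HL]] := H n i j Nn ij jk.
  exists L; first by apply: adm_widen aL.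
  set B := _ - _ in HL.
  have BQ : Q + c * n.+1%:R^-1 <= B.
    have : c * n.+1%:R^-1 <= c * K.+1%:R^-1 by apply: ler_wpM2l.
    have : c * K.+1%:R^-1 >= 0 by rewrite mulr_ge0// ltW.
    by move: KQ K0 cK; rewrite /B /Q -!/(gpt _ _); move: (K.+1%:R^-1) (c * n.+1%:R^-1) => p r; lra.
  rewrite mulrC -ler_pdivrMr//.
  apply: (@le_trans _ _ (usum h n.+1%:R^-1 L)); last exact: usum_eps_le.
  apply: (@le_trans _ _ (n.+1%:R * B)); last by rewrite -ler_pdivlMl.
  apply: (@le_trans _ _ (n.+2%:R * Q)).
    by rewrite mulrC ler_pM2r// -[leRHS]invrK lef_pV2 ?posrE ?invr_gt0.
  apply: (@le_trans _ _ (n.+1%:R * (Q + c * n.+1%:R^-1))); last by rewrite ler_pM2l.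
  have -> : n.+1%:R * (Q + c * n.+1%:R^-1) = n.+1%:R * Q + c.
    by rewrite (mulrDr _ Q); congr (_ + _); rewrite mulrC divfK ?pnatr_eq0.
  have -> : n.+2%:R * Q = n.+1%:R * Q + Q by rewrite -(natr1 n.+1) mulrDl mul1r.
  have eta0 : 0 <= eta.
    apply: le_trans KQ; apply: mulr_ge0; last exact: ltW.
    by lra.
  by rewrite lerD2l /Q; lra.
Qed.

(** The new constants depend on [c] and [f] but not on the path, as a compact family requires. *)
Lemma grid_regular c (f : nat -> nat) : 0 <= c -> exists f', forall h : coding_fun R,
  (forall k, grid_cond c k (f k) (h \o grid_time)) -> regular_family c f' h.
Proof.
move=> c0; suff H k : exists N, forall h : coding_fun R,
    (forall k, grid_cond c k (f k) (h \o grid_time)) -> regular_cond c k N h.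
  by have [f' f'P] := choice H; exists f' => h hf k; exact: f'P.
have q0 : 0 < (5 * c + 2)^-1 * k.+1%:R^-1 by rewrite mulr_gt0 ?invr_gt0//; lra.
have [K Kq] := inv_natS_lt q0.
have {Kq q0}KQ : (5 * c + 2) * K.+1%:R^-1 <= k.+1%:R^-1.
  by rewrite -ler_pdivlMl ?ltW//; lra.
(* [K] and [f K] feed [regular_upgrade]; [2 * (f k).+1] halves the modulus of continuity, the other
   half being spent on rounding times to the grid. *)
pose N := maxn K (maxn (f K) (2 * (f k).+1)); exists N => h hf.
have NK : (K <= N)%N by rewrite leq_max leqnn.
have NfK : (f K <= N)%N by rewrite !leq_max leqnn !orbT.
have Nfk : (2 * (f k).+1 <= N)%N by rewrite !leq_max leqnn !orbT.
have K0 : 0 < K.+1%:R^-1 :> R by rewrite invr_gt0.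
have reg : forall e s t, 0 < e < N.+1%:R^-1 -> 0 <= s -> s <= t -> t <= 1 ->
    regular_at h c e k.+1%:R^-1 s t.
  apply: regular_upgrade NK KQ _ => // n i j Nn ij jk; have [_ _ H3 H4] := hf K.
  have NfKn := leq_trans NfK Nn; split.
    move=> l al; have := grid_upper ij jk (fun m l al => H3 n i j m l NfKn ij jk al) al.
    by rewrite mulrDl mul1r -mulrBl -mulrA.
  have [m [l [al Hl]]] := H4 n i j NfKn ij jk.
  exists (map (pair_map (gpt (refine K m))) l); first exact: gpt_adm.
  rewrite (sampled_usumE _ _ jk al) in Hl; apply: le_trans Hl.
  by rewrite mulrDl mulNr mul1r -mulrBl -mulrA.
split.
- move=> t It; apply: le_of_forall_add => /= e e0; have [M HM] := gpt_rnd h e0.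
  have := HM M t (leqnn _) It; have /andP[_ t1] := It.
  have [H _ _ _] := hf k; have := H (pickle (rnd M t, M)); rewrite /= grid_timeE ?rnd_le//.
  have fN : (f k)%:R <= N%:R :> R.
    by rewrite ler_nat (leq_trans _ Nfk)// mul2n -addnn (leq_trans (leqnSn _))// leq_addr.
  move=> h1 h2; apply: (@le_trans _ _ ((f k)%:R + e)); last by rewrite lerD2r.
  by move: h1 h2; rewrite -/(gpt M _) ler_norml; move: ((f k)%:R : R) => q ? /andP[_ ?]; lra.
- move=> s t Is It st; apply: le_of_forall_add => /= e e0.
  have e2 : 0 < e / 2 by rewrite divr_gt0.
  have [M0 HM] := gpt_rnd h e2; pose M := maxn M0 N.
  have := HM M s (leq_maxl _ _) Is; have := HM M t (leq_maxl _ _) It.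
  have /andP[s0 s1] := Is; have /andP[t0 t1] := It.
  have [_ H _ _] := hf k; have := H (pickle (rnd M s, M)) (pickle (rnd M t, M)).
  rewrite /= !grid_timeE ?rnd_le// -!/(gpt M _) => H'.
  have {}H' : `|h (gpt M (rnd M s)) - h (gpt M (rnd M t))| <= k.+1%:R^-1.
    apply: H'; have := rnd_itv M s0; have := rnd_itv M t0.
    have MN : M.+1%:R^-1 <= N.+1%:R^-1 :> R by rewrite lef_pV2 ?posrE// ler_nat ltnS leq_maxr.
    have Nk : N.+1%:R^-1 <= (f k).+1%:R^-1 / 2 :> R.
      rewrite -invfM lef_pV2 ?posrE ?mulr_gt0// mulrC -natrM ler_nat; exact: leqW.
    move: st; rewrite !ler_norml.
    move: (gpt M (rnd M s)) (gpt M (rnd M t)) => a b.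
    move: (M.+1%:R^-1) (N.+1%:R^-1) ((f k).+1%:R^-1) MN Nk => x y z ? ?.
    by move=> /andP[? ?] /andP[? ?] /andP[? ?]; apply/andP; split; lra.
  move: H'; rewrite !ler_norml; move: (k.+1%:R^-1) => r.
  by move=> /andP[? ?] /andP[? ?] /andP[? ?]; apply/andP; split; lra.
- by move=> e s t l eN s0 st t1; have [+ _] := reg e s t eN s0 st t1; apply.
- move=> e s t y eN s0 st t1 yQ; have [_ [l al Hl]] := reg e s t eN s0 st t1.
  exists l => //; have /andP[e0 _] := eN.
  by rewrite -(ler_pM2l e0); apply: ltW; exact: lt_le_trans Hl.
Qed.

End GridConditions.

(** * The normalised excursion *)

Section RegularAt.
Context {R : realType}.
Implicit Types b : R -> R.

Lemma regular_at_le b c e eta eta' s t : eta <= eta' ->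
  regular_at b c e eta s t -> regular_at b c e eta' s t.
Proof.
move=> ee [H1 [l sl H2]]; split=> [l' sl'|].
  by apply: (le_trans (H1 _ sl')); rewrite lerD2l.
by exists l => //; apply: le_trans H2; rewrite lerB.
Qed.

Lemma regular_at_eq b b' c e eta s t : (forall u, s <= u <= t -> b u = b' u) ->
  regular_at b c e eta s t -> regular_at b' c e eta s t.
Proof.
move=> bb [H1 [l sl H2]]; split=> [l' sl'|].
  by rewrite -(eq_usum e sl' bb); exact: H1.
by exists l => //; rewrite -(eq_usum e sl bb).
Qed.

Lemma regular_at_refl b c e eta s : 0 <= e -> 0 <= eta -> regular_at b c e eta s s.
Proof.
move=> e0 eta0; rewrite /regular_at subrr mulr0 add0r sub0r; split=> [l sl|].
  have -> : usum b e l = usum (fun=> 0) e l.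
    by rewrite (@eq_usum _ _ _ b (fun=> b s) e s s)// => [|a as_];
      [rewrite -[RHS](usumDc (b s)); congr (usum _ _ _); apply/funext => ?; rewrite add0r
      |rewrite (le_anti as_)].
  apply: le_trans eta0; rewrite mulr_ge0_le0//; apply: sumr_le0 => p _; lra.
by exists [::]; rewrite //= usum_nil mulr0 oppr_le0.
Qed.

Lemma regular_at_opp b c e eta C s t : 0 <= e ->
  (forall u, s <= u <= t -> `|b u| <= C) ->
  regular_at b c e eta s t -> regular_at (fun u => - b u) c e (eta + e * (C *+ 2)) s t.
Proof.
move=> e0 bC [H1 [l sl H2]]; split=> [l' sl'|].
  have [l1 sl1 ll] := usum_opp e0 bC sl'.
  apply: (@le_trans _ _ (e * (usum b e l1 + C *+ 2))); first exact: ler_wpM2l.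
  by rewrite mulrDr addrA lerD2r; exact: H1.
have bC' u : s <= u <= t -> `|- b u| <= C by rewrite normrN; exact: bC.
have [l1 sl1 ll] := usum_opp e0 bC' sl.
exists l1 => //; rewrite opprD addrA lerBlDr; apply: (le_trans H2).
rewrite -mulrDr; apply: ler_wpM2l => //; apply: le_trans ll.
by rewrite (_ : (fun x => - - b x) = b)//; apply/funext => x; rewrite opprK.
Qed.

(** Stretching time by [D] and space by [r] multiplies the rate by [D * r ^+ 2]; Brownian scaling is
    the case where this factor is 1. *)
Lemma regular_at_affine b c e eta s t (g D r : R) : 0 < D -> 0 < r ->
  regular_at b c e eta (g + s * D) (g + t * D) <->
  regular_at (fun u => r * b (g + u * D)) (c * D * r ^+ 2) (r * e) (eta * r ^+ 2) s t.
Proof.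
move=> D0 r0; pose phi u := g + u * D; pose psi v := (v - g) / D.
have psiK : cancel psi phi by move=> v; rewrite /phi /psi divfK ?gt_eqF//; lra.
have phiK : cancel phi psi by move=> u; rewrite /phi /psi addrAC subrr add0r mulfK ?gt_eqF.
have r20 : 0 < r ^+ 2 by rewrite exprn_gt0.
have U l : r * e * usum (fun u => r * b (g + u * D)) (r * e) l =
    e * usum b e (map (pair_map phi) l) * r ^+ 2.
  by rewrite usumZ usum_map expr2 /phi /comp; lra.
have fw l : adm s t l -> adm (phi s) (phi t) (map (pair_map phi) l).
  by apply: adm_map => x y _ _ xy; rewrite lerD2l ler_pM2r.
have bw l : adm (phi s) (phi t) l -> adm s t (map (pair_map psi) l).
  rewrite -{2}(phiK s) -{2}(phiK t); apply: adm_map => x y _ _ xy.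
  by rewrite ler_pM2r ?invr_gt0// lerB.
have mapK l : map (pair_map phi) (map (pair_map psi) l) = l.
  rewrite -map_comp -[RHS]map_id; apply: eq_map => -[x y].
  by rewrite /= /pair_map /= !psiK.
have E1 : c * D * r ^+ 2 * (t - s) + eta * r ^+ 2 = (c * (phi t - phi s) + eta) * r ^+ 2.
  by rewrite /phi; lra.
have E2 : c * D * r ^+ 2 * (t - s) - eta * r ^+ 2 = (c * (phi t - phi s) - eta) * r ^+ 2.
  by rewrite /phi; lra.
split=> -[H1 [l sl H2]]; split.
- by move=> l' /fw /H1; rewrite U E1 ler_pM2r.
- by exists (map (pair_map psi) l); [exact: bw|rewrite U mapK E2 ler_pM2r].
- by move=> l' /bw /H1; rewrite U E1 mapK ler_pM2r.
- by exists (map (pair_map phi) l); [exact: fw|move: H2; rewrite U E2 ler_pM2r].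
Qed.

End RegularAt.

Lemma halfline_continuity (R : realType) (b : R -> R) s e :
  {within `[0, +oo[, continuous b} -> 0 <= s -> 0 < e ->
  exists2 r, 0 < r & forall t, 0 <= t -> `|s - t| < r -> `|b s - b t| < e.
Proof.
move=> /subspace_continuousP/(_ s) + s0 e0; rewrite /= in_itv/= s0.
move=> /(_ isT)/cvgrPdist_lt/(_ _ e0); rewrite near_withinE => -[r /= r0 Hr].
by exists r => // t t0 st; apply: Hr => //=; rewrite in_itv/= t0.
Qed.

Section PathExcursion.
Context {R : realType} (b : R -> R).
Hypothesis b0 : b 0 = 0.
Hypothesis cb : {within `[0, +oo[, continuous b}.

Definition last_zero := sup [set s | 0 <= s <= 1 /\ b s = 0].
Definition next_zero := inf [set s | 1 <= s /\ b s = 0].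
Local Notation g := last_zero.
Local Notation d := next_zero.

Let zero_limit s : 0 <= s -> (forall r, 0 < r -> exists t, [/\ 0 <= t, `|s - t| < r & b t = 0]) ->
  b s = 0.
Proof.
move=> s0 H; apply/eqP; rewrite -normr_le0 leNgt; apply/negP => bs.
have [r r0 Hr] := halfline_continuity cb s0 bs; have [t [t0 st bt]] := H r r0.
by have := Hr t t0 st; rewrite bt subr0 ltxx.
Qed.

Lemma last_zeroP : [/\ 0 <= g <= 1, b g = 0 & forall s, 0 <= s <= 1 -> b s = 0 -> s <= g].
Proof.
set S := [set s | 0 <= s <= 1 /\ b s = 0].
have S0 : S 0 by split => //; rewrite lexx ler01.
have Sub : has_ubound S by exists 1 => s [/andP[]].
have supS : has_sup S by split => //; exists 0.
have gub s : S s -> s <= g by move=> Ss; apply: ub_le_sup.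
have g0 : 0 <= g by exact: gub.
have g1 : g <= 1 by apply: ge_sup => [|s [/andP[]]//]; exists 0.
split; first by rewrite g0.
  apply: zero_limit => // r r0; have [s Ss gs] := sup_adherent r0 supS.
  have sg := gub _ Ss; case: Ss => /andP[s0 s1] bs; exists s; split => //.
  by rewrite ger0_norm ?subr_ge0//; rewrite -/last_zero in gs; lra.
by move=> s s01 bs; apply: gub.
Qed.

Lemma next_zeroP : (exists s, 1 <= s /\ b s = 0) ->
  [/\ 1 <= d, b d = 0 & forall s, 1 <= s -> b s = 0 -> d <= s].
Proof.
set S := [set s | 1 <= s /\ b s = 0] => S0.
have Slb : has_lbound S by exists 1 => s [].
have infS : has_inf S by [].
have dlb s : S s -> d <= s by move=> Ss; apply: ge_inf.
have d1 : 1 <= d by apply: lb_le_inf => // s [].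
split => //.
  apply: zero_limit => [|r r0]; first by lra.
  have [s Ss ds] := inf_adherent r0 infS.
  have sd := dlb _ Ss; case: Ss => s1 bs; exists s; split => //; first by lra.
  by rewrite ler0_norm ?subr_le0//; rewrite -/next_zero in ds; lra.
by move=> s s1 bs; apply: dlb.
Qed.

Lemma next_zero_none : ~ (exists s, 1 <= s /\ b s = 0) -> d = 0.
Proof.
move=> nS; rewrite /next_zero (_ : [set s | _] = set0) ?inf0//.
by apply/seteqP; split => // s Ss; apply: nS; exists s.
Qed.

(** The square root of a nonpositive number is 0, and so is the inverse of 0. *)
Lemma excursion_degenerate : d <= g -> forall t, normalised_excursion b t = 0.
Proof.
move=> dg t; rewrite /normalised_excursion -/last_zero -/next_zero.
by rewrite ler0_sqrtr ?subr_le0// invr0 mulr0.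
Qed.

Lemma excursion_sign : g < d -> b d = 0 /\
  ((forall s, g <= s <= d -> `|b s| = b s) \/ (forall s, g <= s <= d -> `|b s| = - b s)).
Proof.
move=> gd; have [/andP[g0 g1] bg glast] := last_zeroP.
have [/next_zeroP[d1 bd dnext]|/next_zero_none d0] := pselect (exists s, 1 <= s /\ b s = 0);
  last by lra.
split => //.
have nz s : g < s < d -> b s <> 0.
  move=> /andP[gs sd] bs; have [s1|s1] := leP s 1.
    by have := glast s; rewrite s1 bs; move=> /(_ _ erefl); lra.
  by have := dnext s (ltW s1) bs; lra.
have sgn s t : g < s < d -> g < t < d -> s <= t -> b s * b t < 0 -> False.
  move=> /andP[gs sd] /andP[gt td] st bst.
  have cst : {within `[s, t], continuous b}.
    apply: continuous_subspaceW cb => u /=; rewrite !in_itv/= andbT => /andP[su _]; lra.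
  have /(IVT st cst)[c cst0 bc] : Num.min (b s) (b t) <= 0 <= Num.max (b s) (b t).
    rewrite ge_min le_max; have [s0|s0] := leP (b s) 0; have [t0|t0] := leP (b t) 0 => //=.
    - by have := mulr_le0 s0 t0; lra.
    - by rewrite (ltW t0) orbT.
    - by rewrite (ltW s0).
    - by have := mulr_gt0 s0 t0; lra.
  move: cst0; rewrite in_itv/= => /andP[sc ct]; apply: (nz c) => //.
  by apply/andP; split; lra.
have {}sgn s t : g < s < d -> g < t < d -> 0 < b s * b t.
  move=> gs gt; have bs := nz s gs; have bt := nz t gt.
  rewrite lt_neqAle eq_sym mulf_neq0/=; try exact/eqP.
  rewrite leNgt; apply/negP => bst; have [st|/ltW ts] := leP s t; first exact: sgn bst.
  by apply: (sgn t s) => //; rewrite mulrC.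
pose m := (g + d) / 2; have gm : g < m < d by rewrite /m; apply/andP; split; lra.
have H s : g <= s <= d -> 0 <= b m * b s.
  move=> /andP[]; rewrite le_eqVlt => /predU1P[<- _|gs]; first by rewrite bg mulr0.
  rewrite le_eqVlt => /predU1P[->|sd]; first by rewrite bd mulr0.
  by apply/ltW/sgn => //; rewrite gs.
have [bm|bm] := ltP 0 (b m).
  by left => s /H; rewrite pmulr_rge0// => ?; rewrite ger0_norm.
have {}bm : b m < 0 by rewrite lt_neqAle bm andbT; apply/eqP; exact: nz.
by right => s /H; rewrite nmulr_rge0// => ?; rewrite ler0_norm.
Qed.

Lemma excursion_coding : exists h : coding_fun R, forall t, h t = normalised_excursion b t.
Proof.
have [/andP[g0 g1] bg _] := last_zeroP.
have nE t : normalised_excursion b t = `|b (g + t * (d - g))| / Num.sqrt (d - g) by [].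
have ge0 : {in `[0, 1], forall t, 0 <= normalised_excursion b t}.
  by move=> t _; rewrite divr_ge0// sqrtr_ge0.
have [dg|gd] := leP d g.
  have X0 := excursion_degenerate dg.
  have c : {within `[0, 1], continuous (normalised_excursion b)}.
    rewrite (_ : normalised_excursion b = fun=> 0); last exact/funext.
    by apply: continuous_subspaceT => x; exact: cvg_cst.
  by exists (CodingFun c ge0 (X0 0) (X0 1)).
have [bd _] := excursion_sign gd.
have e0 : normalised_excursion b 0 = 0 by rewrite nE mul0r addr0 bg normr0 mul0r.
have e1 : normalised_excursion b 1 = 0.
  by rewrite nE mul1r (_ : g + (d - g) = d) ?bd ?normr0 ?mul0r//; lra.
have c : {within `[0, 1], continuous (normalised_excursion b)}.
  apply/subspace_continuousP => t; rewrite /= in_itv/= => /andP[t0 t1].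
  apply: cvgMl; apply/cvgrPdist_lt => e e_gt0.
  have D0 : 0 < d - g by lra.
  have gt : 0 <= g + t * (d - g) by rewrite addr_ge0// mulr_ge0// ltW.
  have [r r0 Hr] := halfline_continuity cb gt e_gt0.
  have rD : 0 < r / (d - g) by rewrite divr_gt0.
  rewrite near_withinE; apply: filterS (nbhsx_ballx t _ rD) => s ts; rewrite /= in_itv/= => /andP[s0 s1].
  apply: (le_lt_trans (ler_dist_dist _ _)); apply: Hr.
    by rewrite addr_ge0// mulr_ge0// ltW.
  rewrite -/last_zero -/next_zero.
  rewrite (_ : g + _ - _ = (t - s) * (d - g)); last by lra.
  by rewrite normrM (gtr0_norm D0) -ltr_pdivlMr.
by exists (CodingFun c ge0 e0 e1).
Qed.

(** The hypothesis concerns one rational interval at a time. After rescaling the segment to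
    [[0, 1]], [regular_upgrade] asks for finitely many of them, and the maximum of their thresholds
    is uniform. *)
Let regular_segment c : 0 <= c ->
  (forall i j m k, (i < j)%N -> exists n0, forall n, (n0 <= n)%N ->
     regular_at b c n.+1%:R^-1 k.+1%:R^-1 (i%:R / m.+1%:R) (j%:R / m.+1%:R)) ->
  forall (L : nat) eta, 0 < eta -> exists2 e0, 0 < e0 &
    forall e s t, 0 < e < e0 -> 0 <= s -> s <= t -> t <= L.+1%:R -> regular_at b c e eta s t.
Proof.
move=> c0 H L eta eta0; pose h u := 1 * b (0 + u * L.+1%:R).
have L0 : 0 < L.+1%:R :> R by rewrite ltr0n.
have cL : 0 <= c * L.+1%:R by rewrite mulr_ge0// ltW.
have q0 : 0 < (5 * (c * L.+1%:R) + 2)^-1 * eta by rewrite mulr_gt0 ?invr_gt0//; lra.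
have [K Kq] := inv_natS_lt q0.
have {Kq q0}KQ : (5 * (c * L.+1%:R) + 2) * K.+1%:R^-1 <= eta.
  by rewrite -ler_pdivlMl ?ltW//; lra.
have [n0 n0P] : exists n0 : nat -> nat -> nat, forall i j, (i < j)%N -> forall n, (n0 i j <= n)%N ->
    regular_at b c n.+1%:R^-1 K.+1%:R^-1 ((L.+1 * i)%:R / K.+1%:R) ((L.+1 * j)%:R / K.+1%:R).
  suff /choice[n0 H0] : forall i, exists n0 : nat -> nat, forall j, (i < j)%N -> forall n, (n0 j <= n)%N ->
    regular_at b c n.+1%:R^-1 K.+1%:R^-1 ((L.+1 * i)%:R / K.+1%:R) ((L.+1 * j)%:R / K.+1%:R).
    by exists n0.
  move=> i; suff /choice[n0 H0] : forall j, exists n0 : nat, (i < j)%N -> forall n, (n0 <= n)%N ->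
    regular_at b c n.+1%:R^-1 K.+1%:R^-1 ((L.+1 * i)%:R / K.+1%:R) ((L.+1 * j)%:R / K.+1%:R).
    by exists n0.
  move=> j; have [ij|ji] := ltnP i j; last by exists 0%N.
  by have [|n0 Hn] := H (L.+1 * i)%N (L.+1 * j)%N K K; [rewrite ltn_mul2l|exists n0].
pose N0 := \max_(i < K.+2) \max_(j < K.+2) n0 i j.
pose N := maxn K N0.
have regh n i j : (N <= n)%N -> (i <= j)%N -> (j <= K.+1)%N ->
    regular_at h (c * L.+1%:R) n.+1%:R^-1 K.+1%:R^-1 (i%:R / K.+1%:R) (j%:R / K.+1%:R).
  move=> Nn; rewrite leq_eqVlt => /predU1P[-> _|ij jK].
    by apply: regular_at_refl; rewrite invr_ge0.
  have iK : (i < K.+2)%N by rewrite ltnS (leq_trans (ltnW ij)).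
  have nn : (n0 i j <= n)%N.
    apply: leq_trans Nn; rewrite leq_max; apply/orP; right.
    apply: leq_trans (leq_bigmax (Ordinal iK)) => /=.
    exact: leq_trans (leq_bigmax (Ordinal (jK : (j < K.+2)%N))).
  have := n0P i j ij n nn.
  have E x : (L.+1 * x)%:R / K.+1%:R = 0 + x%:R / K.+1%:R * L.+1%:R :> R.
    by rewrite add0r natrM (mulrC L.+1%:R) mulrAC.
  by rewrite !E => /(regular_at_affine _ _ _ _ _ _ _ L0 ltr01); rewrite expr1n !mulr1 mul1r.
have up := regular_upgrade cL (leq_maxl _ _) KQ regh.
exists N.+1%:R^-1; first by rewrite invr_gt0.
move=> e s t eN s0 st tL.
have sE (x : R) : x = 0 + x / L.+1%:R * L.+1%:R by rewrite add0r divfK ?gt_eqF.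
rewrite (sE s) (sE t); apply/(regular_at_affine _ _ _ _ _ _ _ L0 ltr01).
rewrite expr1n !mulr1 mul1r; apply: up => //.
- by rewrite divr_ge0// ltW.
- by rewrite ler_pM2r ?invr_gt0.
- by rewrite ler_pdivrMr// mul1r.
Qed.

Lemma excursion_variation c (h : coding_fun R) : 0 <= c ->
  (forall i j m k, (i < j)%N -> exists n0, forall n, (n0 <= n)%N ->
     regular_at b c n.+1%:R^-1 k.+1%:R^-1 (i%:R / m.+1%:R) (j%:R / m.+1%:R)) ->
  (forall t, h t = normalised_excursion b t) ->
  (forall t, h t = 0) \/ variation_regular (double_coding h) (c * 4).
Proof.
move=> c0 H hE; have [dg|gd] := leP d g.
  by left => t; rewrite hE excursion_degenerate.
right; move=> eta eta0; have [/andP[g0 g1] bg _] := last_zeroP.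
have D0 : 0 < d - g by rewrite subr_gt0.
(* The factor 2 is that of [double_coding]; it gives [(d - g) * r ^+ 2 = 4], whence the rate
   [c * 4]. *)
pose r := 2 / Num.sqrt (d - g).
have sD : 0 < Num.sqrt (d - g) by rewrite sqrtr_gt0.
have r0 : 0 < r by rewrite divr_gt0.
have r2 : (d - g) * r ^+ 2 = 4.
  rewrite /r expr_div_n sqr_sqrtr ?(ltW D0)// mulrCA divff ?gt_eqF// mulr1 expr2; lra.
have r20 : 0 < r ^+ 2 by rewrite exprn_gt0.
have [C hC] := coding_bounded h.
have bC s : g <= s <= d -> `|b s| <= C%:R * Num.sqrt (d - g).
  move=> /andP[gs sd]; rewrite -ler_pdivrMr//.
  have := hC ((s - g) / (d - g)); rewrite hE /normalised_excursion -/last_zero -/next_zero.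
  rewrite divfK ?gt_eqF// (_ : g + (s - g) = s); last by lra.
  by apply; rewrite divr_ge0 ?ler_pdivrMr//; lra.
set C' := C%:R * _ in bC.
have C'0 : 0 <= C' by rewrite mulr_ge0// ltW.
pose L := Num.truncn d.
have dL : d <= L.+1%:R by apply/ltW/truncnS_gt.
(* Half of the error goes to the regularity of [b], half to a possible change of sign. *)
pose eta' := eta / r ^+ 2 / 2.
have eta'0 : 0 < eta' by rewrite !divr_gt0.
have [e1 e10 He1] := regular_segment c0 H L eta'0.
pose e2 := eta' / (C' *+ 2 + 1).
have C1 : 0 < C' *+ 2 + 1 by rewrite mulr2n; lra.
have e20 : 0 < e2 by rewrite divr_gt0.
exists (r * Num.min e1 e2); first by rewrite mulr_gt0// lt_min e10.
move=> e s t /andP[e0 ee] s0 st t1; pose e' := e / r.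
have e'0 : 0 < e' by rewrite divr_gt0.
have : e' < Num.min e1 e2 by rewrite /e' ltr_pdivrMr// mulrC.
rewrite lt_min => /andP[e'1 e'2].
have phiI u : s <= u <= t -> g <= g + u * (d - g) <= d.
  move=> /andP[su ut]; rewrite lerDl mulr_ge0 ?(ltW D0)//=; last by lra.
  by rewrite -lerBrDl ler_piMl ?(ltW D0)//; lra.
have /andP[gs _] : g <= g + s * (d - g) <= d by apply: phiI; rewrite lexx.
have /andP[_ td] : g <= g + t * (d - g) <= d by apply: phiI; rewrite lexx st.
have st' : g + s * (d - g) <= g + t * (d - g) by rewrite lerD2l ler_pM2r.
have rb : regular_at b c e' eta' (g + s * (d - g)) (g + t * (d - g)).
  by apply: He1 => //; [rewrite e'0|lra|lra].
have e'C : eta' + e' * (C' *+ 2) <= eta / r ^+ 2.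
  have : e' * (C' *+ 2 + 1) <= eta' by rewrite -ler_pdivlMr// ltW.
  by rewrite /eta' mulrDr mulr1; lra.
have e'C0 : 0 <= e' * (C' *+ 2) by rewrite mulr_ge0 ?mulrn_wge0// ltW.
have bC' u : g + s * (d - g) <= u <= g + t * (d - g) -> `|b u| <= C'.
  by move=> /andP[? ?]; apply: bC; apply/andP; split; lra.
have conv f : (forall u, g <= u <= d -> `|b u| = f u) ->
    regular_at f c e' (eta / r ^+ 2) (g + s * (d - g)) (g + t * (d - g)) ->
    regular_at (double_coding h) (c * 4) e eta s t.
  move=> bf /(regular_at_affine _ _ _ _ _ _ _ D0 r0).
  have -> : c * (d - g) * r ^+ 2 = c * 4 by rewrite -mulrA r2.
  have -> : r * e' = e by rewrite mulrC divfK ?gt_eqF.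
  have -> : eta / r ^+ 2 * r ^+ 2 = eta by rewrite divfK ?gt_eqF.
  apply: regular_at_eq => u ust /=; rewrite hE /normalised_excursion -/last_zero -/next_zero.
  by rewrite bf ?phiI// /r; rewrite mulrAC mulrA.
have [_ [pos|neg]] := excursion_sign gd.
  by apply: conv pos _; apply: regular_at_le rb; lra.
apply: conv neg _; apply: regular_at_le e'C _.
exact: regular_at_opp (ltW e'0) bC' rb.
Qed.

End PathExcursion.

(** * Measurability of the excursion and of its regularity *)

Section CountableMeasurability.
Context d (T : measurableType d) (R : realType).

Lemma measurable_exists (I : countType) (Q : I -> set T) :
  (forall i, measurable (Q i)) -> measurable [set w | exists i, Q i w].
Proof.
move=> mQ; rewrite (_ : [set w | _] = \bigcup_i Q i).
  by apply: countable_bigcup_measurable.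
by apply/seteqP; split => w [i]; [exists i|move=> _; exists i].
Qed.

Lemma measurable_forall (I : countType) (Q : I -> set T) :
  (forall i, measurable (Q i)) -> measurable [set w | forall i, Q i w].
Proof.
move=> mQ; rewrite (_ : [set w | _] = ~` [set w | exists i, (~` Q i) w]).
  by apply/measurableC/measurable_exists => i; exact: measurableC.
apply/seteqP; split => w /=; first by move=> Qw [i]; exact.
by move=> nQ i; apply: contrapT => nQi; apply: nQ; exists i.
Qed.

Lemma measurable_imply (A : Prop) (Q : set T) : (A -> measurable Q) -> measurable [set w | A -> Q w].
Proof.
move=> mQ; have [a|na] := pselect A.
  rewrite (_ : [set w | _] = Q); first exact: mQ.
  by apply/seteqP; split => w /=; [exact|].
by rewrite (_ : [set w | _] = setT)//; apply/seteqP; split => // w _ /na.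
Qed.

Lemma measurable_fun_ge (f : T -> R) : (forall x, measurable [set w | x <= f w]) ->
  measurable_fun setT f.
Proof.
move=> H; apply: (measurability (@RGenCInfty.G R)) => [|/= _ [_] [r] -> <-].
  exact: RGenCInfty.measurableE.
rewrite setTI (_ : _ @^-1` _ = [set w | r <= f w])//.
by apply/seteqP; split => w /=; rewrite in_itv/= andbT.
Qed.

Lemma measurable_fun_gt (f : T -> R) : (forall x, measurable [set w | x < f w]) ->
  measurable_fun setT f.
Proof.
move=> H; apply: (measurability (@RGenOInfty.G R)) => [|/= _ [_] [r] -> <-].
  exact: RGenOInfty.measurableE.
rewrite setTI (_ : _ @^-1` _ = [set w | r < f w])//.
by apply/seteqP; split => w /=; rewrite in_itv/= andbT.
Qed.

Lemma measurable_funV_ge0 (f : T -> R) : (forall w, 0 <= f w) -> measurable_fun setT f ->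
  measurable_fun setT (fun w => (f w)^-1).
Proof.
move=> f0 mf; apply: measurable_fun_ge => x; have [x0|x0] := leP x 0.
  rewrite (_ : [set w | _] = setT)//; apply/seteqP; split => // w _ /=.
  by apply: (le_trans x0); rewrite invr_ge0.
rewrite (_ : [set w | _] = [set w | 0 < f w] `&` [set w | f w <= x^-1]).
  by apply: measurableI; [exact: measurable_lt_set|exact: measurable_le_set].
apply/seteqP; split => w /=.
  move=> xf; have f1 : 0 < (f w)^-1 by exact: lt_le_trans xf.
  by rewrite -invr_gt0; split => //; rewrite -[leLHS]invrK lef_pV2 ?posrE.
by move=> [f1 fx]; rewrite -[leLHS]invrK lef_pV2 ?posrE ?invr_gt0.
Qed.

End CountableMeasurability.

Section ContinuousProcess.
Context d (T : measurableType d) (R : realType) (B : R -> T -> R).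
Hypothesis mB : forall t, 0 <= t -> measurable_fun setT (B t).
Hypothesis cB : forall w, {within `[0, +oo[, continuous (fun t => B t w)}.

(** By compactness and continuity, a zero exists in [[a, c]] exactly when the path comes arbitrarily
    close to 0 along a countable dense set of times. *)
Lemma measurable_zero_in a c : 0 <= a -> a <= c ->
  measurable [set w | exists s, a <= s <= c /\ B s w = 0].
Proof.
move=> a0 ac; pose q n : R := a + grid_time n * (c - a).
have qI n : a <= q n <= c.
  have /andP[h1 h2] := @grid_time_itv R n.
  rewrite lerDl mulr_ge0 ?subr_ge0//= -lerBrDl ler_piMl// subr_ge0//.
have q0 n : 0 <= q n by case/andP: (qI n) => h1 _; exact: le_trans h1.
rewrite (_ : [set w | _] = [set w | forall j, exists n, `|B (q n) w| < j.+1%:R^-1]).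
  apply: measurable_forall => j; apply: measurable_exists => n.
  by apply: measurable_lt_set => //; apply: measurableT_comp => //; exact: mB.
apply/seteqP; split => w /=.
  move=> [s [/andP[as_ sc] Bs]] j; have j0 : 0 < j.+1%:R^-1 :> R by rewrite invr_gt0.
  have s0 := le_trans a0 as_.
  have [r r0 Hr] := halfline_continuity (@cB w) s0 j0.
  have [u Iu sE] : exists2 u, 0 <= u <= 1 & s = a + u * (c - a).
    have [ca|ca] := eqVneq c a; first by exists 0; rewrite ?lexx ?ler01//; lra.
    have ca' : 0 < c - a by rewrite subr_gt0 lt_neqAle eq_sym ca.
    exists ((s - a) / (c - a)); last by rewrite divfK ?gt_eqF//; lra.
    by rewrite divr_ge0 ?ler_pdivrMr//; lra.
  have ca1 : 0 < c - a + 1 by lra.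
  have [n un] := grid_time_dense Iu (divr_gt0 r0 ca1).
  exists n; have := Hr (q n) (q0 n); rewrite Bs sub0r normrN; apply.
  rewrite sE /q (_ : _ - _ = (u - grid_time n) * (c - a)); last by lra.
  rewrite normrM (ger0_norm (x := c - a)) ?subr_ge0//.
  move: un; rewrite ltr_pdivlMr// => un; apply: le_lt_trans un.
  by apply: ler_wpM2l => //; lra.
move=> H; have [n nP] := choice H.
have [U UU UN] := ultra_nat; have UP : ProperFilter U by exact: ultra_proper.
have [|l] := @ultra_cvg R R nat U `[a, c]%classic (fun j => q (n j)) UU (@segment_compact _ _ _).
  by move=> j /=; rewrite in_itv/=; exact: qI.
rewrite /= in_itv/= => lac Hl; exists l; split => //.
apply/eqP; rewrite -normr_le0; apply: le_of_forall_add => /= e e0.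
have e2 : 0 < e / 2 by rewrite divr_gt0.
have l0 : 0 <= l by case/andP: lac => h1 _; exact: le_trans h1.
have [r r0 Hr] := halfline_continuity (@cB w) l0 e2; have [k ke] := inv_natS_lt e2.
have [j [/= jl jk]] := filter_ex (filterI (Hl _ r0) (UN k)).
have := Hr _ (q0 _) jl; have := nP j.
have : j.+1%:R^-1 <= k.+1%:R^-1 :> R by rewrite lef_pV2 ?posrE// ler_nat.
have := ler_normD (B l w - B (q (n j)) w) (B (q (n j)) w); rewrite subrK.
by move: (j.+1%:R^-1) (k.+1%:R^-1) ke => x y; lra.
Qed.

(** Rounded down to a mesh, [tau] takes countably many values; continuity of the paths gives the
    limit. *)
Lemma measurable_at_time (tau : T -> R) : measurable_fun setT tau -> (forall w, 0 <= tau w) ->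
  measurable_fun setT (fun w => B (tau w) w).
Proof.
move=> mt t0; pose k (n : nat) w := Num.truncn (tau w * n.+1%:R).
have kP n w : (k n w)%:R / n.+1%:R <= tau w < (k n w)%:R / n.+1%:R + n.+1%:R^-1.
  have := @truncn_itv R (tau w * n.+1%:R); rewrite mulr_ge0// => /(_ isT)/andP[h1 h2].
  rewrite ler_pdivrMr// h1 /= -[X in _ + X]mul1r -mulrDl ltr_pdivlMr//.
  by move: h2; rewrite -(natr1 (Num.truncn _)).
apply: (@measurable_fun_cvg _ _ _ setT (fun n w => B ((k n w)%:R / n.+1%:R) w)) => [n|w _].
  move=> _ A mA; rewrite setTI.
  rewrite (_ : _ @^-1` _ = [set w | exists i, ([set w | i%:R <= tau w * n.+1%:R] `&`
     [set w | tau w * n.+1%:R < i.+1%:R] `&` (B (i%:R / n.+1%:R) @^-1` A)) w]).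
    apply: measurable_exists => i; apply: measurableI.
      have mtn : measurable_fun setT (fun w => tau w * n.+1%:R) by exact: measurable_funM.
      by apply: measurableI; [exact: measurable_le_set|exact: measurable_lt_set].
    by rewrite -[X in measurable X]setTI; apply: mB => //; rewrite divr_ge0.
  apply/seteqP; split => w /=.
    move=> Aw; exists (k n w); split => //.
    have := @truncn_itv R (tau w * n.+1%:R); rewrite mulr_ge0// => /(_ isT)/andP[h1 h2].
    by split.
  by move=> [i [[h1 h2]]]; have -> : k n w = i by apply: truncn_def; rewrite h1.
apply/cvgrPdist_lt => e e0; have [r r0 Hr] := halfline_continuity (@cB w) (t0 w) e0.
have [N Nr] := inv_natS_lt r0.
exists N => // n /= Nn; apply: Hr; first by rewrite divr_ge0.
have /andP[h1 h2] := kP n w.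
have : n.+1%:R^-1 <= N.+1%:R^-1 :> R by rewrite lef_pV2 ?posrE// ler_nat.
rewrite ger0_norm ?subr_ge0//; move: (_ / _) h1 h2 => z; move: (n.+1%:R^-1) (N.+1%:R^-1) Nr => x y.
by lra.
Qed.

Hypothesis B0 : forall w, B 0 w = 0.

Lemma measurable_last_zero : measurable_fun setT (fun w => last_zero (fun t => B t w)).
Proof.
apply: measurable_fun_ge => x; have [x1|x1] := leP x 1; last first.
  rewrite (_ : [set w | _] = set0)//; apply/seteqP; split => // w /=.
  by have [/andP[_ h1] _ _] := last_zeroP (B0 w) (@cB w); lra.
have [x0|x0] := leP x 0.
  rewrite (_ : [set w | _] = setT)//; apply/seteqP; split => // w _ /=.
  by have [/andP[h0 h1] _ _] := last_zeroP (B0 w) (@cB w); lra.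
rewrite (_ : [set w | _] = [set w | exists s, x <= s <= 1 /\ B s w = 0]).
  by apply: measurable_zero_in => //; exact: ltW.
apply/seteqP; split => w /=; have [/andP[h0 h1] Bg H] := last_zeroP (B0 w) (@cB w).
  by move=> xg; exists (last_zero (fun t => B t w)); rewrite xg.
move=> [s [/andP[xs s1] Bs]]; apply: (le_trans xs); apply: H => //.
by rewrite s1 (le_trans (ltW x0) xs).
Qed.

Lemma measurable_next_zero : measurable_fun setT (fun w => next_zero (fun t => B t w)).
Proof.
have next w s : 1 <= s -> B s w = 0 -> [/\ 1 <= next_zero (fun t => B t w),
    B (next_zero (fun t => B t w)) w = 0 & next_zero (fun t => B t w) <= s].
  move=> s1 Bs; have [|h1 h2 h3] := next_zeroP (@cB w); first by exists s.
  by split => //; exact: h3.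
have none w : ~ (exists s, 1 <= s /\ B s w = 0) -> next_zero (fun t => B t w) = 0.
  exact: next_zero_none.
(* Without a zero after time 1, [next_zero] is 0, the infimum of the empty set; so for [x >= 0] the
   event also asserts that a zero exists. *)
apply: measurable_fun_gt => x; have [x0|x0] := ltP x 0.
  rewrite (_ : [set w | _] = setT)//; apply/seteqP; split => // w _ /=.
  have [[s [s1 Bs]]|/none ->//] := pselect (exists s, 1 <= s /\ B s w = 0).
  by have [? _ _] := next w s s1 Bs; lra.
pose m := Num.max 1 x.
have mm : measurable [set w | exists n : nat, exists s, 1 <= s <= n.+1%:R /\ B s w = 0].
  by apply: measurable_exists => n; apply: measurable_zero_in => //; rewrite ler1n.
have mE w : (exists n : nat, exists s, 1 <= s <= n.+1%:R /\ B s w = 0) <->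
    exists s, 1 <= s /\ B s w = 0.
  split; first by move=> [n [s [/andP[s1 _] Bs]]]; exists s.
  move=> [s [s1 Bs]]; exists (Num.truncn s), s; split => //.
  by rewrite s1 ltW// truncnS_gt.
have [x1|x1] := ltP x 1.
  rewrite (_ : [set w | x < _] = [set w | exists n : nat, exists s, 1 <= s <= n.+1%:R /\ B s w = 0])//.
  apply/seteqP; split => w /=.
    by move=> xd; apply/mE; apply: contrapT => /none d0; rewrite d0 in xd; lra.
  by move/mE => [s [s1 Bs]]; have [? _ _] := next w s s1 Bs; lra.
rewrite (_ : [set w | x < _] = [set w | exists n : nat, exists s, 1 <= s <= n.+1%:R /\ B s w = 0] `\`
   [set w | exists s, 1 <= s <= x /\ B s w = 0]).
  by apply: measurableD => //; apply: measurable_zero_in => //; lra.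
apply/seteqP; split => w /=.
  move=> xd; split.
    by apply/mE; apply: contrapT => /none d0; rewrite d0 in xd; lra.
  by move=> [s [/andP[s1 sx] Bs]]; have [_ _ ?] := next w s s1 Bs; lra.
move=> [/mE[s [s1 Bs]] nx]; have [d1 Bd _] := next w s s1 Bs.
by rewrite ltNge; apply/negP => dx; apply: nx; exists (next_zero (fun t => B t w)); rewrite d1.
Qed.

Lemma measurable_excursion t : 0 <= t <= 1 ->
  measurable_fun setT (fun w => normalised_excursion (fun s => B s w) t).
Proof.
move=> /andP[t0 t1].
have mg := measurable_last_zero; have md := measurable_next_zero.
pose g w := last_zero (fun s => B s w); pose dd w := next_zero (fun s => B s w).
have mD : measurable_fun setT (fun w => dd w - g w) by exact: measurable_funB.
rewrite (_ : (fun w => _) = (fun w => `|B (g w + t * (dd w - g w)) w| * (Num.sqrt (dd w - g w))^-1))//.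
apply: measurable_funM; last first.
  apply: measurable_funV_ge0 => [w|]; first exact: sqrtr_ge0.
  have ms : measurable_fun setT (Num.sqrt : R -> R).
    by apply: continuous_measurable_fun; exact: sqrt_continuous.
  exact: (measurableT_comp ms mD).
apply: measurableT_comp => //; apply: measurable_at_time.
  by apply: measurable_funD => //; exact: measurable_funM.
move=> w; rewrite /g /dd; have [/andP[g0 g1] _ _] := last_zeroP (B0 w) (@cB w).
have [/(next_zeroP (@cB w))[d1 _ _]|/next_zero_none ->] :=
  pselect (exists s, 1 <= s /\ B s w = 0).
  by rewrite addr_ge0// mulr_ge0// subr_ge0; exact: le_trans d1.
(* With [next_zero] equal to 0 the evaluation time is [g - t * g], still nonnegative. *)
by rewrite sub0r mulrN subr_ge0 ler_piMl.
Qed.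

End ContinuousProcess.

Section GridMeasurability.
Context {R : realType}.
Implicit Types c : R.

Lemma measurable_sampled_usum k m e l :
  measurable_fun [set: realseq R] (fun x : realseq R => sampled_usum x k m e l).
Proof.
elim: l => [|p l IH].
  rewrite (_ : (fun x => _) = fun=> 0); first exact: measurable_cst.
  by apply/funext => x; rewrite /sampled_usum usum_nil.
rewrite (_ : (fun x => _) = (fun x : realseq R => x (pickle (p.2, refine k m)) -
    x (pickle (p.1, refine k m)) - e + sampled_usum x k m e l)); last first.
  by apply/funext => x; rewrite /sampled_usum usum_cons.
apply: measurable_funD => //; apply: measurable_funB; last exact: measurable_cst.
by apply: measurable_funB; exact: measurable_coord.
Qed.

Lemma measurable_grid_cond c k N : measurable ([set x | grid_cond c k N x] : set (realseq R)).
Proof.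
have mc : forall a : R, measurable_fun [set: realseq R] (fun=> a) by move=> a; exact: measurable_cst.
rewrite (_ : [set x | _] = [set x | forall n, x n <= N%:R] `&`
    [set x | forall n n', `|grid_time n - grid_time n'| <= N.+1%:R^-1 :> R ->
       `|x n - x n'| <= k.+1%:R^-1] `&`
    [set x | forall n i j m l, (N <= n)%N -> (i <= j)%N -> (j <= k.+1)%N ->
        adm (i * m.+1)%N (j * m.+1)%N l ->
        n.+1%:R^-1 * sampled_usum x k m n.+1%:R^-1 l <= (c * (j%:R - i%:R) + 1) / k.+1%:R] `&`
    [set x | forall n i j, (N <= n)%N -> (i <= j)%N -> (j <= k.+1)%N ->
        exists m l, adm (i * m.+1)%N (j * m.+1)%N l /\
          (c * (j%:R - i%:R) - 1) / k.+1%:R <= n.+1%:R^-1 * sampled_usum x k m n.+1%:R^-1 l]);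
  last by apply/seteqP; split => x /= []; [move=> ? ? ? ?; do ![split]|move=> [[? ?] ?] ?; split].
have mu k' m n l : measurable_fun [set: realseq R]
    (fun x : realseq R => n.+1%:R^-1 * sampled_usum x k' m n.+1%:R^-1 l).
  by apply: measurable_funM => //; exact: measurable_sampled_usum.
apply: measurableI; [apply: measurableI; [apply: measurableI|]|].
- by apply: measurable_forall => n; apply: measurable_le_set => //; exact: measurable_coord.
- apply: measurable_forall => n; apply: measurable_forall => n'.
  apply: measurable_imply => _; apply: measurable_le_set => //; apply: measurableT_comp => //.
  by apply: measurable_funB; exact: measurable_coord.
- do 5![apply: measurable_forall => ?]; do 4![apply: measurable_imply => ?].
  exact: measurable_le_set.
- do 3![apply: measurable_forall => ?]; do 3![apply: measurable_imply => ?].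
  do 2![apply: measurable_exists => ?]; apply: measurableI; last exact: measurable_le_set.
  have mb (A : bool) : measurable ([set _ | A] : set (realseq R)).
    case: A; first by have -> : [set _ | true] = setT :> set (realseq R) by apply/seteqP.
    have -> : [set _ | false] = set0 :> set (realseq R) by apply/seteqP; split.
    exact: measurable0.
  exact: mb.
Qed.

Lemma measurable_seq_zero : measurable ([set x | forall n, x n = 0] : set (realseq R)).
Proof.
apply: measurable_forall => n.
rewrite [X in measurable X](_ : _ = [set x : realseq R | x n <= 0] `&` [set x : realseq R | 0 <= x n]).
  by apply: measurableI; apply: measurable_le_set => //; exact: measurable_coord.
by apply/seteqP; split => x /=; [move=> ->|move=> [a b]; apply/eqP; rewrite eq_le a].
Qed.

End GridMeasurability.

(** [F k N] is the failure of condition [k] with constant [N]. Choosing [f j k] so that it has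
    probability at most [2^-1 ^+ (j + k).+1], the failures for a given [j] have total probability at
    most [2^-1 ^+ j]. *)
Lemma egorov_countable d (T : measurableType d) (R : realType) (P : probability T R)
    (F : nat -> nat -> set T) :
  (forall k N, measurable (F k N)) -> (forall k N N', (N <= N')%N -> F k N' `<=` F k N) ->
  (forall k, P (\bigcap_N F k N) = 0%E) ->
  exists f : nat -> nat -> nat, P.-negligible (\bigcap_j \bigcup_k F k (f j k)).
Proof.
move=> mF dF F0.
have fP j k : exists N, (P (F k N) <= (2^-1 ^+ (j + k).+1)%:E)%E.
  have cv : P \o F k @ \oo --> P (\bigcap_N F k N).
    apply: nonincreasing_cvg_mu => //.
    - by apply: (@le_lt_trans _ _ 1%E); [exact: probability_le1|rewrite ltry].
    - exact: bigcapT_measurable.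
    - by move=> N N' NN; apply/subsetPset; exact: dF.
  rewrite F0 in cv; have e0 : 0 < 2^-1 ^+ (j + k).+1 :> R by rewrite exprn_gt0.
  have /fine_cvgP[_ /cvgrPdist_lt/(_ _ e0)[N _ HN]] := cv.
  exists N; have := HN N (leqnn N); rewrite /= sub0r normrN => /ltW /ler_normlW H.
  have Pf : P (F k N) \is a fin_num by rewrite fin_num_measure.
  by rewrite -(fineK Pf) lee_fin.
have [f0 f0P] := choice (fun jk : nat * nat => fP jk.1 jk.2).
exists (fun j k => f0 (j, k)).
have mU j : measurable (\bigcup_k F k (f0 (j, k))) by exact: bigcupT_measurable.
exists (\bigcap_j \bigcup_k F k (f0 (j, k))); split => //; first exact: bigcapT_measurable.
apply/eqP; rewrite eq_le measure_ge0 andbT; apply/lee_addgt0Pr => e e0; rewrite add0e.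
have [j je] : exists j, 2^-1 ^+ j <= e.
  have /cvgrPdist_lt/(_ _ e0)[j _ Hj] : (2^-1 : R) ^+ n @[n --> \oo] --> 0.
    by apply: cvg_expr; rewrite ger0_norm; lra.
  by exists j; have := Hj j (leqnn j); rewrite sub0r normrN ger0_norm ?exprn_ge0// => /ltW.
apply: (@le_trans _ _ (P (\bigcup_k F k (f0 (j, k))))).
  apply: le_measure; rewrite ?inE//; first exact: bigcapT_measurable.
  by move=> w /(_ j I).
apply: (le_trans (@measure_sigma_subadditive _ _ _ P _ (fun k => F k (f0 (j, k))) _ (mU j) _)) => //.
apply: (@le_trans _ _ (\sum_(0 <= k <oo) (2^-1 ^+ (j + k).+1)%:E)%E).
  by apply: lee_nneseries => // k _; exact: (f0P (j, k)).
apply: le_trans (_ : _ <= (2^-1 ^+ j)%:E)%E _; last by rewrite lee_fin.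
apply: lime_le; first by apply: is_cvg_nneseries => k _ _; rewrite lee_fin exprn_ge0.
apply: nearW => n; rewrite sumEFin lee_fin.
suff -> : \sum_(0 <= k < n) 2^-1 ^+ (j + k).+1 = 2^-1 ^+ j - 2^-1 ^+ (j + n) :> R.
  by rewrite gerBl exprn_ge0.
elim: n => [|n IH]; first by rewrite big_geq// addn0 subrr.
by rewrite big_nat_recr//= IH addnS (exprS _ (j + n)); lra.
Qed.

(** * Transfer to the excursion and conclusion *)

Section LawTransfer.
Context {R : realType} d (T : measurableType d) (P : probability T R)
  (X : T -> coding_fun R).
Hypothesis hX : brownian_excursion P X.

Definition sample (h : coding_fun R) : realseq R := double_coding h \o grid_time.

Lemma measurable_sample : measurable_fun setT (sample \o X).
Proof.
apply: measurable_fun_realseq => n; case: hX => mX _.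
by apply: measurable_funM => //; apply: mX; exact: grid_time_itv.
Qed.

(* The second conjunct sets aside the paths on which the construction of the     *)
(* excursion degenerates to zero, so that this event need not be shown null.     *)
Lemma excursion_regular : exists2 c, 0 < c & forall k,
  P [set w | (forall N, ~ grid_cond c k N (sample (X w))) /\
             ~ (forall n, sample (X w) n = 0)] = 0%E.
Proof.
have mS := measurable_sample.
case: hX => mX [d' [T' [P' [B [hB law]]]]].
have [B0 cB _ _] := hB.
exists (rate B * 4); first by rewrite mulr_gt0// rate_gt0.
move=> k; set c := rate B * 4.
pose G : set (realseq R) := [set x | (forall N, ~ grid_cond c k N x) /\ ~ (forall n, x n = 0)].
have mG : measurable G.
  apply: measurableI.
    by apply: measurable_forall => N; apply: measurableC; exact: measurable_grid_cond.
  exact: measurableC measurable_seq_zero.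
pose Y w : realseq R := fun n => 2 * normalised_excursion (fun s => B s w) (grid_time n).
have mB t : 0 <= t -> measurable_fun setT (B t) by [].
have mY : measurable_fun setT Y.
  apply: measurable_fun_realseq => n; apply: measurable_funM => //.
  exact: measurable_excursion mB cB B0 _ (grid_time_itv n).
pose S : {mfun T >-> realseq R} := mfun_Sub (mem_set mS).
pose S' : {mfun T' >-> realseq R} := mfun_Sub (mem_set mY).
have -> : P [set w | (forall N, ~ grid_cond c k N (sample (X w))) /\
    ~ (forall n, sample (X w) n = 0)] = distribution P S G by [].
(* Equal finite-dimensional marginals make the two laws on sequences agree on cylinders, hence on
   [G]. *)
have -> : distribution P S G = distribution P' S' G.
  apply: seq_measure_unique => //.
    by apply: (@le_lt_trans _ _ 1%E); [exact: probability_le1|rewrite ltry].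
  move=> _ [n [A [mA ->]]].
  have mA' i : measurable ((fun x : R => 2 * x) @^-1` A i).
    by rewrite -[X in measurable X]setTI; apply: measurable_funM.
  have := law n (fun i => grid_time i) (fun i => (fun x => 2 * x) @^-1` A i)
    (fun i => grid_time_itv i) (fun i => mA' i).
  rewrite /distribution /pushforward /=.
  by congr (_ = _); congr (_ _); apply/seteqP; split => w /= H;
    [move=> i ni; exact: (H (Ordinal ni))|move=> i; exact: H|
     move=> i ni; exact: (H (Ordinal ni))|move=> i; exact: H].
have c0 : 0 <= rate B by exact/ltW/rate_gt0.
(* One null set for each pair of rational end points and each tolerance: countably many in all. *)
have bad q : P'.-negligible [set w | let: (i, j, m, k) := q in (i < j)%N /\
    ~ exists n0, forall n, (n0 <= n)%N ->
      regular_at (fun t => B t w) (rate B) n.+1%:R^-1 k.+1%:R^-1 (i%:R / m.+1%:R) (j%:R / m.+1%:R)].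
  case: q => [[[i j] m] k']; have [ij|ji] := ltnP i j; last first.
    by apply: (negligibleS _ (negligible_set0 P')) => w [].
  have ij' : i%:R / m.+1%:R < j%:R / m.+1%:R :> R by rewrite ltr_pM2r ?invr_gt0// ltr_nat.
  have i0 : 0 <= i%:R / m.+1%:R :> R by rewrite divr_ge0.
  have k0 : 0 < k'.+1%:R^-1 :> R by rewrite invr_gt0.
  by apply: negligibleS (brownian_regular hB i0 ij' k0) => w [].
have /negligibleP : P'.-negligible (Y @^-1` G).
  have nU := negligible_bigcup (fun n => bad (odflt (0%N, 0%N, 0%N, 0%N) (unpickle n))).
  apply: negligibleS nU => w [nG nz]; apply: contrapT => nb.
  have reg i j m k' : (i < j)%N -> exists n0, forall n, (n0 <= n)%N ->
      regular_at (fun t => B t w) (rate B) n.+1%:R^-1 k'.+1%:R^-1 (i%:R / m.+1%:R) (j%:R / m.+1%:R).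
    move=> ij; apply: contrapT => nr; apply: nb; exists (pickle (i, j, m, k')); first exact: I.
    by rewrite pickleK.
  have [h hE] := excursion_coding (B0 w) (@cB w).
  have YE : Y w = sample h by apply/funext => n; rewrite /sample /= hE.
  have [h0|hv] := excursion_variation (B0 w) (@cB w) c0 reg hE.
    by apply: nz => n; rewrite YE /sample /= h0 mulr0.
  by have [N HN] := variation_regular_grid hv k; apply: (nG N); rewrite YE.
have mYG : measurable (Y @^-1` G) by have := mY measurableT _ mG; rewrite setTI.
by move=> /(_ mYG).
Qed.

End LawTransfer.

Lemma coding_grid_zero (R : realType) (h : coding_fun R) :
  (forall n, h (grid_time n) = 0) -> forall t, 0 <= t <= 1 -> h t = 0.
Proof.
move=> h0 t It; apply/eqP; rewrite -normr_le0; apply: le_of_forall_add => /= e e0.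
have [r r0 Hr] := coding_cont h It e0; have [n tn] := grid_time_dense It r0.
by have := Hr _ (grid_time_itv n) tn; rewrite h0 subr0 add0r => /ltW.
Qed.

Lemma coded_tree_zero (R : realType) (h : coding_fun R) :
  (forall t, 0 <= t <= 1 -> h t = 0) <-> forall x : coded_tree h, x = point.
Proof.
split=> [h0 x|H t It]; last by rewrite -mdist_root// (H (code_proj h t)) mdistxx.
have [t It <-] := code_proj_surj x; apply: (@mdist_positivity R).
by rewrite metric_sym mdist_root// h0.
Qed.

Lemma isometric_zero (R : realType) (h h' : coding_fun R) :
  isometric (coded_rtree h) (coded_rtree h') ->
  (forall t, 0 <= t <= 1 -> h t = 0) -> forall t, 0 <= t <= 1 -> h' t = 0.
Proof.
move=> [f [[g fK gK] _ fp]] /coded_tree_zero H; apply/coded_tree_zero => y.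
by rewrite -(gK y) (H (g y)).
Qed.

(** The only subsets of a one-point tree are the empty set and the tree, so two probability measures
    on it agree. *)
Lemma misometric_zero (R : realType) (h h' : coding_fun R) :
  isometric (coded_rtree h) (coded_rtree h') ->
  (forall t, 0 <= t <= 1 -> h' t = 0) -> misometric (coded_mrtree h) (coded_mrtree h').
Proof.
move=> [f fi] /coded_tree_zero H; exists f => // A mA.
have [A0|/set0P[y Ay]] := eqVneq A set0; first by rewrite A0 preimage_set0 !measure0.
have -> : A = setT by apply/seteqP; split => // z _; rewrite (H z) -(H y).
rewrite preimage_setT.
by rewrite (probability_setT (mass_measure h')) (probability_setT (mass_measure h)).
Qed.

Theorem proposition1p6 (R : realType) (d : measure_display)
    (Omega : measurableType d) (P : probability Omega R)
    (Bex : Omega -> coding_fun R) (hBex : brownian_excursion P Bex) :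
  exists2 Phi : rtree_class R -> mrtree_class R,
    GH_GHP_measurable Phi &
    {ae P, forall w,
      Phi (rtree_cls (coded_rtree (double_coding (Bex w)))) =
        mrtree_cls (coded_mrtree (double_coding (Bex w)))}.
Proof.
have [c c0 cP] := excursion_regular hBex.
have mS := measurable_sample hBex.
pose F k N := [set w | ~ grid_cond c k N (sample (Bex w)) /\ ~ (forall n, sample (Bex w) n = 0)].
have [] := @egorov_countable _ _ _ P F.
- move=> k N; have mG : measurable ([set x | ~ grid_cond c k N x /\ ~ (forall n, x n = 0)] : set (realseq R)).
    by apply: measurableI; apply: measurableC; [exact: measurable_grid_cond|exact: measurable_seq_zero].
  by have := mS measurableT _ mG; rewrite setTI.
- by move=> k N N' NN w [nG nz]; split => // G; apply: nG; exact: grid_cond_le G.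
- move=> k; rewrite -(cP k); congr (P _); apply/seteqP; split => w /=.
    by move=> H; split => [N|]; [have [] := H N I|have [] := H 0%N I].
  by move=> [nG nz] N _; split => //; exact: nG.
move=> f fP.
have [f' f'P] := choice (fun j => grid_regular (f j) (ltW c0)).
(* A path vanishing on [0, 1] cannot be regular with a positive rate, so such paths make up family 0
   and the regular families are shifted by one. *)
pose S j : set (coding_fun R) :=
  if j is j'.+1 then regular_family c (f' j') else [set h | forall t, 0 <= t <= 1 -> h t = 0].
(* The selection needs some path for its default value; a probability space is not empty. *)
have [w0|noW] := pselect (exists w : Omega, True); last first.
  exfalso; have := probability_setT P; rewrite (_ : setT = set0) ?measure0.
    by move/eqP; rewrite eq_sym onee_eq0.
  by apply/seteqP; split => // w _; apply: noW; exists w.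
case: w0 => w0 _.
have compactS j (u : nat -> coding_fun R) : (forall n, S j (u n)) ->
    exists2 h, S j h & forall (e : R) N, 0 < e ->
      exists2 n, (N <= n)%N & forall t, 0 <= t <= 1 -> `|h t - u n t| <= e.
  case: j => [|j] uS; last exact: regular_family_compact.
  exists (u 0%N) => // e N e0; exists N => // t It.
  by rewrite (uS 0%N) ?(uS N)// subrr normr0 ltW.
have detS h h' j j' : S j h -> S j' h' ->
    isometric (coded_rtree h) (coded_rtree h') -> misometric (coded_mrtree h) (coded_mrtree h').
  (* In the mixed cases, a tree isometric to a one-point tree comes from a vanishing path as
     well. *)
  case: j j' => [|j] [|j'] Sh Sh' hh'; try exact: misometric_zero.
    by apply: misometric_zero => //; exact: isometric_zero hh' Sh.
  by apply: (isometric_misometric c0) => //; exact: regular_family_variation (_ : regular_family c _ _).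
have [Phi mPhi PhiP] := measurable_selection (Bex w0) compactS detS.
exists Phi => //; apply: negligibleS fP => w nw j _.
apply: contrapT => nF; apply: nw.
have [z|nz] := pselect (forall n, sample (Bex w) n = 0).
  by apply: (PhiP 0%N); exact: coding_grid_zero.
apply: (PhiP j.+1) => /=; apply: f'P => k; apply: contrapT => nG.
by apply: nF; exists k.
Qed.
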